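(* If $K$ is a compact set in $\mathbb R^3$ and $\mathcal T_K=K\times i\mathbb R^3\subset\mathbb C^3$, then $$\widehat{(\mathcal T_K)}_{\mathfrak N^*}=\widehat K_{\mathfrak M}\times i\mathbb R^3,$$ where $\widehat{(\mathcal T_K)}_{\mathfrak N^*}$ is the current null hull of $\mathcal T_K$ and $\widehat K_{\mathfrak M}$ is the minimal hull of $K$.
   Context: $\pi\colon\mathbb C^3\to\mathbb R^3$ is the projection $\pi(x+iy)=x$. Subharmonic functions are allowed to be identically $-\infty$. Minimal hull: an upper semicontinuous function $u\colon\omega\to\mathbb R\cup\{-\infty\}$ on a domain $\omega\subset\mathbb R^n$ ($n\ge3$) is minimal plurisubharmonic if its restriction to any affine $2$-dimensional plane $L\subset\mathbb R^n$ is subharmonic on $L\cap\omega$ in any isothermal linear coordinates on $L$ (coordinates $(y_1,y_2)$ given by $x=a+y_1v_1+y_2v_2$ with $a\in L$ and $v_1,v_2$ orthogonal of equal nonzero length); the set of such functions is $\mathfrak M\mathrm{Psh}(\omega)$. The minimal hull of a compact set $K\subset\mathbb R^n$ is $\widehat K_{\mathfrak M}=\{x\in\mathbb R^n: u(x)\le\sup_K u\ \ \forall u\in\mathfrak M\mathrm{Psh}(\mathbb R^n)\}$. Null positive currents: let $\mathfrak A^*=\{z\in\mathbb C^3\setminus\{0\}: z_1^2+z_2^2+z_3^2=0\}$. A (real) $2$-form $\alpha$ on $\mathbb C^3$ is null positive if $\langle\alpha(q),\nu\wedge J\nu\rangle\ge0$ for every point $q$ and every $\nu\in\mathfrak A^*$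 (identified with a tangent vector in $T_q\mathbb C^3$), where $J$ is the standard complex structure operator. A current $T$ of bidimension $(1,1)$ on $\mathbb C^3$ is null positive if $T(\alpha)\ge0$ for every null positive $2$-form $\alpha$ with compact support. $d^c=i(\overline\partial-\partial)$, $dd^c=2i\partial\overline\partial$, $(dd^cT)(u)=T(dd^cu)$ for test functions $u$, and $dd^cT\le0$ on an open set $U$ means $(dd^cT)(u)\le0$ for every nonnegative test function $u$ with compact support in $U$. Current null hull: for a compact set $K\subset\mathbb R^3$, $\widehat{(\mathcal T_K)}_{\mathfrak N^*}$ is the union of the supports of all null positive $(1,1)$-currents $T$ on $\mathbb C^3$ with finite mass such that $\pi(\mathrm{supp}\,T)\subset\mathbb R^3$ is a bounded set and $dd^cT\le0$ on $\mathbb C^3\setminus\mathcal T_K$. *)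

(* Defs.v *)
From HB Require Import structures.
From mathcomp Require Import all_boot all_order all_algebra.
From mathcomp Require Import complex.
From mathcomp Require Import all_classical all_reals all_analysis.

Set Implicit Arguments.
Unset Strict Implicit.
Unset Printing Implicit Defensive.

Import Order.TTheory GRing.Theory Num.Theory.
Import numFieldNormedType.Exports.

Local Open Scope classical_set_scope.
Local Open Scope ring_scope.
Local Open Scope complex_scope.

Definition dot (R : realType) (n : nat) (v w : 'rV[R]_n) : R :=
  \sum_(j < n) v 0 j * w 0 j.

(* Functions with values in R \cup {-oo} on D are extended-real functions that
   are < +oo on D; their values off D are irrelevant. *)

Definition usc_on (R : realType) (T : topologicalType) (D : set T)
    (u : T -> \bar R) : Prop :=
  forall x, D x -> forall a : R, (u x < a%:E)%E ->
    \forall y \near within D (nbhs x), (u y < a%:E)%E.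

Definition closed_disc (R : realType) (c : R * R) (r : R) : set (R * R) :=
  [set p | (p.1 - c.1) ^+ 2 + (p.2 - c.2) ^+ 2 <= r ^+ 2].

(* Subharmonicity on an open subset D of R^2, by upper semicontinuity and the
   sub-mean value inequality on every closed disc in D.  The circle average
   is well defined in [-oo, +oo) since u is bounded above on circles. *)
Definition subharmonic_on (R : realType) (D : set (R * R))
    (u : R * R -> \bar R) : Prop :=
  [/\ forall p, D p -> (u p < +oo)%E,
      usc_on D u &
      forall (c : R * R) (r : R), 0 < r -> closed_disc c r `<=` D ->
        (u c <= ((2 * pi)^-1)%:E *
          \int[lebesgue_measure]_(t in `[0%R, (2 * pi)%R])
             u (c.1 + r * cos t, c.2 + r * sin t)%R)%E].

(* The point with isothermal coordinates p in the plane a + <v1, v2>. *)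
Definition plane_point (R : realType) (n : nat) (a v1 v2 : 'rV[R]_n)
    (p : R * R) : 'rV[R]_n :=
  a + p.1 *: v1 + p.2 *: v2.

Definition MPsh (R : realType) (n : nat) (omega : set 'rV[R]_n) :
    set ('rV[R]_n -> \bar R) :=
  [set u | [/\ forall x, omega x -> (u x < +oo)%E,
      usc_on omega u &
      forall a v1 v2 : 'rV[R]_n,
        v1 != 0 -> dot v1 v2 = 0 -> dot v1 v1 = dot v2 v2 ->
        subharmonic_on (plane_point a v1 v2 @^-1` omega)
          (u \o plane_point a v1 v2)]].

Definition minimal_hull (R : realType) (n : nat) (K : set 'rV[R]_n) :
    set 'rV[R]_n :=
  [set x | forall u, MPsh [set: 'rV[R]_n] u ->
    (u x <= ereal_sup [set u z | z in K])%E].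

(* The point x + iy of C^3 is the pair (x, y), so the projection pi to the real
   part is fst.  Tangent vectors of C^3 are again elements of C3 R. *)

Notation C3 R := ('rV[R]_3 * 'rV[R]_3)%type.

Definition J (R : realType) (v : C3 R) : C3 R := (- v.2, v.1).

(* The Euclidean norm; `|v| is the maximum norm. *)
Definition enorm (R : realType) (v : C3 R) : R :=
  Num.sqrt (dot v.1 v.1 + dot v.2 v.2).

Definition null_vector (R : realType) (v : C3 R) : Prop :=
  v != 0 /\ \sum_(j < 3) (v.1 0 j +i* v.2 0 j) ^+ 2 = 0 :> R[i].

Definition iter_derive (R : realType) (vs : seq (C3 R)) (u : C3 R -> R) :
    C3 R -> R :=
  foldr (fun v f => fun q => 'D_v f q) u vs.

Definition smooth (R : realType) (u : C3 R -> R) : Prop :=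
  forall (vs : seq (C3 R)) (q : C3 R), differentiable (iter_derive vs u) q.

Definition fun_supp (R : realType) (u : C3 R -> R) : set (C3 R) :=
  closure [set q | u q != 0].

Definition test_fun (R : realType) (u : C3 R -> R) : Prop :=
  smooth u /\ compact (fun_supp u).

(* alpha q v w is the value <alpha(q), v /\ w>. *)
Definition field2 (R : realType) := C3 R -> C3 R -> C3 R -> R.

Definition is_form2 (R : realType) (alpha : field2 R) : Prop :=
  (forall q (a : R) v v' w,
     alpha q (a *: v + v') w = a * alpha q v w + alpha q v' w) /\
  (forall q v w, alpha q v w = - alpha q w v).

Definition form_supp (R : realType) (alpha : field2 R) : set (C3 R) :=
  closure [set q | exists v w, alpha q v w != 0].

Definition test_form2 (R : realType) (alpha : field2 R) : Prop :=
  [/\ is_form2 alpha,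
      forall v w, smooth (fun q => alpha q v w) &
      compact (form_supp alpha)].

Definition null_positive_form (R : realType) (alpha : field2 R) : Prop :=
  forall q v, null_vector v -> 0 <= alpha q v (J v).

Definition del (R : realType) (u : C3 R -> R) (q v : C3 R) : R[i] :=
  ('D_v u q / 2) -i* ('D_(J v) u q / 2).

Definition delbar (R : realType) (u : C3 R -> R) (q v : C3 R) : R[i] :=
  ('D_v u q / 2) +i* ('D_(J v) u q / 2).

(* i (delbar u - del u) is real, as delbar u and del u are conjugate. *)
Definition dc (R : realType) (u : C3 R -> R) (q v : C3 R) : R :=
  complex.Re ('i * (delbar u q v - del u q v)).

(* Normalized so that d(f dg) = df /\ dg with
   (df /\ dg)(v, w) = df(v) dg(w) - df(w) dg(v). *)
Definition d1 (R : realType) (beta : C3 R -> C3 R -> R) : field2 R :=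
  fun q v w => 'D_v (fun p => beta p w) q - 'D_w (fun p => beta p v) q.

Definition ddc (R : realType) (u : C3 R -> R) : field2 R := d1 (dc u).

(* A current is a functional on the real test 2-forms; its values on arguments
   that are not test forms are irrelevant. *)

Definition test_linear (R : realType) (T : field2 R -> R) : Prop :=
  forall (a : R) (alpha beta : field2 R), test_form2 alpha -> test_form2 beta ->
    T (fun q v w => a * alpha q v w + beta q v w) = a * T alpha + T beta.

(* Continuity for the inductive limit topology of test forms: B bounds all
   derivatives of order <= N of the coefficients of alpha. *)
Definition test_continuous (R : realType) (T : field2 R -> R) : Prop :=
  forall A : set (C3 R), compact A ->
  exists (N : nat) (C : R), forall (alpha : field2 R) (B : R),
    test_form2 alpha -> form_supp alpha `<=` A ->
    (forall (vs : seq (C3 R)) (q v w : C3 R), (size vs <= N)%N ->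
       (forall e, e \in vs -> `|e| <= 1) -> `|v| <= 1 -> `|w| <= 1 ->
       `|iter_derive vs (fun p => alpha p v w) q| <= B) ->
    `|T alpha| <= C * B.

(* A real 2-form is the real part of a (2,0)-form iff it changes sign under
   J; bidimension (1,1) means vanishing on the (2,0) and (0,2) parts. *)
Definition bidim11 (R : realType) (T : field2 R -> R) : Prop :=
  forall alpha : field2 R, test_form2 alpha ->
    (forall q v w, alpha q (J v) (J w) = - alpha q v w) -> T alpha = 0.

Definition current11 (R : realType) (T : field2 R -> R) : Prop :=
  [/\ test_linear T, test_continuous T & bidim11 T].

Definition comass_le1 (R : realType) (alpha : field2 R) : Prop :=
  forall q v w, enorm v = 1 -> enorm w = 1 -> `|alpha q v w| <= 1.

Definition mass (R : realType) (T : field2 R -> R) : \bar R :=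
  ereal_sup [set (`|T alpha|)%:E | alpha in
    [set alpha : field2 R | test_form2 alpha /\ comass_le1 alpha]].

Definition current_supp (R : realType) (T : field2 R -> R) : set (C3 R) :=
  [set q | forall U : set (C3 R), open U -> U q ->
    exists alpha : field2 R,
      [/\ test_form2 alpha, form_supp alpha `<=` U & T alpha != 0]].

Definition null_positive_current (R : realType) (T : field2 R -> R) : Prop :=
  forall alpha : field2 R, test_form2 alpha -> null_positive_form alpha ->
    0 <= T alpha.

Definition ddc_le0_on (R : realType) (U : set (C3 R)) (T : field2 R -> R) :
    Prop :=
  forall u : C3 R -> R, test_fun u -> (forall q, 0 <= u q) ->
    fun_supp u `<=` U -> T (ddc u) <= 0.

Definition tube (R : realType) (K : set 'rV[R]_3) : set (C3 R) :=
  K `*` [set: 'rV[R]_3].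

Definition current_null_hull (R : realType) (X : set (C3 R)) : set (C3 R) :=
  \bigcup_(T in [set T : field2 R -> R |
      [/\ current11 T, null_positive_current T, (mass T < +oo)%E,
          bounded_set [set q.1 | q in current_supp T] &
          ddc_le0_on (~` X) T]]) current_supp T.

(* Main.v *)
Require Import Defs.
From HB Require Import structures.
From mathcomp Require Import all_boot all_order all_algebra.
From mathcomp Require Import complex finmap.
From mathcomp Require Import ring lra.
From mathcomp Require Import all_classical all_reals all_analysis.
From mathcomp Require Import measurable_realfun.

Set Implicit Arguments.
Unset Strict Implicit.
Unset Printing Implicit Defensive.

Import Order.TTheory GRing.Theory Num.Theory.
Import numFieldNormedType.Exports.

Local Open Scope classical_set_scope.
Local Open Scope ring_scope.

(* Write a null vector as v = (v1, v2).  Its parts v1 and v2 are orthogonal of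
   equal length, and ddc u (v, J v) is the Laplacian of u along the real plane
   spanned by v and J v; both |x|^2 and |y|^2 contribute 2|v|^2 to it, so
   e (2|x|^2 - |y|^2) is strictly positive on null vectors although it tends to
   -oo with |y|.

   The current hull lies in the tube: let T be admissible, q0 = x0 + i y0 in its
   support and u minimal plurisubharmonic with u(x0) > sup_K u.  A
   sup-convolution followed by mollification replaces u by a smooth function w
   of x with the same properties near pi(supp T).  Adding a small multiple of
   the function above and composing with the convex function t exp(-1/t) yields
   a test function phi >= 0 that vanishes near T_K, with ddc phi >= 0 on null
   vectors near supp T and > 0 at q0.  Then 0 <= T(ddc phi) <= 0 forces T = 0
   near q0.

   The tube over the minimal hull lies in the current hull: for x0 in the hull,
   u(x) = g(x) + sup_y phi(x, y) is minimal plurisubharmonic whenever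
   phi + g is smooth with nonnegative Laplacian on null vectors, so the maximum
   principle phi(q0) <= sup_(T_K) phi holds for such functions.  By Hahn-Banach
   this dualizes to a null positive T with T(ddc phi) <= sup phi - phi(q0). *)

(** * Smooth functions *)

(** Both inclusions have to bridge a mismatch in y: test functions have compact support in C^3,
    whereas the tube and functions of x alone are invariant along i R^3. In one direction the term -
    e |y|^2 cuts off in y without destroying positivity on null vectors. In the other, only a test
    function depends on y, so its supremum over the noncompact fibre is finite and Lipschitz in x.

    Hahn-Banach is run on functions of (q, v) bounded by C |v|^2, because T may read a form only
    through its values alpha(q)(v, J v); bidimension (1,1) then comes for free. Comparison with C
    |x|^2 / 2 bounds the mass, and comparison with a multiple of cvx(|x|^2 - M) confines the
    support. Points over K get a separate current, since the inequality at q0 says nothing about the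
    support there.

    The sup-convolution comes before the mollification because u may take the value -oo and is
    subharmonic only along planes: the mollifier then integrates a continuous function, and Fubini
    carries the circle means through. *)

Section SmoothFunctions.
Context {R : realType}.

Definition iterD (V : normedModType R) (vs : seq V) (u : V -> R) : V -> R :=
  foldr (fun v f => fun q => 'D_v f q) u vs.

(** Extends [smooth] to any normed space, so that functions of one real variable are covered as
    well; at [C3 R] the two are convertible. *)
Definition Csmooth (V : normedModType R) (u : V -> R) : Prop :=
  forall vs q, differentiable (iterD vs u) q.

Context {V : normedModType R}.
Implicit Types (f g a : V -> R) (v : V).

(** Iterated derivatives rarely have a closed form, so smoothness is proved by exhibiting a family
    of differentiable functions that is stable under directional derivatives. The closure lemmas
    below choose such families. *)
Lemma Csmooth_coind (P : (V -> R) -> Prop) :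
  (forall f, P f -> (forall q, differentiable f q) /\
     forall v, P (fun q => 'D_v f q)) ->
  forall f, P f -> Csmooth f.
Proof.
move=> HP f Pf vs; suff : P (iterD vs f) by move=> /HP[].
by elim: vs => //= v vs /HP[_]; apply.
Qed.

Lemma Csmooth_diff f q : Csmooth f -> differentiable f q.
Proof. by move=> sf; exact: (sf [::]). Qed.

Lemma Csmooth_derivable f q v : Csmooth f -> derivable f q v.
Proof. by move=> sf; apply/diff_derivable/Csmooth_diff. Qed.

Lemma Csmooth_continuous f : Csmooth f -> continuous f.
Proof. by move=> sf q; apply/differentiable_continuous/Csmooth_diff. Qed.

Lemma Csmooth_D f v : Csmooth f -> Csmooth (fun q => 'D_v f q).
Proof.
move=> sf vs q; have := sf (rcons vs v) q.
by rewrite /iterD foldr_rcons.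
Qed.

Lemma Csmooth_ext f g : f =1 g -> Csmooth f -> Csmooth g.
Proof. by move=> /funext ->. Qed.

Lemma Csmooth_cst (c : R) : Csmooth (fun _ : V => c).
Proof.
apply: (@Csmooth_coind (fun f => exists c, f = cst c)); last by exists c.
move=> f [{}c ->]; split=> [q|v]; first exact: differentiable_cst.
by exists 0; apply/funext => q; rewrite derive_cst.
Qed.

Lemma Dadd f g q v : Csmooth f -> Csmooth g ->
  'D_v (fun p => f p + g p) q = 'D_v f q + 'D_v g q.
Proof. by move=> sf sg; rewrite -deriveD//; exact: Csmooth_derivable. Qed.

Lemma Dmul f g q v : Csmooth f -> Csmooth g ->
  'D_v (fun p => f p * g p) q = 'D_v f q * g q + f q * 'D_v g q.
Proof.
move=> sf sg; rewrite [LHS](@deriveM _ _ f g); try exact: Csmooth_derivable.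
by rewrite addrC mulrC; congr (_ + _).
Qed.

Lemma Csmooth_add f g : Csmooth f -> Csmooth g -> Csmooth (fun q => f q + g q).
Proof.
move=> sf sg.
apply: (@Csmooth_coind (fun h => exists a b, [/\ Csmooth a, Csmooth b &
  h = fun q => a q + b q])); last by exists f, g.
move=> h [a [b [sa sb ->]]]; split=> [q|v].
  by apply: differentiableD; exact: Csmooth_diff.
exists (fun q => 'D_v a q), (fun q => 'D_v b q).
by split; [exact: Csmooth_D|exact: Csmooth_D|apply/funext => q; exact: Dadd].
Qed.

(** The Leibniz rule leaves the single products but not their finite sums, whence this family for
    [Csmooth_coind]. *)
Inductive mulspan : (V -> R) -> Prop :=
| mulspan_mul f g : Csmooth f -> Csmooth g -> mulspan (fun q => f q * g q)
| mulspan_add f g : mulspan f -> mulspan g -> mulspan (fun q => f q + g q).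

Lemma Csmooth_mul f g : Csmooth f -> Csmooth g -> Csmooth (fun q => f q * g q).
Proof.
move=> sf sg; apply: (@Csmooth_coind mulspan); last exact: mulspan_mul.
move=> {sf sg f g} h; elim=> [f g sf sg|f g _ [df IHf] _ [dg IHg]].
  split=> [q|v]; first by apply: differentiableM; exact: Csmooth_diff.
  rewrite (_ : (fun q => _) = fun q => 'D_v f q * g q + f q * 'D_v g q).
    by apply: mulspan_add; apply: mulspan_mul => //; exact: Csmooth_D.
  by apply/funext => q; exact: Dmul.
split=> [q|v]; first exact: differentiableD.
rewrite (_ : (fun q => _) = fun q => 'D_v f q + 'D_v g q).
  by apply: mulspan_add.
by apply/funext => q; rewrite -deriveD//; exact: diff_derivable.
Qed.

Lemma Csmooth_scale (c : R) f : Csmooth f -> Csmooth (fun q => c * f q).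
Proof. by move=> sf; apply: Csmooth_mul => //; exact: Csmooth_cst. Qed.

Lemma Dscale (c : R) f q v : Csmooth f ->
  'D_v (fun p => c * f p) q = c * 'D_v f q.
Proof.
move=> sf; rewrite (@Dmul (fun=> c) f) //; last exact: Csmooth_cst.
by rewrite derive_cst mul0r add0r.
Qed.

Lemma Csmooth_opp f : Csmooth f -> Csmooth (fun q => - f q).
Proof.
by move=> sf; apply: (Csmooth_ext _ (Csmooth_scale (-1) sf)) => q; rewrite mulN1r.
Qed.

Lemma Dopp f q v : Csmooth f -> 'D_v (fun p => - f p) q = - 'D_v f q.
Proof.
move=> sf; rewrite -mulN1r -Dscale//; congr ('D_v _ q).
by apply/funext => p; rewrite mulN1r.
Qed.

Lemma Csmooth_sub f g : Csmooth f -> Csmooth g -> Csmooth (fun q => f q - g q).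
Proof. by move=> sf sg; apply: Csmooth_add => //; exact: Csmooth_opp. Qed.

Lemma Csmooth_sum n (F : 'I_n -> V -> R) :
  (forall i, Csmooth (F i)) -> Csmooth (fun q => \sum_(i < n) F i q).
Proof.
move=> sF; rewrite (_ : (fun q => _) = \sum_(i < n) F i); last first.
  by apply/funext => q; rewrite fct_sumE.
elim/big_ind: _ => //; first exact: Csmooth_cst.
by move=> f g; exact: Csmooth_add.
Qed.

Lemma Dsum n (F : 'I_n -> V -> R) q v : (forall i, Csmooth (F i)) ->
  'D_v (fun p => \sum_(i < n) F i p) q = \sum_(i < n) 'D_v (F i) q.
Proof.
move=> sF; rewrite (_ : (fun q => _) = \sum_(i < n) F i); last first.
  by apply/funext => p; rewrite fct_sumE.
by rewrite derive_sum// => i; exact: Csmooth_derivable.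
Qed.

Lemma Dlin f q v w (c : R) : Csmooth f ->
  'D_(c *: v + w) f q = c * 'D_v f q + 'D_w f q.
Proof. by move=> sf; rewrite !deriveE ?linearP//; exact: Csmooth_diff. Qed.

Lemma DdirD f q v w : Csmooth f -> 'D_(v + w) f q = 'D_v f q + 'D_w f q.
Proof. by move=> sf; rewrite -[v]scale1r Dlin// mul1r scale1r. Qed.

Lemma DdirZ f q v (c : R) : Csmooth f -> 'D_(c *: v) f q = c * 'D_v f q.
Proof. by move=> sf; rewrite !deriveE ?linearZ//; exact: Csmooth_diff. Qed.

Lemma DdirN f q v : Csmooth f -> 'D_(- v) f q = - 'D_v f q.
Proof. by move=> sf; rewrite -scaleN1r DdirZ// mulN1r. Qed.

End SmoothFunctions.

Section Composition.
Context {R : realType}.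

Lemma Dlinear (V : normedModType R) (L : {linear V -> R}) q v :
  continuous L -> 'D_v L q = L v.
Proof.
by move=> cL; rewrite deriveE ?diff_lin//; exact: linear_differentiable.
Qed.

Lemma Csmooth_linear (V : normedModType R) (L : {linear V -> R}) :
  continuous L -> Csmooth L.
Proof.
move=> cL; apply: (@Csmooth_coind _ _ (fun h => h = L \/ exists c, h = cst c)).
  move=> h [->|[c ->]]; split=> [q|v]; first exact: linear_differentiable.
  - by right; exists (L v); apply/funext => q; rewrite Dlinear.
  - exact: differentiable_cst.
  - by right; exists 0; apply/funext => q; rewrite derive_cst.
by left.
Qed.

Lemma Dcomp (V : normedModType R) (g : R -> R) (f : V -> R) q v :
  (forall t, differentiable g t) -> (forall p, differentiable f p) ->
  'D_v (fun p => g (f p)) q = 'D_1 g (f q) * 'D_v f q.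
Proof.
move=> dg df; rewrite (_ : (fun p => _) = g \o f)// deriveE; last first.
  exact: differentiable_comp.
rewrite diff_comp//= !deriveE// mulrC.
by rewrite -[LHS](congr1 ('d g (f q)) (mulr1 ('d f q v))) -linearZ.
Qed.

(** Stable under derivatives: the chain rule sends [g (f q) * a q] to g'(f) (Df a) + g(f) Da, two
    terms of the same shape. *)
Inductive compspan (V : normedModType R) (f : V -> R) : (V -> R) -> Prop :=
| compspan_mul g a : Csmooth g -> Csmooth a ->
    compspan f (fun q => g (f q) * a q)
| compspan_add h k : compspan f h -> compspan f k ->
    compspan f (fun q => h q + k q).

Lemma Csmooth_comp (V : normedModType R) (g : R -> R) (f : V -> R) :
  Csmooth g -> Csmooth f -> Csmooth (fun q => g (f q)).
Proof.
move=> sg sf; apply: (@Csmooth_coind _ _ (compspan f)); last first.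
  rewrite (_ : (fun q => _) = fun q => g (f q) * 1).
    by apply: compspan_mul => //; exact: Csmooth_cst.
  by apply/funext => q; rewrite mulr1.
move=> {sg g} h; elim=> [g a sg sa|h1 h2 _ [df IHf] _ [dg IHg]].
  have dgf p : differentiable (fun q => g (f q)) p.
    by apply: (@differentiable_comp _ _ _ _ f g); exact: Csmooth_diff.
  split=> [q|v].
    by apply: (@differentiableM _ _ (fun q => g (f q)) a) => //; exact: Csmooth_diff.
  rewrite (_ : (fun q => _) = fun q =>
     'D_1 g (f q) * ('D_v f q * a q) + g (f q) * 'D_v a q).
    apply: compspan_add.
      apply: (@compspan_mul _ f (fun t => 'D_1 g t) (fun q => 'D_v f q * a q)).
        exact: Csmooth_D.
      by apply: Csmooth_mul => //; exact: Csmooth_D.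
    by apply: (@compspan_mul _ f g (fun q => 'D_v a q)) => //; exact: Csmooth_D.
  apply/funext => q.
  rewrite [LHS](@deriveM _ _ (fun q => g (f q)) a); last 2 first.
    exact: diff_derivable.
    exact: Csmooth_derivable.
  rewrite (@Dcomp _ g f) => [|t|p]; try exact: Csmooth_diff.
  by rewrite addrC; congr (_ + _); rewrite [LHS]mulrC mulrA.
split=> [q|v]; first exact: differentiableD.
rewrite (_ : (fun q => _) = fun q => 'D_v h1 q + 'D_v h2 q).
  exact: compspan_add.
by apply/funext => q; rewrite -deriveD//; exact: diff_derivable.
Qed.

End Composition.

Lemma dd_spec (R : realType) (V : normedModType R) :
  {d : V -> (V -> R) -> V -> R | d = fun v u q => 'D_v u q}.
Proof. by eexists. Qed.

(* An opaque copy of the directional derivative: unification would otherwise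
   unfold limits when two derivatives fail to match. *)
Definition dd {R : realType} {V : normedModType R} := sval (dd_spec V).

Section LockedDerivative.
Context {R : realType} {V : normedModType R}.
Implicit Types (f g : V -> R) (q v w : V) (c : R).

Lemma ddE v f : dd v f = fun q => 'D_v f q.
Proof. by rewrite /dd (svalP (dd_spec V)). Qed.

Lemma Csmooth_dd v f : Csmooth f -> Csmooth (dd v f).
Proof. by rewrite ddE; exact: Csmooth_D. Qed.

Lemma ddD v f g : Csmooth f -> Csmooth g ->
  dd v (fun p => f p + g p) = fun q => dd v f q + dd v g q.
Proof. by move=> sf sg; rewrite !ddE; apply/funext => q; exact: Dadd. Qed.

Lemma ddM v f g : Csmooth f -> Csmooth g ->
  dd v (fun p => f p * g p) = fun q => dd v f q * g q + f q * dd v g q.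
Proof. by move=> sf sg; rewrite !ddE; apply/funext => q; exact: Dmul. Qed.

Lemma ddZ v c f : Csmooth f -> dd v (fun p => c * f p) = fun q => c * dd v f q.
Proof. by move=> sf; rewrite !ddE; apply/funext => q; exact: Dscale. Qed.

Lemma ddN v f : Csmooth f -> dd v (fun p => - f p) = fun q => - dd v f q.
Proof. by move=> sf; rewrite !ddE; apply/funext => q; exact: Dopp. Qed.

Lemma dd_cst v c : dd v (fun _ : V => c) = fun=> 0.
Proof. by rewrite ddE; apply/funext => q; rewrite derive_cst. Qed.

Lemma dd_lin v w c f q : Csmooth f -> dd (c *: v + w) f q = c * dd v f q + dd w f q.
Proof. by move=> sf; rewrite !ddE; exact: Dlin. Qed.

Lemma dd_opp v f q : Csmooth f -> dd (- v) f q = - dd v f q.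
Proof. by move=> sf; rewrite !ddE; exact: DdirN. Qed.

End LockedDerivative.

Lemma dd_comp {R : realType} {V : normedModType R} (v : V) (g : R -> R) (f : V -> R) :
  Csmooth g -> Csmooth f ->
  dd v (fun p => g (f p)) = fun q => dd (1 : R) g (f q) * dd v f q.
Proof.
move=> sg sf; rewrite !ddE; apply/funext => q.
by apply: (@Dcomp _ _ g f) => ?; exact: Csmooth_diff.
Qed.

(** * Differentiability from a quadratic remainder *)

Section QuadraticRemainder.
Context {R : realType} {V : normedModType R}.

(** A remainder of order |h|^2 is o(h). This replaces a computation of the derivative at the two
    places where no rule applies: at the flat point of exp(-1/t) and under the integral of a
    mollification. *)
Lemma diff_quadratic (f : V -> R) (q : V) (L : {linear V -> R}) (C : R) :
  continuous L ->
  (forall h, `|h| <= 1 -> `|f (h + q) - f q - L h| <= C * `|h| ^+ 2) ->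
  differentiable f q /\ forall v, 'D_v f q = L v.
Proof.
move=> cL HC.
have HO : f \o shift q = cst (f q) + L +o_ (0 : V) id.
  apply/eqaddoP => eps eps0; near=> h; rewrite /=.
  have -> : (f \o shift q - (cst (f q) + L)) h = f (h + q) - f q - L h.
    by rewrite /= !fctE /= opprD addrA.
  have h1 : `|h| <= 1 by near: h; apply: nbhs0_le.
  rewrite (le_trans (HC h h1))// expr2 mulrA ler_wpM2r//.
  have C0 : 0 < `|C| + 1 by rewrite ltr_wpDl.
  apply: (@le_trans _ _ ((`|C| + 1) * `|h|)).
    rewrite ler_wpM2r// (le_trans (ler_norm _))// lerDl//.
  rewrite mulrC -ler_pdivlMr//.
  by near: h; apply: nbhs0_le; exact: divr_gt0.
have dE := diff_unique cL HO.
have df : differentiable f q by apply/diff_locallyP; rewrite dE; split.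
by split=> // v; rewrite deriveE// dE.
Unshelve. all: by end_near. Qed.

End QuadraticRemainder.

(** * Flat functions and the convex function t exp(-1/t) *)

Section OneVariable.
Context {R : realType}.
Implicit Types (p : {poly R}) (t s : R).

(** For n >= 1, s / n <= 1 + s / n <= exp(s / n); raise this to the power n. *)
Lemma exprn_le_expR n s : 0 <= s -> s ^+ n <= n%:R ^+ n * expR s.
Proof.
move=> s0; case: n => [|n]; first by rewrite !expr0 mul1r -expR0 ler_expR.
have -> : expR s = expR (s / n.+1%:R) ^+ n.+1.
  by rewrite -expRM_natl; congr expR; rewrite -mulr_natl mulrCA divff ?mulr1.
rewrite -exprMn lerXn2r ?nnegrE ?mulr_ge0 ?expR_ge0//.
rewrite mulrC -ler_pdivrMr ?ltr0n// (le_trans _ (expR_ge1Dx _))//.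
by rewrite lerDr.
Qed.

Lemma horner_le_expR p : exists C, forall s, 0 <= s -> `|p.[s]| <= C * expR s.
Proof.
exists (\sum_(i < size p) `|p`_i| * i%:R ^+ i) => s s0.
rewrite horner_coef mulr_suml (le_trans (ler_norm_sum _ _ _))// ler_sum// => i _.
rewrite normrM -mulrA ler_wpM2l// ger0_norm ?exprn_ge0//.
exact: exprn_le_expR.
Qed.

(** The functions p(1/t) exp(-1/t), extended by 0, for all polynomials p at once: differentiation
    maps [flat p] to [flat (dpoly p)], so the family proves its own smoothness. *)
Definition flat p t : R := if 0 < t then p.[t^-1] * expR (- t^-1) else 0.

Lemma flat0 p t : t <= 0 -> flat p t = 0.
Proof. by rewrite /flat leNgt; case: ifP. Qed.

Lemma flatE p t : 0 < t -> flat p t = p.[t^-1] * expR (- t^-1).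
Proof. by rewrite /flat => ->. Qed.

(** The exponential bound for the polynomial p X^2 at 1/t gains the factor t^2. This gives the
    derivative 0 at t = 0. *)
Lemma flat_quadratic p : exists C, forall t, `|flat p t| <= C * t ^+ 2.
Proof.
have [C HC] := horner_le_expR (p * 'X^2).
have C0 : 0 <= C.
  by have := le_trans (normr_ge0 _) (HC 0 (lexx 0)); rewrite expR0 mulr1.
exists C => t; have [t0|t0] := leP t 0.
  by rewrite flat0// normr0 mulr_ge0// sqr_ge0.
rewrite flatE// normrM [X in _ * X]ger0_norm ?expR_ge0//.
have /= := HC t^-1; rewrite invr_ge0 ltW// => /(_ isT).
rewrite hornerM hornerXn normrM [X in _ * X]ger0_norm ?sqr_ge0//.
rewrite -ler_pdivlMr ?exprn_gt0 ?invr_gt0// => H.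
rewrite expRN -ler_pdivlMr ?invr_gt0 ?expR_gt0// invrK (le_trans H)//.
by rewrite -exprVn invrK mulrAC.
Qed.

Definition dpoly p : {poly R} := 'X^2 * (p - p^`()).

Lemma flat_is_derive p t : is_derive t 1 (flat p) (flat (dpoly p) t).
Proof.
have [t0|t0|->] := ltrgtP t 0.
- rewrite flat0 ?ltW//.
  apply: (@near_eq_is_derive _ _ _ (cst 0)) => //.
  by near=> s; rewrite flat0// ltW//; near: s; exact: lt_nbhsl.
- apply: (@near_eq_is_derive _ _ _
    (fun s => p.[s^-1] * expR (- s^-1))) => //.
    by near=> s; rewrite flatE//; near: s; exact: lt_nbhsr.
  have dV : is_derive t 1 (fun s : R => s^-1) (- t ^- 2).
    apply: DeriveDef; first by apply: derivableV => //; rewrite gt_eqF.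
    by rewrite deriveV ?gt_eqF// derive_id /GRing.scale/= mulr1.
  have dp : is_derive t 1 (fun s => p.[s^-1]) (p^`().[t^-1] * - t ^- 2).
    have -> : (fun s => p.[s^-1]) = (horner p) \o (fun s : R => s^-1) by [].
    exact: is_derive1_comp.
  have de : is_derive t 1 (fun s => expR (- s^-1)) (t ^- 2 * expR (- t^-1)).
    have -> : (fun s => expR (- s^-1)) = expR \o (fun s : R => - s^-1) by [].
    rewrite mulrC; apply: is_derive1_comp.
    by rewrite -[t ^- 2]opprK; apply: is_deriveN.
  apply: is_derive_eq; rewrite flatE// /dpoly /GRing.scale/= !hornerE/=.
  rewrite exprVn; set e := expR _; set a := p.[_]; set b := _.[t^-1].
  move: (t ^- 2) => c.
  by ring.
- rewrite flat0//.
  have [C HC] := flat_quadratic p.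
  have [//||df dE] := @diff_quadratic R R (flat p) 0 \0 C.
  - exact: cst_continuous.
  - move=> h _; rewrite addr0 [flat p 0]flat0// !subr0.
    by rewrite (le_trans (HC h))// -normrX ger0_norm ?sqr_ge0.
  apply: DeriveDef; last by rewrite dE.
  exact: diff_derivable.
Unshelve. all: by end_near. Qed.

Lemma D_flat p t : 'D_1 (flat p) t = flat (dpoly p) t.
Proof. by apply: derive_val; exact: flat_is_derive. Qed.

Lemma D1dir (f : R -> R) t v : differentiable f t -> 'D_v f t = v * 'D_1 f t.
Proof.
move=> df; rewrite !deriveE//.
by rewrite -[LHS](congr1 ('d f t) (mulr1 v)) -linearZ.
Qed.

(** On the line the derivative along v is v times the derivative along 1, so stability under ['D_1]
    and under scaling is enough. *)
Lemma Csmooth1_coind (P : (R -> R) -> Prop) :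
  (forall f (c : R), P f -> P (fun t => c * f t)) ->
  (forall f, P f -> (forall q, derivable f q 1) /\ P (fun q => 'D_1 f q)) ->
  forall f, P f -> Csmooth f.
Proof.
move=> HZ HD; apply: Csmooth_coind => f Pf.
have df q : differentiable f q by apply/derivable1_diffP; have [] := HD _ Pf.
split=> // v; rewrite (_ : (fun q => _) = fun q => v * 'D_1 f q).
  by apply: HZ; have [] := HD _ Pf.
by apply/funext => q; rewrite D1dir.
Qed.

Lemma Csmooth_flat p : Csmooth (flat p).
Proof.
apply: (@Csmooth1_coind (fun f => exists p, f = flat p)); last by exists p.
  move=> f c [{}p ->]; exists (c *: p); apply/funext => t.
  by rewrite /flat; case: ifP; rewrite ?mulr0// hornerZ mulrA.
move=> f [{}p ->]; split=> [q|]; first by case: (flat_is_derive p q).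
by exists (dpoly p); apply/funext => t; rewrite D_flat.
Qed.

Lemma Csmooth_id : Csmooth (@id R).
Proof.
apply: (@Csmooth1_coind (fun f => (exists c, f = fun t => c * t)
    \/ exists c, f = cst c)).
- move=> f c [[d ->]|[d ->]]; [left; exists (c * d)|right; exists (c * d)] => //.
  by apply/funext => t; rewrite mulrA.
- move=> f [[c ->]|[c ->]]; split=> [q|].
  + exact: derivableM.
  + right; exists c; apply/funext => t.
    by rewrite [LHS](@deriveM _ _ (cst c) id)// derive_id derive_cst scaler0 addr0 /GRing.scale/= mulr1.
  + exact: derivable_cst.
  + by right; exists 0; apply/funext => t; rewrite derive_cst.
- by left; exists 1; apply/funext => t; rewrite mul1r.
Qed.

(** The factor t makes the function convex: exp(-1/t) is concave for t > 1/2, whereas the second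
    derivative of t exp(-1/t) is exp(-1/t) / t^3. *)
Definition cvx t : R := t * flat 1 t.

Lemma Csmooth_cvx : Csmooth cvx.
Proof. by apply: Csmooth_mul; [exact: Csmooth_id|exact: Csmooth_flat]. Qed.

Lemma cvx_flat t : cvx t = if 0 < t then t * expR (- t^-1) else 0.
Proof. by rewrite /cvx /flat hornerC mul1r; case: ifP => // _; rewrite mulr0. Qed.

Lemma D_cvx t : 'D_1 cvx t = flat (1 + 'X) t.
Proof.
rewrite (@Dmul _ _ id (flat 1)) ?D_flat ?derive_id.
- rewrite mul1r; have [t0|t0] := leP t 0; first by rewrite !flat0// mulr0 addr0.
  have -> : dpoly (1 : {poly R}) = 'X^2.
    by rewrite /dpoly -[X in X^`()]polyC1 derivC subr0 mulr1.
  rewrite !flatE// !hornerE/=.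
  by field; rewrite gt_eqF.
- exact: Csmooth_id.
- exact: Csmooth_flat.
Qed.

Lemma D2_cvx t : 'D_1 (fun t => 'D_1 cvx t) t = flat ('X^3) t.
Proof.
rewrite (_ : (fun t => _) = flat (1 + 'X)); last exact/funext/D_cvx.
rewrite D_flat; congr (flat _ t).
rewrite /dpoly derivD derivX -[X in X^`()]polyC1 derivC add0r.
by rewrite [1 + 'X]addrC addrK -exprSr.
Qed.

Lemma cvx_eq0 t : t <= 0 -> cvx t = 0.
Proof. by move=> t0; rewrite /cvx flat0// mulr0. Qed.

Lemma cvx_ge0 t : 0 <= cvx t.
Proof.
rewrite cvx_flat; case: ifP => // t0.
by rewrite mulr_ge0 ?expR_ge0// ltW.
Qed.

Lemma dcvx_gt0 t : 0 < t -> 0 < 'D_1 cvx t.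
Proof.
move=> t0; rewrite D_cvx flatE// mulr_gt0 ?expR_gt0//.
by rewrite !hornerE addr_gt0// invr_gt0.
Qed.

Lemma dcvx_ge0 t : 0 <= 'D_1 cvx t.
Proof.
have [t0|t0] := leP t 0; last exact/ltW/dcvx_gt0.
by rewrite D_cvx flat0.
Qed.

Lemma d2cvx_ge0 t : 0 <= 'D_1 (fun t => 'D_1 cvx t) t.
Proof.
rewrite D2_cvx; have [t0|t0] := leP t 0; first by rewrite flat0.
by rewrite flatE// hornerXn mulr_ge0 ?expR_ge0// exprn_ge0// invr_ge0 ltW.
Qed.

Lemma ger0_D_ndecr (f : R -> R) s t : (forall u, derivable f u 1) ->
  (forall u, s < u -> u < t -> 0 <= 'D_1 f u) -> s <= t -> f s <= f t.
Proof.
move=> df f0 st; apply: (@ger0_derive1_ndecr R f s t) => //.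
  by move=> u; rewrite in_itv/= derive1E => /andP[]; exact: f0.
apply: derivable_within_continuous => u _; exact: df.
Qed.

Lemma dcvx_nondecr s t : s <= t -> 'D_1 cvx s <= 'D_1 cvx t.
Proof.
move=> st; apply: (@ger0_D_ndecr (fun t => 'D_1 cvx t)) => // u.
  exact/Csmooth_derivable/Csmooth_D/Csmooth_cvx.
by move=> _ _; exact: d2cvx_ge0.
Qed.

End OneVariable.

(** * Smooth steps and cutoffs *)

Section InverseStep.
Context {R : realType}.

Lemma Csmooth_inv (V : normedModType R) (d : V -> R) :
  (forall q, d q != 0) -> Csmooth d -> Csmooth (fun q => (d q)^-1).
Proof.
(* The functions a / d^n form a stable family: the derivative of a / d^n is (a' d - n a d') /
   d^(n+1). *)
move=> d0 sd; apply: (@Csmooth_coind _ _ (fun f => exists a n, Csmooth a /\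
   f = fun q => a q * (d q)^-1 ^+ n)); last first.
  exists (cst 1), 1; split; first exact: Csmooth_cst.
  by apply/funext => q; rewrite mul1r expr1.
have ddV q : differentiable (fun p => (d p)^-1) q.
  by apply: differentiableV => //; exact: Csmooth_diff.
move=> f [a [n [sa ->]]].
have ddX q : differentiable (fun p => (d p)^-1 ^+ n) q.
  rewrite (_ : (fun p => _) = (fun p => (d p)^-1) ^+ n); last first.
    by apply/funext => p; rewrite exprfctE.
  by case: n => [|n]; [exact: differentiable_cst|exact: differentiableX].
split=> [q|v]; first by apply: differentiableM => //; exact: Csmooth_diff.
exists (fun q => 'D_v a q * d q - n%:R * (a q * 'D_v d q)), n.+1; split.
  by apply: Csmooth_sub;
    repeat (apply: Csmooth_mul || exact: Csmooth_D || exact: Csmooth_cst).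
apply/funext => q.
rewrite [LHS](@deriveM _ _ a (fun p => (d p)^-1 ^+ n)); last 2 first.
- exact: Csmooth_derivable.
- exact: diff_derivable.
have -> : 'D_v (fun p => (d p)^-1 ^+ n) q =
   - (n%:R * (d q)^-1 ^+ n.+1 * 'D_v d q).
  rewrite (_ : (fun p => _) = (fun p => (d p)^-1) ^+ n); last first.
    by apply/funext => p; rewrite exprfctE.
  rewrite deriveX; last exact: diff_derivable.
  rewrite deriveV//; last exact: Csmooth_derivable.
  rewrite /GRing.scale/= -exprVn; case: n {ddX} => [|n] /=.
    by rewrite !mulr0n !mul0r oppr0.
  by rewrite -mulr_natl !exprS; ring.
rewrite /GRing.scale/= exprS.
by field; apply: d0.
Qed.

(** The denominator never vanishes, as one of t and 1 - t is positive. *)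
Definition step (t : R) : R := flat 1 t / (flat 1 t + flat 1 (1 - t)).

Lemma flat1_ge0 (t : R) : 0 <= flat 1 t.
Proof.
rewrite /flat; case: ifP => // _; rewrite hornerC mul1r; exact: expR_ge0.
Qed.

Lemma flat1_gt0 (t : R) : 0 < t -> 0 < flat 1 t.
Proof. by move=> t0; rewrite flatE// hornerC mul1r; exact: expR_gt0. Qed.

Lemma step_den_gt0 (t : R) : 0 < flat 1 t + flat 1 (1 - t).
Proof.
have [t0|t0] := leP t 0.
  by rewrite ltr_wpDl ?flat1_ge0// flat1_gt0// subr_gt0 (le_lt_trans t0).
by rewrite ltr_pwDl ?flat1_ge0// flat1_gt0.
Qed.

Lemma Csmooth_flat1B : Csmooth (fun t : R => flat 1 (1 - t)).
Proof.
apply: Csmooth_comp; first exact: Csmooth_flat.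
by apply: Csmooth_sub; [exact: Csmooth_cst|exact: Csmooth_id].
Qed.

Lemma Csmooth_step : Csmooth step.
Proof.
apply: Csmooth_mul; first exact: Csmooth_flat.
apply: Csmooth_inv => [t|]; first by rewrite gt_eqF// step_den_gt0.
by apply: Csmooth_add; [exact: Csmooth_flat|exact: Csmooth_flat1B].
Qed.

Lemma step_ge0 t : 0 <= step t.
Proof. by rewrite divr_ge0 ?addr_ge0 ?flat1_ge0. Qed.

Lemma step_le1 t : step t <= 1.
Proof. by rewrite ler_pdivrMr ?step_den_gt0// mul1r lerDl flat1_ge0. Qed.

Lemma step_eq0 t : t <= 0 -> step t = 0.
Proof. by move=> t0; rewrite /step flat0// mul0r. Qed.

Lemma step_eq1 t : 1 <= t -> step t = 1.
Proof.
move=> t1; rewrite /step [X in _ + X]flat0 ?subr_le0// addr0 divff//.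
by rewrite gt_eqF// flat1_gt0// (lt_le_trans ltr01).
Qed.

(** Interpolates from 1 on {f <= 1} to 0 on {f >= 2}; f will be a rescaled squared distance, so the
    two regions have squared radii in the ratio 2. *)
Definition cutoff (V : Type) (f : V -> R) (q : V) : R := step (2 - f q).

Lemma Csmooth_cutoff (V : normedModType R) (f : V -> R) :
  Csmooth f -> Csmooth (cutoff f).
Proof.
move=> sf; apply: Csmooth_comp; first exact: Csmooth_step.
by apply: Csmooth_sub => //; exact: Csmooth_cst.
Qed.

Lemma cutoff_ge0 V (f : V -> R) q : 0 <= cutoff f q.
Proof. exact: step_ge0. Qed.

Lemma cutoff_le1 V (f : V -> R) q : cutoff f q <= 1.
Proof. exact: step_le1. Qed.

Lemma cutoff_eq1 V (f : V -> R) q : f q <= 1 -> cutoff f q = 1.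
Proof. by move=> fq; rewrite /cutoff step_eq1//; lra. Qed.

Lemma cutoff_eq0 V (f : V -> R) q : 2 <= f q -> cutoff f q = 0.
Proof. by move=> fq; rewrite /cutoff step_eq0// subr_le0. Qed.

Lemma cutoff_neq0 V (f : V -> R) q : cutoff f q != 0 -> f q < 2.
Proof. by apply: contra_neqT; rewrite -leNgt => fq; rewrite cutoff_eq0. Qed.

End InverseStep.

(** * Euclidean product against the maximum norm *)

Section Dot.
Context {R : realType} {n : nat}.
Implicit Types u v w : 'rV[R]_n.

Lemma dotC v w : dot v w = dot w v.
Proof. by apply: eq_bigr => j _; rewrite mulrC. Qed.

Lemma dotDl u v w : dot (u + v) w = dot u w + dot v w.
Proof. by rewrite -big_split; apply: eq_bigr => j _; rewrite !mxE mulrDl. Qed.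

Lemma dotZl (c : R) v w : dot (c *: v) w = c * dot v w.
Proof. by rewrite mulr_sumr; apply: eq_bigr => j _; rewrite !mxE mulrA. Qed.

Lemma dotDr u v w : dot u (v + w) = dot u v + dot u w.
Proof. by rewrite dotC dotDl !(dotC u). Qed.

Lemma dotZr (c : R) v w : dot v (c *: w) = c * dot v w.
Proof. by rewrite dotC dotZl dotC. Qed.

Lemma dotNl v w : dot (- v) w = - dot v w.
Proof. by rewrite -scaleN1r dotZl mulN1r. Qed.

Lemma dotNr v w : dot v (- w) = - dot v w.
Proof. by rewrite dotC dotNl dotC. Qed.

Lemma dot_ge0 v : 0 <= dot v v.
Proof. by apply: sumr_ge0 => j _; rewrite -expr2 sqr_ge0. Qed.

Lemma dot_eq0 v : dot v v = 0 -> v = 0.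
Proof.
move=> /eqP; rewrite psumr_eq0 => [/allP H|j _]; last by rewrite -expr2 sqr_ge0.
apply/rowP => j; rewrite mxE; have /= := H j (mem_index_enum j).
by rewrite -expr2 sqrf_eq0 => /eqP.
Qed.

Lemma sqr_coord_le_dot v j : v 0 j ^+ 2 <= dot v v.
Proof.
rewrite /dot (bigD1 j)//= -expr2 lerDl.
by apply: sumr_ge0 => i _; rewrite -expr2 sqr_ge0.
Qed.

Lemma coord_le_norm v j : `|v 0 j| <= `|v|.
Proof.
by rewrite [leRHS]mx_normrE; apply: (le_bigmax _ (fun i => `|v i.1 i.2|) (0, j)).
Qed.

Lemma norm_le_coord v (e : R) : 0 <= e -> (forall j, `|v 0 j| <= e) -> `|v| <= e.
Proof.
move=> e0 H; rewrite [leLHS]mx_normrE; apply: bigmax_le => // -[i j] _ /=.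
by rewrite (ord1 i).
Qed.

Lemma norm_le_sqrt_dot v (e : R) : 0 <= e -> dot v v <= e ^+ 2 -> `|v| <= e.
Proof.
move=> e0 H; apply: norm_le_coord => // j.
rewrite -ler_sqr ?nnegrE// real_normK ?num_real//.
exact: le_trans (sqr_coord_le_dot v j) H.
Qed.

Lemma dot_le_norm v : dot v v <= n%:R * `|v| ^+ 2.
Proof.
rewrite /dot -[n in n%:R]card_ord -sum1_card natr_sum mulr_suml ler_sum// => j _.
rewrite mul1r -expr2 -real_normK ?num_real// lerXn2r ?nnegrE//.
exact: coord_le_norm.
Qed.

End Dot.

(** * Circle means and the Laplacian *)

Section CircleIntegral.
Context {R : realType}.
Notation mu := (@lebesgue_measure R).
Notation circ := (`[0%R, (2 * pi)%R]%classic : set R).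

Lemma integrable_continuous (f : R -> R) (a b : R) : continuous f ->
  mu.-integrable `[a, b] (EFin \o f).
Proof.
move=> cf; apply: continuous_compact_integrable; first exact: segment_compact.
exact: continuous_subspaceT.
Qed.

Lemma bounded_rectangle (F : R * R -> R) (a b c d : R) : continuous F ->
  exists M, forall s t, a <= s <= b -> c <= t <= d -> `|F (s, t)| <= M.
Proof.
move=> cF.
have cpt : compact (`[a, b] `*` `[c, d]).
  by apply: compact_setX; exact: segment_compact.
have /compact_bounded[M [_ HM]] : compact (F @` (`[a, b] `*` `[c, d])).
  by apply: continuous_compact => //; exact: continuous_subspaceT.
exists (M + 1) => s t st ct; apply: (HM (M + 1)); first by rewrite ltrDl.
by exists (s, t) => //=; rewrite !in_itv.
Qed.

Lemma cont_slice1 (F : R * R -> R) (s : R) : continuous F ->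
  continuous (fun t => F (s, t)).
Proof.
move=> cF t; apply: (@continuous_comp _ _ _ (fun t => (s, t)) F); last exact: cF.
by apply: (@cvg_pair _ _ _ _ (nbhs s) (nbhs t)); [exact: cvg_cst|exact: cvg_id].
Qed.

Arguments cont_slice1 {F} s _.

(** Dominated differentiation: on the compact rectangle [s - 1, s + 1] x [c, d] the continuous [dF]
    is bounded by a constant. *)
Lemma derive_integral (F dF : R * R -> R) (c d : R) (s : R) :
  continuous F -> continuous dF ->
  (forall s t : R, is_derive s 1 (fun x : R => F (x, t)) (dF (s, t))) ->
  is_derive s 1 (fun x : R => \int[mu]_(t in `[c, d]) F (x, t))
    (\int[mu]_(t in `[c, d]) dF (s, t)).
Proof.
move=> cF cdF HF.
have [M HM] := bounded_rectangle (s - 1) (s + 1) c d cdF.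
have mcd : measurable (`[c, d]%classic : set R) by [].
have Is : (`]s - 1, s + 1[%classic : set R) s.
  by rewrite /= in_itv/= ltrBlDr ltrDl ltr01.
have intF x : (`]s - 1, s + 1[%classic : set R) x ->
    mu.-integrable `[c, d] (EFin \o (fun t => F (x, t))).
  by move=> _; exact/integrable_continuous/cont_slice1.
have derF x y : (`]s - 1, s + 1[%classic : set R) x -> `[c, d]%classic y ->
    derivable (fun x : R => F (x, y)) x 1.
  by move=> _ _; case: (HF x y).
have intM : mu.-integrable `[c, d] (EFin \o (fun=> `|M|)).
  by apply: integrable_continuous; exact: cst_continuous.
have dE : partial1of2 (fun s t => F (s, t)) = fun s t => dF (s, t).
  by apply/funext => x; apply/funext => y; rewrite partial1of2E derive_val.
have bM x y : (`]s - 1, s + 1[%classic : set R) x -> `[c, d]%classic y ->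
    `|partial1of2 (fun s t => F (s, t)) x y| <= `|M|.
  rewrite /= !in_itv/= => /andP[x1 x2] ycd; rewrite dE.
  by rewrite (le_trans (HM x y _ ycd)) ?ler_norm// !ltW.
have M0 (y : R) : 0 <= (fun=> `|M| : R) y by [].
apply: DeriveDef.
  exact: (@derivable_under_integral R _ _ mu (fun x t => F (x, t)) _ mcd s _ _
    Is intF derF _ M0 intM bM).
rewrite -derive1E (@differentiation_under_integral R _ _ mu
  (fun x t => F (x, t)) _ mcd s _ _ Is intF derF _ M0 intM bM).
by rewrite dE.
Qed.

Section Rotation.
Context {V : normedModType R} (q a b : V).

Definition rot (t : R) : V := cos t *: a + sin t *: b.
(** Polar coordinates about q in the plane of a and b; a fixed radius gives a true circle when a and
    b are orthogonal of equal length, an ellipse in general. *)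
Definition polar (p : R * R) : V := p.1 *: rot p.2 + q.

Lemma rot_is_diff t : differentiable rot t /\
  'd rot t = (fun h => h *: (- sin t *: a + cos t *: b)) :> (R -> V).
Proof.
have dc : is_derive t 1 cos (- sin t) by exact: is_derive_cos.
have ds : is_derive t 1 sin (cos t) by exact: is_derive_sin.
have dcd : differentiable cos t by apply/derivable1_diffP; case: dc.
have dsd : differentiable sin t by apply/derivable1_diffP; case: ds.
have H1 : differentiable (fun t => cos t *: a) t by apply: differentiableZl.
have H2 : differentiable (fun t => sin t *: b) t by apply: differentiableZl.
split; first exact: (differentiableD H1 H2).
rewrite [LHS](diffD H1 H2) !diffZl//; apply/funext => h; rewrite /=.
rewrite !deriv1E ?derive1E ?derive_val//=.
by rewrite scalerDr !scalerA.
Qed.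

Lemma rot_continuous : continuous rot.
Proof.
move=> t; apply: differentiable_continuous; by have [] := rot_is_diff t.
Qed.

Lemma polar_continuous : continuous polar.
Proof.
move=> p; apply: cvgD; last exact: cvg_cst.
apply: cvgZ; first exact: cvg_fst.
apply: (@continuous_comp _ _ _ snd rot); first exact: cvg_snd.
exact: rot_continuous.
Qed.

Context (f : V -> R) (sf : Csmooth f).

Lemma line_is_derive (g : V -> R) (u : V) (s : R) : Csmooth g ->
  is_derive s 1 (fun x : R => g (x *: u + q)) ('D_u g (s *: u + q)).
Proof.
move=> sg.
have E : (fun h : R => h^-1 *: (g ((h *: 1 + s) *: u + q) - g (s *: u + q)))
   = (fun h => h^-1 *: ((g \o shift (s *: u + q)) (h *: u) - g (s *: u + q))).
  by apply/funext => k; rewrite /= scalerDl scaler1 addrA.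
apply: DeriveDef; last by rewrite /derive /= E.
by rewrite /derivable /= E; exact: Csmooth_derivable.
Qed.

Lemma circle_is_derive (g : V -> R) (s t : R) : Csmooth g ->
  is_derive t 1 (fun x : R => g (polar (s, x)))
    (s * (- sin t * 'D_a g (polar (s, t)) + cos t * 'D_b g (polar (s, t)))).
Proof.
move=> sg; have [drot rotE] := rot_is_diff t.
have dp : differentiable (fun t => polar (s, t)) t.
  apply: differentiableD; last exact: differentiable_cst.
  exact: differentiableZ.
apply: DeriveDef.
  apply: diff_derivable.
  by apply: (@differentiable_comp _ _ _ _ (fun t => polar (s, t)) g) => //; exact: Csmooth_diff.
rewrite deriveE; last first.
  by apply: (@differentiable_comp _ _ _ _ (fun t => polar (s, t)) g) => //; exact: Csmooth_diff.
rewrite diff_comp//=; last exact: Csmooth_diff.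
have -> : 'd (fun t => polar (s, t)) t 1 = s *: (- sin t *: a + cos t *: b).
  rewrite /polar /= diffD//; last exact: differentiableZ.
  by rewrite diff_cst diffZ// rotE /= addr0 scale1r.
rewrite -deriveE; last exact: Csmooth_diff.
by rewrite DdirZ// DdirD// !DdirZ.
Qed.

(** Laplacian at the origin of (s, t) |-> g(p + s a + t b); the case that matters is a = v, b = J v
    with v null. *)
Definition lap (g : V -> R) (p : V) : R :=
  'D_a (fun r => 'D_a g r) p + 'D_b (fun r => 'D_b g r) p.

Lemma lapE (g : V -> R) (p : V) : lap g p = dd a (dd a g) p + dd b (dd b g) p.
Proof. by rewrite !ddE. Qed.

(** The function f in polar coordinates, followed by its first and second radial derivatives. *)
Let F (p : R * R) := f (polar p).
Let dF (p : R * R) :=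
  cos p.2 * 'D_a f (polar p) + sin p.2 * 'D_b f (polar p).
Let ddF (p : R * R) :=
  cos p.2 * (cos p.2 * 'D_a (fun r => 'D_a f r) (polar p) +
             sin p.2 * 'D_b (fun r => 'D_a f r) (polar p)) +
  sin p.2 * (cos p.2 * 'D_a (fun r => 'D_b f r) (polar p) +
             sin p.2 * 'D_b (fun r => 'D_b f r) (polar p)).

Let cont_polar (g : V -> R) : Csmooth g -> continuous (fun p => g (polar p)).
Proof.
move=> sg p; apply: (@continuous_comp _ _ _ polar g).
  exact: polar_continuous.
exact: Csmooth_continuous.
Qed.

Let cont_cos : continuous (fun p : R * R => cos p.2).
Proof.
move=> p; apply: (@continuous_comp _ _ _ snd cos); first exact: cvg_snd.
exact: continuous_cos.
Qed.

Let cont_sin : continuous (fun p : R * R => sin p.2).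
Proof.
move=> p; apply: (@continuous_comp _ _ _ snd sin); first exact: cvg_snd.
exact: continuous_sin.
Qed.

Let cont_mul (g h : R * R -> R) : continuous g -> continuous h ->
  continuous (fun p => g p * h p).
Proof. by move=> cg ch p; apply: cvgM; [exact: cg|exact: ch]. Qed.

Let cont_add (g h : R * R -> R) : continuous g -> continuous h ->
  continuous (fun p => g p + h p).
Proof. by move=> cg ch p; apply: cvgD; [exact: cg|exact: ch]. Qed.

Let sfa : Csmooth (fun r => 'D_a f r). Proof. exact: Csmooth_D. Qed.
Let sfb : Csmooth (fun r => 'D_b f r). Proof. exact: Csmooth_D. Qed.
Let sfaa : Csmooth (fun r => 'D_a (fun r => 'D_a f r) r).
Proof. exact: Csmooth_D. Qed.
Let sfba : Csmooth (fun r => 'D_b (fun r => 'D_a f r) r).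
Proof. exact: Csmooth_D. Qed.
Let sfab : Csmooth (fun r => 'D_a (fun r => 'D_b f r) r).
Proof. exact: Csmooth_D. Qed.
Let sfbb : Csmooth (fun r => 'D_b (fun r => 'D_b f r) r).
Proof. exact: Csmooth_D. Qed.

Let cF : continuous F. Proof. exact: (cont_polar sf). Qed.

Let cont_comb (g h : V -> R) : Csmooth g -> Csmooth h ->
  continuous (fun p : R * R => cos p.2 * g (polar p) + sin p.2 * h (polar p)).
Proof.
move=> sg sh; have c1 := cont_polar sg; have c2 := cont_polar sh.
exact: (cont_add (cont_mul cont_cos c1) (cont_mul cont_sin c2)).
Qed.

Let cdF : continuous dF. Proof. exact: (cont_comb sfa sfb). Qed.

Let cddF : continuous ddF.
Proof.
have c1 := cont_comb sfaa sfba; have c2 := cont_comb sfab sfbb.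
exact: (cont_add (cont_mul cont_cos c1) (cont_mul cont_sin c2)).
Qed.

Let F_is_derive (s t : R) : is_derive s 1 (fun x : R => F (x, t)) (dF (s, t)).
Proof.
have := @line_is_derive f (rot t) s sf.
by rewrite DdirD// !DdirZ.
Qed.

Let dF_is_derive (s t : R) :
  is_derive s 1 (fun x : R => dF (x, t)) (ddF (s, t)).
Proof.
have sg : Csmooth (fun r => cos t * 'D_a f r + sin t * 'D_b f r).
  by apply: Csmooth_add; exact: Csmooth_scale.
have := @line_is_derive _ (rot t) s sg.
rewrite Dadd; [|exact: Csmooth_scale|exact: Csmooth_scale].
rewrite (Dscale _ _ _ sfa) (Dscale _ _ _ sfb).
by rewrite (DdirD _ _ _ sfa) (DdirD _ _ _ sfb) 2!(DdirZ _ _ _ sfa) 2!(DdirZ _ _ _ sfb).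
Qed.

(** The angular derivative of [F]. *)
Let P (s t : R) := s * (- sin t * 'D_a f (polar (s, t)) + cos t * 'D_b f (polar (s, t))).

Let P_is_derive (s t : R) : is_derive t 1 (P s)
  (s ^+ 2 * lap f (polar (s, t)) - s * dF (s, t) - s ^+ 2 * ddF (s, t)).
Proof.
have dc : is_derive t 1 cos (- sin t) by exact: is_derive_cos.
have ds : is_derive t 1 sin (cos t) by exact: is_derive_sin.
have Ha := @circle_is_derive _ s t sfa.
have Hb := @circle_is_derive _ s t sfb.
rewrite /P; apply: is_derive_eq.
rewrite /GRing.scale/= /dF /ddF /lap/=.
set A := 'D_a f _; set B := 'D_b f _.
set AA := 'D_a (fun r => 'D_a f r) _; set BA := 'D_b (fun r => 'D_a f r) _.
set AB := 'D_a (fun r => 'D_b f r) _; set BB := 'D_b (fun r => 'D_b f r) _.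
rewrite -[AA + BB]mul1r -(cos2Dsin2 t).
by set c := cos t; set d := sin t; ring.
Qed.

Let g1 (s : R) := \int[mu]_(t in circ) dF (s, t).

(** In polar coordinates s^2 lap f = s^2 F_ss + s F_s + F_tt. The last term is the t-derivative of
    the periodic function [P s], so it integrates to 0 over the circle. *)
Let circle_ge0 (s : R) : (forall t, 0 <= lap f (polar (s, t))) ->
  0 <= s ^+ 2 * (\int[mu]_(t in circ) ddF (s, t)) + s * g1 s.
Proof.
move=> lap0.
have clap : continuous (fun t : R => lap f (polar (s, t))).
  have c1 := cont_polar sfaa; have c2 := cont_polar sfbb.
  have c12 : continuous (fun p : R * R => lap f (polar p)).
    exact: (cont_add c1 c2).
  exact: (cont_slice1 s c12).
have cdFs := cont_slice1 s cdF; have cddFs := cont_slice1 s cddF.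
pose dP t := s ^+ 2 * lap f (polar (s, t)) - s * dF (s, t) - s ^+ 2 * ddF (s, t).
have cdP : continuous dP.
  move=> t; apply: cvgB; first apply: cvgB.
  - by apply: cvgM; [exact: cvg_cst|exact: clap].
  - by apply: cvgM; [exact: cvg_cst|exact: cdFs].
  - by apply: cvgM; [exact: cvg_cst|exact: cddFs].
have cP : continuous (P s).
  by move=> t; apply/differentiable_continuous/derivable1_diffP; case: (P_is_derive s t).
have pi2 : 0 < 2 * pi :> R by rewrite mulr_gt0// pi_gt0.
have intdP : (\int[mu]_(t in circ) dP t = 0)%R.
  rewrite /Rintegral (@continuous_FTC2 R dP (P s))//.
  - rewrite /P /polar /rot /= mulr_natl cos2pi sin2pi cos0 sin0.
    by rewrite subrr.
  - exact: continuous_subspaceT.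
  - split.
    + by move=> t _; case: (P_is_derive s t).
    + exact/cvg_at_right_filter/cP.
    + exact/cvg_at_left_filter/cP.
  - by move=> t _; rewrite derive1E; case: (P_is_derive s t) => _ ->.
have -> : s ^+ 2 * (\int[mu]_(t in circ) ddF (s, t)) + s * g1 s =
   \int[mu]_(t in circ) (s ^+ 2 * lap f (polar (s, t))).
  rewrite /g1 -!RintegralZl//; try exact: integrable_continuous.
  rewrite -RintegralD//; last 2 first.
  - by apply: integrable_continuous => t; apply: cvgM; [exact: cvg_cst|exact: cddFs].
  - by apply: integrable_continuous => t; apply: cvgM; [exact: cvg_cst|exact: cdFs].
  rewrite -[LHS]addr0 -[X in _ + X]intdP -RintegralD//; last 2 first.
  - apply: integrable_continuous => t; apply: cvgD.
      by apply: cvgM; [exact: cvg_cst|exact: cddFs].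
    by apply: cvgM; [exact: cvg_cst|exact: cdFs].
  - exact: integrable_continuous.
  by apply: eq_Rintegral => t _; rewrite /dP; ring.
by apply: Rintegral_ge0 => t _; rewrite mulr_ge0// sqr_ge0.
Qed.

(* [s * g1 s] is nondecreasing, where [g1] is the derivative of the circle mean. *)
Lemma lap_ge0_submean (r : R) : 0 <= r ->
  (forall s t : R, 0 <= s <= r -> 0 <= lap f (polar (s, t))) ->
  2 * pi * f q <= \int[mu]_(t in circ) f (polar (r, t)).
Proof.
move=> r0 Hlap.
pose g2 s := \int[mu]_(t in circ) ddF (s, t).
have dg (s : R) : is_derive s 1 (fun s : R => \int[mu]_(t in circ) F (s, t)) (g1 s).
  by apply: derive_integral => //; exact: F_is_derive.
have dg1 (s : R) : is_derive s 1 g1 (g2 s).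
  by apply: derive_integral => //; exact: dF_is_derive.
have dM (s : R) : is_derive s 1 (fun s : R => s * g1 s) (g1 s + s * g2 s).
  apply: is_derive_eq.
  by rewrite /GRing.scale/= mulr1 addrC.
have M0 (s : R) : 0 <= s <= r -> 0 <= s * g1 s.
  move=> /andP[s0 sr]; rewrite -(mul0r (g1 0)).
  apply: (@ger0_D_ndecr _ (fun s => s * g1 s)) => // u u0 us.
  case: (dM u) => _ ->.
  have := @circle_ge0 u; rewrite expr2 -mulrA -mulrDr pmulr_rge0// addrC; apply.
  by move=> t; apply: Hlap; rewrite (ltW u0)/= (le_trans (ltW us)).
have -> : 2 * pi * f q = \int[mu]_(t in circ) F (0, t).
  under eq_Rintegral do rewrite /F /polar /= scale0r add0r.
  rewrite Rintegral_cst//= mulrC; congr (_ * _).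
  by rewrite lebesgue_measure_itv/= lte_fin mulr_gt0 ?pi_gt0//= subr0.
apply: (@ger0_D_ndecr _ (fun s => \int[mu]_(t in circ) F (s, t))) => //.
move=> u u0 ur; case: (dg u) => _ ->.
have := M0 u; rewrite pmulr_rge0//; apply.
by rewrite !ltW.
Qed.

End Rotation.
End CircleIntegral.

(** * Hahn-Banach for sublinear functionals on a subspace *)

Section HahnBanach.
Context {R : realType} {V : lmodType R} (E : set V) (p : V -> R).
Hypothesis E0 : E 0.
Hypothesis Elin : forall (c : R) x y, E x -> E y -> E (c *: x + y).
Hypothesis pD : forall x y, E x -> E y -> p (x + y) <= p x + p y.
Hypothesis pZ : forall (c : R) x, 0 < c -> E x -> p (c *: x) = c * p x.
Hypothesis p0 : p 0 = 0.

(* A graph dominated by p is automatically functional. *)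
Let graph (G : set (V * R)) :=
  (forall c u v, G u -> G v -> G (c *: u.1 + v.1, c * u.2 + v.2)) /\
  (forall u, G u -> E u.1 /\ u.2 <= p u.1).

Let graph_fun G x y z : graph G -> G (x, y) -> G (x, z) -> y = z.
Proof.
move=> [Glin Gp] Gy Gz.
have key a b : G (x, a) -> G (x, b) -> a <= b.
  move=> Ga Gb; have := Glin (-1) _ _ Gb Ga.
  rewrite /= scaleN1r addNr mulN1r => /Gp/= [_].
  by rewrite p0 addrC subr_le0.
by apply/eqP; rewrite eq_le !key.
Qed.

Let maximal_graph : exists G, graph G /\ forall H, G `<` H -> ~ graph H.
Proof.
apply: Zorn_bigcup => F FP Ftot; split.
- move=> c u v [A FA Au] [B FB Bv].
  have [AB|BA] := Ftot _ _ FA FB.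
  + by exists B => //; apply: (FP _ FB).1 => //; exact: AB.
  + by exists A => //; apply: (FP _ FA).1 => //; exact: BA.
- by move=> u [A FA Au]; apply: (FP _ FA).2.
Qed.

(** The domain E is a subset and not a type because p will be an infimum that is meaningful only on
    bounded functions; f is then linear on E only. *)
Lemma hahn_banach : exists f : V -> R,
  (forall (c : R) x y, E x -> E y -> f (c *: x + y) = c * f x + f y) /\
  (forall x, E x -> f x <= p x).
Proof.
have [G [GG Gmax]] := maximal_graph.
have [Glin Gp] := GG.
(* The empty relation is also a [graph], so maximality is what excludes it. *)
have G0 : G (0, 0).
  have [[u Gu]|nG] := pselect (exists u, G u).
    have := Glin (-1) _ _ Gu Gu.
    by rewrite scaleN1r addNr mulN1r addNr.
  exfalso; apply: (Gmax [set (0, 0)]).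
    split=> [u Gu|H]; first by exfalso; apply: nG; exists u.
    by apply: nG; exists (0, 0); apply: H.
  split=> [c u v -> ->|u ->] /=; first by rewrite scaler0 addr0 mulr0 addr0.
  by rewrite p0.
have dom x : E x -> exists y, G (x, y).
  move=> Ex; apply: contrapT => nGx.
  have bnd u v : G u -> G v -> u.2 - p (u.1 - x) <= p (v.1 + x) - v.2.
    move=> Gu Gv; have [Eu pu] := Gp _ Gu; have [Ev pv] := Gp _ Gv.
    have := (Gp _ (Glin 1 _ _ Gu Gv)).2; rewrite /= scale1r mul1r => H.
    have EN : E (u.1 - x) by rewrite addrC -scaleN1r; apply: Elin.
    have EP : E (v.1 + x) by rewrite -[v.1]scale1r; apply: Elin.
    have := pD EN EP; rewrite addrACA addNr addr0 => H2.
    by rewrite lerBlDr addrAC lerBrDr [leRHS]addrC (le_trans H).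
  (* A value c at x is admissible iff [u.2 - p (u.1 - x) <= c <= p (v.1 + x) - v.2] for all u, v in
     G; by [bnd] the supremum of the left-hand sides qualifies. *)
  pose S := [set u.2 - p (u.1 - x) | u in G].
  have S0 : S !=set0 by exists (0 - p (0 - x)); exists (0, 0).
  have Sub v : G v -> ubound S (p (v.1 + x) - v.2).
    by move=> Gv _ [u Gu <-]; exact: bnd.
  pose c := sup S.
  have c1 u : G u -> u.2 - p (u.1 - x) <= c.
    move=> Gu; apply: ub_le_sup; last by exists u.
    by exists (p (0 + x) - 0); apply: (Sub (0, 0)).
  have c2 v : G v -> c <= p (v.1 + x) - v.2.
    by move=> Gv; apply: ge_sup => //; exact: Sub.
  (* The graph G enlarged by the line through (x, c). *)
  pose H := [set w : V * R | exists u t, G u /\ w = (u.1 + t *: x, u.2 + t * c)].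
  apply: (Gmax H).
    split=> [u Gu|HG].
      by exists u, 0; rewrite scale0r mul0r !addr0; split=> //; case: u Gu.
    apply: nGx; exists c; apply: HG; exists (0, 0), 1.
    by rewrite scale1r mul1r !add0r.
  split=> [d _ _ [u [s [Gu ->]]] [v [t [Gv ->]]]|_ [u [t [Gu ->]]]] /=.
    exists (d *: u.1 + v.1, d * u.2 + v.2), (d * s + t); split; first exact: (Glin d u v Gu Gv).
    congr (_, _) => /=; last by ring.
    by rewrite scalerDr scalerDl scalerA addrACA.
  have [Eu pu] := Gp _ Gu; split; first by rewrite addrC; apply: Elin.
  have Gs (s : R) : G (s *: u.1, s * u.2).
    by have := Glin s _ _ Gu G0; rewrite /= !addr0.
  (* Positive homogeneity reduces t to -1 or 1, where domination by p is the lower and the upper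
     bound on c. *)
  have [t0|t0|->] := ltrgtP t 0; last by rewrite scale0r mul0r !addr0.
  - pose s := - t; have s0 : 0 < s by rewrite oppr_gt0.
    have := c1 _ (Gs s^-1) => /=.
    have -> : u.1 + t *: x = s *: (s^-1 *: u.1 - x).
      by rewrite scalerBr scalerA divff ?gt_eqF// scale1r scaleNr opprK.
    rewrite pZ//; last by rewrite addrC -scaleN1r; apply: Elin => //; rewrite -[_ *: _]addr0; apply: Elin.
    rewrite lerBlDr -lerBlDl -(ler_pM2l s0) mulrBr mulrA divff ?gt_eqF// mul1r.
    by rewrite mulNr opprK.
  - have := c2 _ (Gs t^-1) => /=.
    have -> : u.1 + t *: x = t *: (t^-1 *: u.1 + x).
      by rewrite scalerDr scalerA divff ?gt_eqF// scale1r.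
    rewrite pZ//; last by apply: Elin.
    by rewrite lerBrDr -(ler_pM2l t0) mulrDr mulrA divff ?gt_eqF// mul1r addrC.
have /choice[f Hf] : forall x, exists y, E x -> G (x, y).
  move=> x; have [/dom[y Gy]|nE] := pselect (E x); first by exists y.
  by exists 0.
exists f; split=> [c x y Ex Ey|x Ex]; last exact: (Gp _ (Hf _ Ex)).2.
apply: (graph_fun GG (Hf _ (Elin c Ex Ey))).
exact: Glin (Hf _ Ex) (Hf _ Ey).
Qed.

End HahnBanach.

(** * Squared distances in x and in y *)

Section AffineCoordinates.
Context {R : realType}.
Notation C3 := (C3 R).
Implicit Types (q v w a : C3).

Definition coordx (j : 'I_3) q : R := q.1 0 j.
Definition coordy (j : 'I_3) q : R := q.2 0 j.

Let coordx_linear j : linear (coordx j).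
Proof. by move=> c u v; rewrite /coordx !mxE. Qed.
HB.instance Definition _ j :=
  GRing.isLinear.Build R C3 R _ (coordx j) (coordx_linear j).

Let coordy_linear j : linear (coordy j).
Proof. by move=> c u v; rewrite /coordy !mxE. Qed.
HB.instance Definition _ j :=
  GRing.isLinear.Build R C3 R _ (coordy j) (coordy_linear j).

Lemma coordx_continuous j : continuous (coordx j).
Proof.
move=> q; apply: (@continuous_comp _ _ _ fst (fun x : 'rV[R]_3 => x 0 j)).
  exact: cvg_fst.
exact: coord_continuous.
Qed.

Lemma coordy_continuous j : continuous (coordy j).
Proof.
move=> q; apply: (@continuous_comp _ _ _ snd (fun x : 'rV[R]_3 => x 0 j)).
  exact: cvg_snd.
exact: coord_continuous.
Qed.

Section SquareSum.
Context (L : 'I_3 -> {linear C3 -> R}) (cL : forall j, continuous (L j)).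
Context (c : 'I_3 -> R).

(** One computation of the constant Hessian serves both [sqx] and [sqy]. *)
Definition sqsum q : R := \sum_(j < 3) (L j q - c j) ^+ 2.

Let sLc j : Csmooth (fun q => L j q - c j).
Proof.
by apply: Csmooth_sub; [exact: Csmooth_linear|exact: Csmooth_cst].
Qed.

Let sqE j : (fun q => (L j q - c j) ^+ 2) = fun q => (L j q - c j) * (L j q - c j).
Proof. by apply/funext => q; rewrite expr2. Qed.

Lemma Csmooth_sqsum : Csmooth sqsum.
Proof. by apply: Csmooth_sum => j; rewrite sqE; exact: Csmooth_mul. Qed.

Let DLc j q v : 'D_v (fun q => L j q - c j) q = L j v.
Proof.
rewrite Dadd; [|exact: Csmooth_linear|exact: Csmooth_cst].
by rewrite Dlinear// derive_cst addr0.
Qed.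

Lemma D_sqsum q v : 'D_v sqsum q = \sum_(j < 3) 2 * L j v * (L j q - c j).
Proof.
rewrite Dsum => [|j]; last by rewrite sqE; exact: Csmooth_mul.
by apply: eq_bigr => j _; rewrite sqE Dmul// DLc; ring.
Qed.

Lemma DD_sqsum q v w :
  'D_w (fun q => 'D_v sqsum q) q = \sum_(j < 3) 2 * L j v * L j w.
Proof.
rewrite (_ : (fun q => _) = fun q => \sum_(j < 3) 2 * L j v * (L j q - c j)).
  rewrite Dsum => [|j]; last exact: Csmooth_scale.
  by apply: eq_bigr => j _; rewrite Dscale// DLc.
by apply/funext => p; rewrite D_sqsum.
Qed.

End SquareSum.

Definition sqx a q : R := dot (q.1 - a.1) (q.1 - a.1).
Definition sqy a q : R := dot (q.2 - a.2) (q.2 - a.2).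

Let sqxE a : sqx a = sqsum (fun j => coordx j) (fun j => a.1 0 j).
Proof.
by apply/funext => q; apply: eq_bigr => j _; rewrite !mxE expr2.
Qed.

Let sqyE a : sqy a = sqsum (fun j => coordy j) (fun j => a.2 0 j).
Proof.
by apply/funext => q; apply: eq_bigr => j _; rewrite !mxE expr2.
Qed.

Lemma Csmooth_sqx a : Csmooth (sqx a).
Proof. by rewrite sqxE; apply: Csmooth_sqsum => j; exact: coordx_continuous. Qed.

Lemma Csmooth_sqy a : Csmooth (sqy a).
Proof. by rewrite sqyE; apply: Csmooth_sqsum => j; exact: coordy_continuous. Qed.

Lemma DD_sqx a q v w : 'D_w (fun q => 'D_v (sqx a) q) q = 2 * dot v.1 w.1.
Proof.
rewrite sqxE DD_sqsum => [|j]; last exact: coordx_continuous.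
by rewrite /dot mulr_sumr; apply: eq_bigr => j _; rewrite mulrA.
Qed.

Lemma DD_sqy a q v w : 'D_w (fun q => 'D_v (sqy a) q) q = 2 * dot v.2 w.2.
Proof.
rewrite sqyE DD_sqsum => [|j]; last exact: coordy_continuous.
by rewrite /dot mulr_sumr; apply: eq_bigr => j _; rewrite mulrA.
Qed.

Lemma dd2_sqx a q v w : dd w (dd v (sqx a)) q = 2 * dot v.1 w.1.
Proof. by rewrite !ddE; exact: DD_sqx. Qed.

Lemma dd2_sqy a q v w : dd w (dd v (sqy a)) q = 2 * dot v.2 w.2.
Proof. by rewrite !ddE; exact: DD_sqy. Qed.

Lemma sqx_ge0 a q : 0 <= sqx a q. Proof. exact: dot_ge0. Qed.
Lemma sqy_ge0 a q : 0 <= sqy a q. Proof. exact: dot_ge0. Qed.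

Lemma compact_sqx_sqy a (A B : R) :
  compact [set q | sqx a q <= A /\ sqy a q <= B].
Proof.
have [M [M0 HA HB]] : exists M : R, [/\ 0 <= M, A <= M ^+ 2 & B <= M ^+ 2].
  exists (1 + `|A| + `|B|); split; first by rewrite !addr_ge0.
  - have := ler_norm A; have := normr_ge0 A; have := normr_ge0 B; nra.
  - have := ler_norm B; have := normr_ge0 A; have := normr_ge0 B; nra.
have cpt (b : 'rV[R]_3) : compact [set x : 'rV[R]_3 | `|x - b| <= M].
  apply: bounded_closed_compact.
    exists (M + `|b|); split; first exact: num_real.
    move=> N HN x /= xb; rewrite (le_trans _ (ltW HN))//.
    by rewrite -lerBlDr (le_trans (lerB_dist _ _)).
  apply: (@preimage_closed _ _ (fun x : 'rV[R]_3 => `|x - b|) [set t | t <= M]).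
    move=> x _.
    have cB : {for x, continuous (fun x : 'rV[R]_3 => x - b)}.
      by apply: continuousB => //; exact: cst_continuous.
    exact: (continuous_comp cB (@norm_continuous _ _ _)).
  exact: closed_le.
apply: (@subclosed_compact _ _
  ([set x : 'rV[R]_3 | `|x - a.1| <= M] `*` [set x : 'rV[R]_3 | `|x - a.2| <= M])).
- rewrite (_ : [set q | _] = sqx a @^-1` [set t | t <= A] `&`
                             sqy a @^-1` [set t | t <= B]) //.
  apply: closedI; apply: preimage_closed; try exact: closed_le.
  - by move=> q _; apply: Csmooth_continuous; exact: Csmooth_sqx.
  - by move=> q _; apply: Csmooth_continuous; exact: Csmooth_sqy.
- by apply: compact_setX; exact: cpt.
- move=> q [/= qA qB]; split; apply: norm_le_sqrt_dot => //.
    exact: le_trans HA.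
  exact: le_trans HB.
Qed.

End AffineCoordinates.

(** * The Levi form on null vectors *)

Section ComplexStructure.
Context {R : realType} {V : normedModType R} (I : V -> V).
Hypothesis II : forall v, I (I v) = - v.
Hypothesis I_lin : forall (c : R) v w, I (c *: v + w) = c *: I v + I w.
Implicit Types (u : V -> R) (q v w : V).

(** This is dd^c u at q on (v, w), since d^c u(v) = - D_(I v) u for the complex structure I. *)
Definition levi u q v w : R := dd w (dd (I v) u) q - dd v (dd (I w) u) q.

Lemma d_dc_levi u q v w : Csmooth u ->
  'D_v (fun p => - 'D_(I w) u p) q - 'D_w (fun p => - 'D_(I v) u p) q =
  levi u q v w.
Proof.
move=> su; have sv := Csmooth_D (I v) su; have sw := Csmooth_D (I w) su.
by rewrite /levi !ddE Dopp// Dopp// opprK addrC.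
Qed.

Lemma leviI u q v : Csmooth u -> levi u q v (I v) = lap v (I v) u q.
Proof.
move=> su; rewrite /levi II lapE.
have -> : dd (- v) u = fun p => - dd v u p.
  by apply/funext => p; rewrite dd_opp.
by rewrite (ddN v (Csmooth_dd v su)) opprK addrC.
Qed.

Lemma levi_lin u q (c : R) v v' w : Csmooth u ->
  levi u q (c *: v + v') w = c * levi u q v w + levi u q v' w.
Proof.
move=> su; rewrite /levi I_lin.
have s1 := Csmooth_dd (I v) su; have s2 := Csmooth_dd (I v') su.
have s3 := Csmooth_dd (I w) su.
have -> : dd (c *: I v + I v') u = fun p => c * dd (I v) u p + dd (I v') u p.
  by apply/funext => p; rewrite dd_lin.
rewrite (dd_lin v v' c q s3) (ddD w (Csmooth_scale c s1) s2) (ddZ w c s1).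
by ring.
Qed.

Lemma Csmooth_levi u v w : Csmooth u -> Csmooth (fun q => levi u q v w).
Proof. by move=> su; apply: Csmooth_sub; do 2 apply: Csmooth_dd. Qed.

Lemma near_dd (O : set V) u v q : open O -> O q -> (forall p, O p -> u p = 0) ->
  dd v u q = 0.
Proof.
move=> oO Oq u0; rewrite ddE (@near_eq_derive _ _ _ u (cst 0)) ?derive_cst//.
by near=> p; rewrite u0//; near: p; exact: open_nbhs_nbhs.
Unshelve. all: by end_near. Qed.

Lemma levi_out (F : set V) u q v w : closed F -> (forall p, ~ F p -> u p = 0) ->
  ~ F q -> levi u q v w = 0.
Proof.
move=> cF u0 nFq.
have oF : open (~` F) by rewrite openC.
have D0 x p : (~` F) p -> dd x u p = 0.
  by move=> nFp; apply: (near_dd _ oF nFp) => r /u0.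
by rewrite /levi (near_dd _ oF nFq (D0 _)) (near_dd _ oF nFq (D0 _)) subrr.
Qed.

End ComplexStructure.

(** * Forms on C^3, their supports and bump functions *)

Section Forms.
Context {R : realType}.
Notation C3 := (C3 R).
Implicit Types (q v w a : C3) (u chi : C3 -> R) (alpha beta : field2 R).

Lemma JJ v : J (J v) = - v.
Proof. by case: v. Qed.

Lemma J_lin (c : R) v w : J (c *: v + w) = c *: J v + J w.
Proof. by case: v => v1 v2; case: w => w1 w2; congr (_, _) => /=; rewrite opprD scalerN. Qed.

(** The square of [enorm]: values alpha(v, J v) are quadratic in v, and bounds in this form avoid
    roots. *)
Definition esq v : R := dot v.1 v.1 + dot v.2 v.2.

Lemma esq_ge0 v : 0 <= esq v.
Proof. by rewrite addr_ge0 ?dot_ge0. Qed.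

Lemma esqJ v : esq (J v) = esq v.
Proof. by rewrite /esq /J /= dotNl dotNr opprK addrC. Qed.

Lemma esq_eq0 v : esq v = 0 -> v = 0.
Proof.
move=> /eqP; rewrite paddr_eq0 ?dot_ge0// => /andP[/eqP/dot_eq0 v1 /eqP/dot_eq0 v2].
by case: v v1 v2 => ? ? /= -> ->.
Qed.

Lemma esqZ (c : R) v : esq (c *: v) = c ^+ 2 * esq v.
Proof. by rewrite /esq /= !dotZl !dotZr; ring. Qed.

(** The sum of the squares of the components of x + iy has real part |x|^2 - |y|^2 and imaginary
    part 2 x . y. *)
Lemma null_vectorP v : null_vector v <->
  [/\ v != 0, dot v.1 v.1 = dot v.2 v.2 & dot v.1 v.2 = 0].
Proof.
rewrite /null_vector.
have -> : \sum_(j < 3) (v.1 0 j +i* v.2 0 j)%C ^+ 2 =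
  ((dot v.1 v.1 - dot v.2 v.2) +i* (2 * dot v.1 v.2))%C :> R[i].
  rewrite /dot -sumrB mulr_sumr !big_ord_recl !big_ord0 !addr0.
  by rewrite !expr2; simpc; congr (_ +i* _)%C; ring.
split=> [[v0 /eqP]|[v0 -> ->]]; last by rewrite subrr mulr0.
rewrite eq_complex /= subr_eq0 mulf_eq0 pnatr_eq0 /=.
by move=> /andP[/eqP ? /eqP ?].
Qed.

Lemma null_vector_esq v : null_vector v ->
  esq v = 2 * dot v.1 v.1 /\ 0 < dot v.1 v.1.
Proof.
move=> /null_vectorP[v0 e1 _]; have e : esq v = 2 * dot v.1 v.1.
  by rewrite /esq -e1; ring.
split=> //; rewrite lt_neqAle dot_ge0 andbT eq_sym.
apply: contra v0 => /eqP e0; apply/eqP/esq_eq0.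
by rewrite e e0 mulr0.
Qed.

(** The standard Kaehler form; its value |v|^2 on (v, J v) makes it the yardstick for test forms. *)
Definition omega : field2 R := fun _ v w => dot v.1 w.2 - dot v.2 w.1.

Lemma omegaJ q v : omega q v (J v) = esq v.
Proof. by rewrite /omega /J /= dotNr opprK. Qed.

Lemma dcE u q v : dc u q v = - 'D_(J v) u q.
Proof.
rewrite /dc /delbar /del.
move: ('D_v u q) ('D_(J v) u q) => x y; simpc; rewrite /=.
by rewrite -opprD -splitr.
Qed.

Lemma ddcE u q v w : Csmooth u -> ddc u q v w = levi (@J R) u q v w.
Proof.
move=> su; rewrite -d_dc_levi// /ddc /d1.
have E x : (fun p => dc u p x) = fun p => - 'D_(J x) u p.
  by apply/funext => p; exact: dcE.
by congr ('D_v _ q - 'D_w _ q); exact: E.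
Qed.

Lemma ddcJ u q v : Csmooth u -> ddc u q v (J v) = lap v (J v) u q.
Proof. by move=> su; rewrite ddcE//; apply: leviI => //; exact: JJ. Qed.

Lemma lap_sqx a q v : lap v (J v) (sqx a) q = 2 * esq v.
Proof.
rewrite lapE 2!dd2_sqx /esq -mulrDr; congr (_ * (_ + _)).
by rewrite /J /= dotNl dotNr opprK.
Qed.

Lemma lap_sqy a q v : lap v (J v) (sqy a) q = 2 * esq v.
Proof. by rewrite lapE 2!dd2_sqy /esq -mulrDr addrC. Qed.

Lemma is_form2Dr alpha q v w w' (c : R) : is_form2 alpha ->
  alpha q v (c *: w + w') = c * alpha q v w + alpha q v w'.
Proof. by move=> [lin anti]; rewrite !(anti _ v) lin opprD mulrN. Qed.

Lemma is_form2_ddc u : Csmooth u -> is_form2 (ddc u).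
Proof.
move=> su; split=> [q c v v' w|q v w]; rewrite !ddcE//.
  by apply: levi_lin => //; exact: J_lin.
by rewrite opprB.
Qed.

Lemma Csmooth_ddc u v w : Csmooth u -> Csmooth (fun q => ddc u q v w).
Proof.
move=> su; rewrite (_ : (fun q => _) = fun q => levi (@J R) u q v w).
  exact: Csmooth_levi.
by apply/funext => q; rewrite ddcE.
Qed.

Lemma form_supp_out alpha q v w : ~ form_supp alpha q -> alpha q v w = 0.
Proof.
move=> nq; apply: contrapT => /eqP H; apply: nq; apply: subset_closure.
by exists v, w.
Qed.

Lemma fun_supp_out u q : ~ fun_supp u q -> u q = 0.
Proof.
move=> nq; apply: contrapT => /eqP H; apply: nq; exact: subset_closure.
Qed.

Lemma ddc_out (F : set C3) u q v w : closed F -> (forall p, ~ F p -> u p = 0) ->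
  Csmooth u -> ~ F q -> ddc u q v w = 0.
Proof.
move=> cF u0 su nFq; rewrite ddcE//.
exact: levi_out nFq.
Qed.

Lemma supp_sub_form (F : set C3) alpha : closed F ->
  (forall q v w, ~ F q -> alpha q v w = 0) -> form_supp alpha `<=` F.
Proof.
move=> cF H; rewrite [X in _ `<=` X](closure_id F).1//.
apply: closureS => q [v [w]]; apply: contra_neqP => nF; exact: H.
Qed.

Lemma supp_sub_fun (F : set C3) u : closed F ->
  (forall q, ~ F q -> u q = 0) -> fun_supp u `<=` F.
Proof.
move=> cF H; rewrite [X in _ `<=` X](closure_id F).1//.
by apply: closureS => q; apply: contra_neqP => nF; exact: H.
Qed.

Lemma test_form2_in (F : set C3) alpha : is_form2 alpha ->
  (forall v w, Csmooth (fun q => alpha q v w)) -> closed F -> compact F ->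
  (forall q v w, ~ F q -> alpha q v w = 0) -> test_form2 alpha.
Proof.
move=> fa sa cF kF H; split=> //.
by apply: (subclosed_compact _ kF) => //; [exact: closed_closure|exact: supp_sub_form].
Qed.

Lemma test_fun_in (F : set C3) u : Csmooth u -> closed F -> compact F ->
  (forall q, ~ F q -> u q = 0) -> test_fun u.
Proof.
move=> su cF kF H; split=> //.
by apply: (subclosed_compact _ kF) => //; [exact: closed_closure|exact: supp_sub_fun].
Qed.

Lemma test_form2_ddc u : test_fun u -> test_form2 (ddc u).
Proof.
move=> [su ku]; apply: (@test_form2_in (fun_supp u)) => //.
- exact: is_form2_ddc.
- by move=> v w; exact: Csmooth_ddc.
- exact: closed_closure.
- move=> q v w; apply: ddc_out => //; first exact: closed_closure.
  by move=> p; exact: fun_supp_out.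
Qed.

Lemma test_form2_mul chi alpha : Csmooth chi -> test_form2 alpha ->
  test_form2 (fun q v w => chi q * alpha q v w).
Proof.
move=> sc [[lin anti] sa ka]; apply: (@test_form2_in (form_supp alpha)) => //.
- split=> [q c v v' w|q v w]; first by rewrite lin; ring.
  by rewrite anti mulrN.
- by move=> v w; apply: (Csmooth_mul sc); exact: sa.
- exact: closed_closure.
- by move=> q v w /form_supp_out ->; rewrite mulr0.
Qed.

Lemma test_form2_lin (c : R) alpha beta : test_form2 alpha -> test_form2 beta ->
  test_form2 (fun q v w => c * alpha q v w + beta q v w).
Proof.
move=> [[lin anti] sa ka] [[lin' anti'] sb kb].
apply: (@test_form2_in (form_supp alpha `|` form_supp beta)).
- split=> [q d v v' w|q v w]; first by rewrite lin lin'; ring.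
  by rewrite anti anti'; ring.
- move=> v w; apply: (@Csmooth_add _ _ (fun q => c * alpha q v w)).
    by apply: Csmooth_scale; exact: sa.
  exact: sb.
- by apply: closedU; exact: closed_closure.
- exact: compactU.
- move=> q v w /not_orP[/form_supp_out -> /form_supp_out ->].
  by rewrite mulr0 addr0.
Qed.

Lemma is_form2_omega : is_form2 omega.
Proof.
split=> [q c v v' w|q v w]; rewrite /omega /=.
  by rewrite !dotDl !dotZl; ring.
by rewrite (dotC v.1) (dotC v.2) opprB.
Qed.

Lemma test_form2_omega chi : test_fun chi ->
  test_form2 (fun q v w => chi q * omega q v w).
Proof.
move=> [sc kc]; apply: (@test_form2_in (fun_supp chi)) => //.
- have [lin anti] := is_form2_omega.
  split=> [q c v v' w|q v w]; first by rewrite lin; ring.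
  by rewrite anti mulrN.
- by move=> v w; apply: (Csmooth_mul sc); exact: Csmooth_cst.
- exact: closed_closure.
- by move=> q v w /fun_supp_out ->; rewrite mul0r.
Qed.

(** Equals 1 on the Euclidean ball of radius d about a and 0 beyond radius sqrt(2) d, whence the
    constants [2 * d ^+ 2] that follow. *)
Definition ballbump a (d : R) : C3 -> R :=
  cutoff (fun q => d ^- 2 * (sqx a q + sqy a q)).

Lemma Csmooth_ballbump a d : Csmooth (ballbump a d).
Proof.
apply: Csmooth_cutoff; apply: Csmooth_scale.
by apply: Csmooth_add; [exact: Csmooth_sqx|exact: Csmooth_sqy].
Qed.

Lemma ballbump_out a d q : 0 < d -> 2 * d ^+ 2 < sqx a q + sqy a q -> ballbump a d q = 0.
Proof.
move=> d0 H; apply: cutoff_eq0.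
by rewrite mulrC ler_pdivlMr ?exprn_gt0// ltW.
Qed.

Lemma ballbump_in a d q : 0 < d -> sqx a q + sqy a q <= d ^+ 2 -> ballbump a d q = 1.
Proof.
move=> d0 H; apply: cutoff_eq1.
by rewrite mulrC ler_pdivrMr ?exprn_gt0// mul1r.
Qed.

Lemma closed_sqball a (d : R) : closed [set q | sqx a q + sqy a q <= d].
Proof.
apply: (@preimage_closed _ _ (fun q => sqx a q + sqy a q) [set t | t <= d]).
  move=> q _; apply: Csmooth_continuous.
  by apply: Csmooth_add; [exact: Csmooth_sqx|exact: Csmooth_sqy].
exact: closed_le.
Qed.

Lemma compact_sqball a (d : R) : compact [set q | sqx a q + sqy a q <= d].
Proof.
apply: (subclosed_compact (@closed_sqball a d) (compact_sqx_sqy (a := a) (A := d) (B := d))).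
move=> q /= H; split; apply: le_trans H.
  by rewrite lerDl sqy_ge0.
by rewrite lerDr sqx_ge0.
Qed.

Lemma test_fun_ballbump a d : 0 < d -> test_fun (ballbump a d).
Proof.
move=> d0; apply: (@test_fun_in [set q | sqx a q + sqy a q <= 2 * d ^+ 2]).
- exact: Csmooth_ballbump.
- exact: closed_sqball.
- exact: compact_sqball.
- by move=> q /= /negP; rewrite -ltNge; exact: ballbump_out.
Qed.

Lemma sqx_center a : sqx a a = 0.
Proof. by rewrite /sqx subrr /dot big1// => j _; rewrite !mxE mul0r. Qed.

Lemma sqy_center a : sqy a a = 0.
Proof. by rewrite /sqy subrr /dot big1// => j _; rewrite !mxE mul0r. Qed.

Lemma small_sqball (U : set C3) a : open U -> U a ->
  exists2 d, 0 < d & [set q | sqx a q + sqy a q <= 2 * d ^+ 2] `<=` U.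
Proof.
move=> oU Ua; have : nbhs a U by exact: open_nbhs_nbhs.
(* With d = e / 4, 2 d^2 <= (e / 2)^2, so both components are within e / 2 < e in the maximum
   norm. *)
move=> /nbhs_ballP[e /= e0 He]; exists (e / 4); first by rewrite divr_gt0.
have e20 : 0 <= e / 2 by rewrite divr_ge0// ltW.
have bnd (b x : 'rV[R]_3) : dot (x - b) (x - b) <= (e / 2) ^+ 2 -> `|b - x| < e.
  move=> H; rewrite distrC; apply: (@le_lt_trans _ _ (e / 2)).
    exact: norm_le_sqrt_dot.
  by rewrite ltr_pdivrMr// ltr_pMr// ltr1n.
have e2 : 2 * (e / 4) ^+ 2 <= (e / 2) ^+ 2.
  by have := sqr_ge0 e; rewrite !expr2; lra.
move=> q /= H; apply: He; rewrite -ball_normE /=.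
change (Num.max `|a.1 - q.1| `|a.2 - q.2| < e).
rewrite gt_max; apply/andP; split; apply: bnd; apply: le_trans e2; apply: le_trans H.
  by rewrite lerDl sqy_ge0.
by rewrite lerDr sqx_ge0.
Qed.

End Forms.

(** * Linearity and monotonicity of currents *)

Section Currents.
Context {R : realType}.
Notation C3 := (C3 R).
Implicit Types (alpha beta : field2 R).
Context (T : field2 R -> R) (Tlin : test_linear T).

Lemma current_scale (c : R) alpha : test_form2 alpha ->
  T (fun q v w => c * alpha q v w) = c * T alpha.
Proof.
move=> ta.
(* Linearity is available only for combinations a alpha + beta, so c alpha is read as (c - 1) alpha
   + alpha. *)
have := Tlin (c - 1) ta ta.
rewrite -[RHS](_ : c * T alpha = _); last by ring.
move=> <-; congr T; apply/funext => q; apply/funext => v; apply/funext => w.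
by ring.
Qed.

Lemma current_add alpha beta : test_form2 alpha -> test_form2 beta ->
  T (fun q v w => alpha q v w + beta q v w) = T alpha + T beta.
Proof.
move=> ta tb; rewrite -[T alpha]mul1r -Tlin//.
congr T; apply/funext => q; apply/funext => v; apply/funext => w.
by rewrite mul1r.
Qed.

Lemma current_sub alpha beta : test_form2 alpha -> test_form2 beta ->
  T (fun q v w => alpha q v w - beta q v w) = T alpha - T beta.
Proof.
move=> ta tb; rewrite addrC -mulN1r -Tlin//.
congr T; apply/funext => q; apply/funext => v; apply/funext => w.
by rewrite mulN1r addrC.
Qed.

Lemma current_le alpha beta : null_positive_current T ->
  test_form2 alpha -> test_form2 beta ->
  (forall q v, null_vector v -> alpha q v (J v) <= beta q v (J v)) ->
  T alpha <= T beta.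
Proof.
move=> Tp ta tb H; rewrite -subr_ge0 -current_sub//; apply: Tp.
  have := test_form2_lin (-1) ta tb.
  congr test_form2; apply/funext => q; apply/funext => v; apply/funext => w.
  by rewrite mulN1r addrC.
by move=> q v nv; rewrite subr_ge0 H.
Qed.

End Currents.

(** * Point currents on the tube *)

Section TubePoints.
Context {R : realType}.
Notation C3 := (C3 R).

(** The null vector (1, i, 0). *)
Definition null0 : C3 := (delta_mx 0 0, delta_mx 0 1).

Lemma dot_delta (i j : 'I_3) :
  dot (delta_mx 0 i) (delta_mx 0 j : 'rV[R]_3) = (i == j)%:R.
Proof.
rewrite /dot (bigD1 i)//= big1 => [|k ki]; rewrite !mxE ?eqxx /=.
  by rewrite addr0 mul1r.
by rewrite (negPf ki) mul0r.
Qed.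

Lemma null0_null : null_vector null0.
Proof.
apply/null_vectorP; rewrite /null0/= !dot_delta !eqxx; split=> //.
apply/eqP => /(congr1 (fun v : C3 => v.1 0 0)); rewrite !mxE/= => /eqP.
by rewrite oner_eq0.
Qed.

Lemma esq_null0 : esq null0 = 2.
Proof. by rewrite /esq /null0 /= !dot_delta !eqxx -natrD. Qed.

Lemma norm_le1_esq (v : C3) : enorm v = 1 -> esq v = 1.
Proof.
move=> v1; rewrite -[esq v]sqr_sqrtr; last exact: esq_ge0.
by rewrite -[Num.sqrt _]/(enorm v) v1 expr1n.
Qed.

(** The value alpha(v, J v) is homogeneous of degree two in v and J preserves [enorm], so the bound
    on unit vectors scales by |v|^2. *)
Lemma comass_bound (alpha : field2 R) (B : R) (q v : C3) : is_form2 alpha ->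
  (forall q v w, enorm v = 1 -> enorm w = 1 -> `|alpha q v w| <= B) ->
  `|alpha q v (J v)| <= B * esq v.
Proof.
move=> fa H; have [e0|e0] := eqVneq (esq v) 0.
  have -> : v = 0 by exact: esq_eq0.
  have [lin _] := fa.
  have z w : alpha q 0 w = 0.
    have := lin q 0 0 0 w; rewrite scale0r add0r mul0r add0r => /eqP.
    have := lin q 1 0 0 w; rewrite scaler0 addr0 mul1r => /eqP.
    by rewrite -subr_eq0 opprD addNKr oppr_eq0 => /eqP.
  by rewrite z normr0 /esq /dot !big1 ?addr0 ?mulr0// => j _; rewrite !mxE mul0r.
have es : 0 < esq v by rewrite lt_neqAle eq_sym e0 esq_ge0.
pose s := Num.sqrt (esq v).
have s0 : 0 < s by rewrite sqrtr_gt0.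
have ss : s ^+ 2 = esq v by rewrite sqr_sqrtr// ltW.
pose w := s^-1 *: v.
have w1 : esq w = 1 by rewrite esqZ exprVn ss mulVf.
have vw : v = s *: w by rewrite scalerA divff ?gt_eqF// scale1r.
have JZ (c : R) x : J (c *: x) = c *: J x.
  by rewrite /J; congr (_, _); rewrite /= scalerN.
have E : alpha q v (J v) = s ^+ 2 * alpha q w (J w).
  have [lin anti] := fa.
  have lZ c x y : alpha q (c *: x) y = c * alpha q x y.
    have := lin q c x 0 y; rewrite addr0 => ->.
    have := lin q (-1) 0 0 y; rewrite scaler0 addr0 mulN1r addNr => ->.
    by rewrite addr0.
  by rewrite {1 2}vw JZ lZ anti lZ [in X in _ * - (_ * X)]anti; ring.
rewrite E normrM ger0_norm ?sqr_ge0// ss mulrC ler_wpM2r ?esq_ge0//.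
by apply: H; rewrite /enorm -/(esq _) ?esqJ ?w1 ?sqrtr1.
Qed.

Lemma norm_pair_le (v : C3) (e : R) : `|v.1| <= e -> `|v.2| <= e -> `|v| <= e.
Proof.
by move=> v1 v2; change (Num.max `|v.1| `|v.2| <= e); rewrite ge_max v1.
Qed.

Lemma norm_fst_le (v : C3) : `|v.1| <= `|v|.
Proof. by change (`|v.1| <= Num.max `|v.1| `|v.2|); rewrite le_max lexx. Qed.

Lemma norm_snd_le (v : C3) : `|v.2| <= `|v|.
Proof. by change (`|v.2| <= Num.max `|v.1| `|v.2|); rewrite le_max lexx orbT. Qed.

Lemma enorm_norm_le1 (v : C3) : enorm v = 1 -> `|v| <= 1.
Proof.
move=> /norm_le1_esq v1; apply: norm_pair_le; apply: norm_le_sqrt_dot => //;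
  rewrite expr1n -v1 /esq.
  by rewrite lerDl dot_ge0.
by rewrite lerDr dot_ge0.
Qed.

(* A point of the tube carries the current of evaluation on a null direction:
   its ddc is supported on the tube, where nothing is required. *)
Lemma tube_sub_hull (K : set 'rV[R]_3) : tube K `<=` current_null_hull (tube K).
Proof.
move=> q0 Kq0; pose T (alpha : field2 R) := alpha q0 null0 (J null0).
have Tsupp : current_supp T `<=` [set q0].
  move=> q Tq; apply: contrapT => /= qq0.
  have oU : open (~` [set q0]).
    by rewrite openC; apply: accessible_closed_set1; exact: hausdorff_accessible (@norm_hausdorff _ _).
  have [alpha [_ sa /eqP]] := Tq _ oU qq0; apply.
  by apply: form_supp_out => /sa; apply.
exists T; last first.
  move=> U oU Uq0; have [d d0 Hd] := small_sqball oU Uq0.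
  exists (fun q v w => ballbump q0 d q * omega q v w); split.
  - by apply: test_form2_omega; exact: test_fun_ballbump.
  - apply: subset_trans Hd; apply: supp_sub_form; first exact: closed_sqball.
    move=> q v w /= /negP; rewrite -ltNge => H.
    by rewrite ballbump_out ?mul0r.
  - rewrite /T ballbump_in//; last by rewrite sqx_center sqy_center addr0 sqr_ge0.
    by rewrite mul1r omegaJ esq_null0 pnatr_eq0.
have ndelta (j : 'I_3) : `|delta_mx 0 j : 'rV[R]_3| <= 1.
  by apply: norm_le_sqrt_dot => //; rewrite dot_delta eqxx expr1n.
have n0 : `|null0| <= 1 by apply: norm_pair_le; exact: ndelta.
have Jn0 : `|J null0| <= 1 by apply: norm_pair_le; rewrite /= ?normrN; exact: ndelta.
split.
- split=> [a alpha beta _ _|A kA|alpha [fa _ _] H] //.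
  + exists 0%N, 1 => alpha B ta sA H; rewrite mul1r.
    exact: (H [::]).
  (* As J (J v) = - v, antisymmetry gives alpha(J v, J (J v)) = alpha(v, J v); a form that changes
     sign under J therefore vanishes on (v, J v). *)
  + rewrite /T; have := H q0 null0 (J null0).
    rewrite JJ; have [lin anti] := fa.
    have -> : - null0 = (-1) *: null0 + 0 by rewrite addr0 scaleN1r.
    rewrite (is_form2Dr _ _ _ _ _ fa) mulN1r.
    have := is_form2Dr q0 (J null0) 0 0 (-1) fa.
    rewrite scaler0 addr0 mulN1r addNr => ->.
    by rewrite addr0 anti opprK; lra.
- by move=> alpha _ np; apply: np; exact: null0_null.
- apply: (@le_lt_trans _ _ 2%:E); last exact: ltry.
  apply: ge_ereal_sup => _ [alpha [[fa _ _] ca] <-]; rewrite lee_fin.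
  have := @comass_bound alpha 1 q0 null0 fa.
  by rewrite mul1r esq_null0; apply.
- exists `|q0.1|; split; first exact: num_real.
  by move=> M HM _ [q /Tsupp -> <-]; exact: ltW.
- move=> u [su _] _ uU; rewrite /T.
  rewrite (@ddc_out _ (fun_supp u))//; first exact: closed_closure.
    by move=> p; exact: fun_supp_out.
  by move=> /uU; apply.
Qed.

End TubePoints.

(** * Uniform bounds on test functions and test forms *)

Section Bounds.
Context {R : realType}.
Notation C3 := (C3 R).

(** The standard real basis of C^3: [true] marks the directions of x, [false] those of y. *)
Definition ebasis (k : bool * 'I_3) : C3 :=
  if k.1 then (delta_mx 0 k.2, 0) else (0, delta_mx 0 k.2).

Definition ecoord (k : bool * 'I_3) (v : C3) : R :=
  if k.1 then v.1 0 k.2 else v.2 0 k.2.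

Lemma C3_ext (v w : C3) : v.1 = w.1 -> v.2 = w.2 -> v = w.
Proof. by case: v => ? ?; case: w => ? ? /= -> ->. Qed.

Lemma ebasisE (v : C3) : v = \sum_k ecoord k v *: ebasis k.
Proof.
rewrite -(pair_bigA _ (fun b j => ecoord (b, j) v *: ebasis (b, j))) /=.
rewrite big_bool /ecoord /ebasis /=.
have E1 : \sum_(j < 3) v.1 0 j *: (delta_mx 0 j, 0) = (v.1, 0) :> C3.
  pose F (x : 'rV[R]_3) : C3 := (x, 0).
  have FD : {morph F : x y / x + y} by move=> x y; apply: C3_ext; rewrite /= ?addr0.
  rewrite [in RHS](row_sum_delta v.1) -[RHS]/(F _) (big_morph F FD (erefl _)).
  by apply: eq_bigr => j _; apply: C3_ext; rewrite /= ?scaler0.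
have E2 : \sum_(j < 3) v.2 0 j *: (0, delta_mx 0 j) = (0, v.2) :> C3.
  pose F (x : 'rV[R]_3) : C3 := (0, x).
  have FD : {morph F : x y / x + y} by move=> x y; apply: C3_ext; rewrite /= ?addr0.
  rewrite [in RHS](row_sum_delta v.2) -[RHS]/(F _) (big_morph F FD (erefl _)).
  by apply: eq_bigr => j _; apply: C3_ext; rewrite /= ?scaler0.
by rewrite E1 E2; apply: C3_ext; rewrite /= ?addr0 ?add0r.
Qed.

Lemma ecoord_le_norm k (v : C3) : `|ecoord k v| <= `|v|.
Proof.
rewrite /ecoord; case: ifP => _.
  exact: le_trans (coord_le_norm _ _) (norm_fst_le _).
exact: le_trans (coord_le_norm _ _) (norm_snd_le _).
Qed.

Lemma sqr_ecoord_le k (v : C3) : ecoord k v ^+ 2 <= esq v.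
Proof.
rewrite /ecoord /esq; case: ifP => _; apply: le_trans (sqr_coord_le_dot _ _) _.
  by rewrite lerDl dot_ge0.
by rewrite lerDr dot_ge0.
Qed.

Lemma lin_sum (b : C3 -> R) (v : C3) :
  (forall (c : R) x y, b (c *: x + y) = c * b x + b y) ->
  b v = \sum_k ecoord k v * b (ebasis k).
Proof.
move=> lin; have b0 : b 0 = 0.
  by have := lin (-1) 0 0; rewrite scaler0 addr0 mulN1r addNr.
rewrite {1}[v]ebasisE.
by elim/big_rec2: _ => // k y x _ <-; rewrite lin.
Qed.

Lemma test_fun_bounded (u : C3 -> R) : test_fun u ->
  exists2 B, 0 <= B & forall q, `|u q| <= B.
Proof.
move=> [su ku].
have /compact_bounded[M [_ HM]] : compact (u @` fun_supp u).
  apply: continuous_compact => //; apply: continuous_subspaceT.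
  exact: Csmooth_continuous.
exists (`|M| + 1) => [|q]; first by rewrite addr_ge0.
have [qs|nqs] := pselect (fun_supp u q); last first.
  by rewrite fun_supp_out// normr0 addr_ge0.
apply: (HM (`|M| + 1)); last by exists q.
by rewrite (le_lt_trans (ler_norm M))// ltrDl.
Qed.

Lemma test_fun_dd (u : C3 -> R) v : test_fun u -> test_fun (dd v u).
Proof.
move=> [su ku]; apply: (@test_fun_in _ (fun_supp u)) => //.
- exact: Csmooth_dd.
- exact: closed_closure.
- move=> q nq; apply: (@near_dd _ _ (~` fun_supp u)) => //.
    by rewrite openC; exact: closed_closure.
  by move=> p; exact: fun_supp_out.
Qed.

Lemma uniform_bound (I : finType) (A : Type) (F : I -> A -> R) :
  (forall i, exists2 B, 0 <= B & forall a, `|F i a| <= B) ->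
  exists2 B, 0 <= B & forall i a, `|F i a| <= B.
Proof.
move=> H; have /choice[B HB] : forall i, exists B, 0 <= B /\ forall a, `|F i a| <= B.
  by move=> i; have [B] := H i; exists B.
exists (\sum_i B i) => [|i a]; first by apply: sumr_ge0 => i _; case: (HB i).
rewrite (le_trans ((HB i).2 a))// (bigD1 i)//= lerDl.
by apply: sumr_ge0 => j _; case: (HB j).
Qed.

(** The coefficients on the finite basis are compactly supported, hence bounded; in the expansion of
    alpha(v, J v) they are multiplied by coordinates of v and J v, each of size at most |v|. *)
Lemma test_form_bounded (alpha : field2 R) : test_form2 alpha ->
  exists2 C, 0 <= C & forall q v, `|alpha q v (J v)| <= C * esq v.
Proof.
move=> [fa sa ka]; have [lin anti] := fa.
have [B B0 HB] : exists2 B, 0 <= B & forall (kl : (bool * 'I_3) * (bool * 'I_3)) q,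
    `|alpha q (ebasis kl.1) (ebasis kl.2)| <= B.
  apply: uniform_bound => -[k l] /=.
  apply: (@test_fun_bounded (fun q => alpha q (ebasis k) (ebasis l))).
  apply: (@test_fun_in _ (form_supp alpha)) => //.
  - exact: sa.
  - exact: closed_closure.
  - by move=> q; exact: form_supp_out.
exists (\sum_(k : bool * 'I_3) \sum_(l : bool * 'I_3) B) => [|q v].
  by do 2 apply: sumr_ge0 => ? _.
have -> : alpha q v (J v) = \sum_k \sum_l
    ecoord k v * ecoord l (J v) * alpha q (ebasis k) (ebasis l).
  rewrite (@lin_sum (fun x => alpha q x (J v))); last by move=> *; exact: lin.
  apply: eq_bigr => k _.
  rewrite (@lin_sum (fun x => alpha q (ebasis k) x)); last first.
    by move=> *; exact: is_form2Dr.
  by rewrite mulr_sumr; apply: eq_bigr => l _; rewrite mulrA.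
rewrite mulr_suml; apply: (le_trans (ler_norm_sum _ _ _)); apply: ler_sum => k _.
rewrite mulr_suml; apply: (le_trans (ler_norm_sum _ _ _)); apply: ler_sum => l _.
rewrite normrM mulrC ler_pM// ?(HB (k, l))//.
have h1 := sqr_ecoord_le k v; have h2 := sqr_ecoord_le l (J v).
rewrite esqJ in h2; rewrite ler_norml; apply/andP; split; nra.
Qed.

Lemma test_fun_lip (u : C3 -> R) : test_fun u ->
  exists2 C, 0 <= C & forall v q, `|dd v u q| <= C * `|v|.
Proof.
move=> tu; have su : Csmooth u by case: tu.
have [B B0 HB] : exists2 B, 0 <= B & forall k q, `|dd (ebasis k) u q| <= B.
  by apply: uniform_bound => k; apply/test_fun_bounded/test_fun_dd.
exists (\sum_(k : bool * 'I_3) B) => [|v q]; first by apply: sumr_ge0.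
rewrite (@lin_sum (fun x => dd x u q)); last by move=> *; exact: dd_lin.
rewrite mulr_suml; apply: (le_trans (ler_norm_sum _ _ _)); apply: ler_sum => k _.
by rewrite normrM mulrC ler_pM// ecoord_le_norm.
Qed.

Lemma dd_sum (V : normedModType R) (v : V) (I : Type) (r : seq I)
    (F : I -> V -> R) : (forall i, Csmooth (F i)) ->
  Csmooth (fun p => \sum_(i <- r) F i p) /\
  dd v (fun p => \sum_(i <- r) F i p) = fun q => \sum_(i <- r) dd v (F i) q.
Proof.
move=> sF; elim: r => [|i r [sr Hr]].
  split; first by under eq_fun do rewrite big_nil; exact: Csmooth_cst.
  under eq_fun do rewrite big_nil; rewrite dd_cst.
  by apply/funext => q; rewrite big_nil.
split; first by under eq_fun do rewrite big_cons; exact: Csmooth_add.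
under eq_fun do rewrite big_cons; rewrite ddD// Hr.
by apply/funext => q; rewrite big_cons.
Qed.

(** Expand one of the two directions in the basis and apply the first-order bound to the partial
    derivatives of u. *)
Lemma test_fun_lip2 (u : C3 -> R) : test_fun u ->
  exists2 C, 0 <= C & forall v q, `|dd v (dd v u) q| <= C * `|v| ^+ 2.
Proof.
move=> tu; have su : Csmooth u by case: tu.
have H k : exists2 C, 0 <= C & forall (vq : C3 * C3), `|dd vq.1 (dd (ebasis k) u) vq.2| <= C * `|vq.1|.
  have [C C0 HC] := test_fun_lip (test_fun_dd (ebasis k) tu).
  by exists C => // -[v q] /=.
have /choice[B HB] : forall k, exists B, 0 <= B /\
    forall (vq : C3 * C3), `|dd vq.1 (dd (ebasis k) u) vq.2| <= B * `|vq.1|.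
  by move=> k; have [B] := H k; exists B.
exists (\sum_(k : bool * 'I_3) B k) => [|v q].
  by apply: sumr_ge0 => k _; case: (HB k).
have sk k : Csmooth (dd (ebasis k) u) by exact: Csmooth_dd.
have -> : dd v (dd v u) q = \sum_k ecoord k v * dd v (dd (ebasis k) u) q.
  have -> : dd v u = fun p => \sum_k ecoord k v * dd (ebasis k) u p.
    apply/funext => p; rewrite (@lin_sum (fun x => dd x u p))//.
    by move=> *; exact: dd_lin.
  rewrite (dd_sum _ _ (fun k => Csmooth_scale (ecoord k v) (sk k))).2.
  by apply: eq_bigr => k _; rewrite (ddZ v (ecoord k v) (sk k)).
rewrite mulr_suml; apply: (le_trans (ler_norm_sum _ _ _)); apply: ler_sum => k _.
rewrite normrM expr2 mulrA [leRHS]mulrC ler_pM// ?ecoord_le_norm//.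
exact: (HB k).2 (v, q).
Qed.

Lemma segment_MVT (V : normedModType R) (u : V -> R) (q h : V) : Csmooth u ->
  exists2 s : R, 0 <= s <= 1 & u (h + q) - u q = dd h u (s *: h + q).
Proof.
move=> su.
have dl s := @line_is_derive _ _ q u h s su.
have cl : {within `[0%R, 1%R], continuous (fun s : R => u (s *: h + q))}.
  by apply: derivable_within_continuous => s _; case: (dl s).
have [s] := @MVT R (fun s : R => u (s *: h + q)) (fun s => 'D_h u (s *: h + q)) 0 1 ltr01 (fun s _ => dl s) cl.
rewrite in_itv/= => /andP[s0 s1]; rewrite subr0 mulr1 scale1r scale0r add0r => ->.
by exists s; [rewrite !ltW|rewrite ddE].
Qed.

End Bounds.

(** * The maximum principle on the minimal hull *)

Section FiberSup.
Context {R : realType}.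
Notation C3 := (C3 R).
Notation mu := (@lebesgue_measure R).
Notation circ := (`[0%R, (2 * pi)%R]%classic : set R).

Lemma plane_point_continuous n (a v1 v2 : 'rV[R]_n) : continuous (plane_point a v1 v2).
Proof.
move=> p; apply: cvgD; first apply: cvgD.
- exact: cvg_cst.
- by apply: cvgZr_tmp; exact: cvg_fst.
- by apply: cvgZr_tmp; exact: cvg_snd.
Qed.

Lemma lip_continuous (V : normedModType R) (f : V -> R) (C : R) : 0 <= C ->
  (forall x y, `|f y - f x| <= C * `|y - x|) -> continuous f.
Proof.
move=> C0 H x; apply/cvgrPdist_le => e e0.
have C1 : 0 < C + 1 by rewrite ltr_wpDl.
near=> y.
rewrite distrC (le_trans (H x y))//.
apply: (@le_trans _ _ ((C + 1) * `|y - x|)).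
  by rewrite ler_wpM2r// lerDl.
rewrite mulrC -ler_pdivlMr//.
rewrite distrC; near: y; apply/nbhs_normP.
by exists (e / (C + 1)) => [|y /= /ltW]; first by rewrite /= divr_gt0.
Unshelve. all: by end_near. Qed.

Lemma circle_continuous (c : R * R) (r : R) :
  continuous (fun t : R => (c.1 + r * cos t, c.2 + r * sin t)).
Proof.
move=> t; apply: (@cvg_pair _ _ _ _ (nbhs (c.1 + r * cos t)) (nbhs (c.2 + r * sin t))).
  exact: (cvgD (cvg_cst _) (cvgM (cvg_cst _) (@continuous_cos R t))).
exact: (cvgD (cvg_cst _) (cvgM (cvg_cst _) (@continuous_sin R t))).
Qed.

Lemma integral_EFin_continuous (f : R -> R) (a b : R) : continuous f ->
  (\int[mu]_(t in `[a, b]) (f t)%:E = (\int[mu]_(t in `[a, b]) f t)%:E)%E.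
Proof.
move=> cf; rewrite /Rintegral fineK//; apply: integrable_fin_num => //.
exact: integrable_continuous.
Qed.

Lemma submean_EFin (f : R -> R) (m : R) : continuous f ->
  2 * pi * m <= \int[mu]_(t in circ) f t ->
  (m%:E <= ((2 * pi)^-1)%:E * \int[mu]_(t in circ) (f t)%:E)%E.
Proof.
move=> cf H; rewrite integral_EFin_continuous// -EFinM lee_fin.
by rewrite mulrC ler_pdivlMr ?mulr_gt0 ?pi_gt0// mulrC.
Qed.

Lemma MPsh_continuous n (u : 'rV[R]_n -> R) : continuous u ->
  (forall a v1 v2, v1 != 0 -> dot v1 v2 = 0 -> dot v1 v1 = dot v2 v2 ->
   forall (c : R * R) r, 0 < r -> 2 * pi * u (plane_point a v1 v2 c) <=
     \int[mu]_(t in circ)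
       u (plane_point a v1 v2 (c.1 + r * cos t, c.2 + r * sin t))) ->
  MPsh setT (fun x => (u x)%:E).
Proof.
move=> cu H.
have usc (T : topologicalType) D (f : T -> R) : continuous f ->
    usc_on D (fun x => (f x)%:E).
  move=> cf x _ a; rewrite lte_fin => fa.
  apply: cvg_within; have := cf x; move/cvgr_lt/(_ _ fa).
  by apply: filterS => y; rewrite lte_fin.
split=> [x _||a v1 v2 v10 v12 v11]; [exact: ltry|exact: usc|].
split=> [p _||c r r0 _]; first exact: ltry.
  apply: usc => p; apply: (@continuous_comp _ _ _ (plane_point a v1 v2) u).
    exact: plane_point_continuous.
  exact: cu.
apply: submean_EFin; last exact: H.
move=> t; apply: (@continuous_comp _ _ _
  (fun t => plane_point a v1 v2 (c.1 + r * cos t, c.2 + r * sin t)) u).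
  apply: (@continuous_comp _ _ _ (fun t => (c.1 + r * cos t, c.2 + r * sin t))
   (plane_point a v1 v2)); first exact: circle_continuous.
  exact: plane_point_continuous.
exact: cu.
Qed.

Context (phi phi0 : C3 -> R) (g : 'rV[R]_3 -> R).
Hypothesis sphi : Csmooth phi.
Hypothesis tphi0 : test_fun phi0.
Hypothesis cg : continuous g.
Hypothesis phiE : forall q, phi q = phi0 q + g q.1.
Hypothesis lap_phi : forall q v, null_vector v -> 0 <= lap v (J v) phi q.

(** The unbounded fibre causes no trouble because the y-dependence sits in the bounded [phi0];
    adding g turns this into the supremum of phi over the fibre of x. *)
Let S x := sup (range (fun y => phi0 (x, y))).
Let u x := S x + g x.

Let S_bnd x : has_sup (range (fun y => phi0 (x, y))).
Proof.
have [B B0 HB] := test_fun_bounded tphi0.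
split; first by exists (phi0 (x, 0)); exists 0.
by exists B => _ [y _ <-]; exact: le_trans (ler_norm _) (HB _).
Qed.

Let le_S x y : phi0 (x, y) <= S x.
Proof. by apply: ub_le_sup; [case: (S_bnd x)|exists y]. Qed.

Let le_u x y : phi (x, y) <= u x.
Proof. by rewrite phiE lerD2r. Qed.

Let u_le x s : (forall y, phi (x, y) <= s) -> u x <= s.
Proof.
move=> H; rewrite -lerBrDr; apply: ge_sup; first by case: (S_bnd x).
by move=> _ [y _ <-]; rewrite lerBrDr; have := H y; rewrite phiE.
Qed.

(** The functions x |-> phi0(x, y) share a Lipschitz constant, which their supremum inherits. *)
Let cu : continuous u.
Proof.
suff cS : continuous S by move=> x; exact: (cvgD (cS x) (@cg x)).
have [C C0 HC] := test_fun_lip tphi0.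
suff H x1 x2 : S x2 <= S x1 + C * `|x2 - x1|.
  apply: (lip_continuous C0) => x1 x2; rewrite ler_norml; apply/andP; split.
    by rewrite lerNl opprB lerBlDr addrC distrC H.
  by rewrite lerBlDr addrC H.
apply: ge_sup; first by case: (S_bnd x2).
move=> _ [y _ <-].
have [s0 Hs] : Csmooth phi0 /\ True by case: tphi0.
have [s _] := @segment_MVT _ _ phi0 (x1, y) (x2 - x1, 0) s0.
have -> : (x2 - x1, 0) + (x1, y) = (x2, y) :> C3.
  by apply: C3_ext; rewrite /= ?subrK ?add0r.
move=> E; rewrite -lerBlDl; apply: (@le_trans _ _ (phi0 (x2, y) - phi0 (x1, y))).
  by rewrite lerB.
rewrite E (le_trans (ler_norm _))// (le_trans (HC _ _))// ler_wpM2l//.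
by apply: norm_pair_le => //=; rewrite normr0.
Qed.

(** For each y, phi(x, y) is at most its mean over a circle in a complex null line through (x, y);
    this circle projects onto the given circle in the plane, where phi is at most u. The supremum
    over y gives the claim. *)
Let MPsh_u : MPsh setT (fun x => (u x)%:E).
Proof.
apply: MPsh_continuous cu _ => a v1 v2 v10 v12 v11 c r r0.
have pi2 : 0 < 2 * pi :> R by rewrite mulr_gt0// pi_gt0.
set x := plane_point a v1 v2 c.
pose gam t := plane_point a v1 v2 (c.1 + r * cos t, c.2 + r * sin t).
rewrite mulrC -ler_pdivlMr//; apply: u_le => y; rewrite ler_pdivlMr// mulrC.
(* Then [J nu] is (v2, v1), so the real part of cos t nu + sin t J nu is cos t v1 + sin t v2. *)
pose nu : C3 := (v1, - v2).
have nu_null : null_vector nu.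
  apply/null_vectorP; rewrite /nu/= !dotNl !dotNr opprK v12 oppr0; split=> //.
  by apply/eqP => /(congr1 fst)/= /eqP; apply/negP.
have := @lap_ge0_submean _ _ (x, y) nu (J nu) phi sphi r (ltW r0).
move=> /(_ (fun s t _ => lap_phi _ nu_null)) H; apply: (le_trans H).
have E t : (polar (x, y) nu (J nu) (r, t)).1 = gam t.
  rewrite /polar /rot /gam /plane_point /x /plane_point /= opprK.
  by rewrite !scalerDr !scalerDl !scalerA addrC !addrA; congr (_ + _); rewrite addrAC.
apply: le_Rintegral => //.
- apply: integrable_continuous => t.
  apply: (@continuous_comp _ _ _ (fun t => polar (x, y) nu (J nu) (r, t)) phi).
    apply: (@continuous_comp _ _ _ (fun t => (r, t)) (polar (x, y) nu (J nu))).
      by apply: (@cvg_pair _ _ _ _ (nbhs r) (nbhs t)); [exact: cvg_cst|exact: cvg_id].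
    exact: polar_continuous.
  exact: Csmooth_continuous.
- apply: integrable_continuous => t.
  apply: (@continuous_comp _ _ _ gam u); last exact: cu.
  apply: (@continuous_comp _ _ _ (fun t => (c.1 + r * cos t, c.2 + r * sin t))
    (plane_point a v1 v2)); first exact: circle_continuous.
  exact: plane_point_continuous.
- move=> t _; rewrite -[X in u X]/(gam t) -E.
  by case: (polar _ _ _ _) => x' y' /=; exact: le_u.
Qed.

Lemma hull_le (K : set 'rV[R]_3) (q0 : C3) (s : R) : minimal_hull K q0.1 ->
  (forall q, tube K q -> phi q <= s) -> phi q0 <= s.
Proof.
case: q0 => x0 y0 /= /(_ _ MPsh_u) H Hs.
rewrite (le_trans (le_u x0 y0))// -lee_fin (le_trans H)//.
apply: ge_ereal_sup => _ [z Kz <-]; rewrite lee_fin; apply: u_le => y.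
by apply: Hs.
Qed.

End FiberSup.

(** * Laplacians of combinations and compositions *)

Section Laplacian.
Context {R : realType} {V : normedModType R} (a b : V).
Implicit Types f g : V -> R.

Lemma lapD f g q : Csmooth f -> Csmooth g ->
  lap a b (fun p => f p + g p) q = lap a b f q + lap a b g q.
Proof.
move=> sf sg; rewrite !lapE (ddD a sf sg) (ddD b sf sg).
rewrite (ddD a (Csmooth_dd a sf) (Csmooth_dd a sg)).
rewrite (ddD b (Csmooth_dd b sf) (Csmooth_dd b sg)); exact: addrACA.
Qed.

Lemma lapZ (c : R) f q : Csmooth f ->
  lap a b (fun p => c * f p) q = c * lap a b f q.
Proof.
move=> sf; rewrite !lapE (ddZ a c sf) (ddZ b c sf).
by rewrite (ddZ a c (Csmooth_dd a sf)) (ddZ b c (Csmooth_dd b sf)) mulrDr.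
Qed.

Lemma lap_cst (c : R) q : lap a b (fun=> c) q = 0.
Proof. by rewrite lapE (dd_cst a c) (dd_cst b c) (dd_cst a 0) (dd_cst b 0) addr0. Qed.

Lemma lap_comp (h : R -> R) f q : Csmooth h -> Csmooth f ->
  lap a b (fun p => h (f p)) q = dd (1 : R) h (f q) * lap a b f q +
    dd (1 : R) (dd (1 : R) h) (f q) * (dd a f q ^+ 2 + dd b f q ^+ 2).
Proof.
move=> sh sf; have sh1 := Csmooth_dd (1 : R) sh.
have E v : dd v (dd v (fun p => h (f p))) q =
    dd (1 : R) (dd (1 : R) h) (f q) * dd v f q * dd v f q +
    dd (1 : R) h (f q) * dd v (dd v f) q.
  rewrite (dd_comp v sh sf).
  rewrite (ddM v (Csmooth_comp sh1 sf) (Csmooth_dd v sf)).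
  by rewrite (dd_comp v sh1 sf).
rewrite !lapE (E a) (E b).
move: (dd a (dd a f) q) (dd b (dd b f) q) (dd a f q) (dd b f q) => A B x y.
by ring.
Qed.

(** The chain rule has one more term, cvx'' times the squared gradient of f along a and b; it is
    nonnegative by convexity. *)
Lemma lap_cvx_ge f q : Csmooth f ->
  'D_1 cvx (f q) * lap a b f q <= lap a b (fun p => cvx (f p)) q.
Proof.
move=> sf; rewrite (lap_comp q (Csmooth_cvx) sf) !ddE lerDl.
by rewrite mulr_ge0 ?d2cvx_ge0// addr_ge0// sqr_ge0.
Qed.

End Laplacian.

(** * Construction of a current by duality *)

Section Duality.
Context {R : realType}.
Notation C3 := (C3 R).

Lemma scale_bound (C x y e L : R) : 0 <= C -> 0 < x -> x <= y -> 0 <= e ->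
  y * (2 * e) <= L -> C * e <= C / x * L.
Proof.
move=> C0 x0 xy e0 HL; rewrite -mulrA ler_wpM2l// ler_pdivlMl// (le_trans _ HL)//.
by apply: ler_pM => //; [exact: ltW|rewrite ler_peMl// ler1n].
Qed.

Lemma test_fun0 : test_fun (fun _ : C3 => 0).
Proof.
apply: (@test_fun_in _ set0) => //; first exact: Csmooth_cst.
- exact: closed0.
- exact: compact0.
Qed.

Lemma test_fun_lin (c : R) (u u' : C3 -> R) : test_fun u -> test_fun u' ->
  test_fun (fun q => c * u q + u' q).
Proof.
move=> [su ku] [su' ku']; apply: (@test_fun_in _ (fun_supp u `|` fun_supp u')).
- by apply: Csmooth_add => //; exact: Csmooth_scale.
- by apply: closedU; exact: closed_closure.
- exact: compactU.
- by move=> q /not_orP[/fun_supp_out -> /fun_supp_out ->]; rewrite mulr0 addr0.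
Qed.

(** Functions that differ from a test function by a function of x. Unlike test functions, this class
    contains |x|^2 and its convex modifications, and it is stable under linear combinations. *)
Definition almost_x (phi : C3 -> R) : Prop := Csmooth phi /\
  exists2 phi0, test_fun phi0 &
    forall x y y', phi (x, y) - phi0 (x, y) = phi (x, y') - phi0 (x, y').

Lemma almost_x_test u : test_fun u -> almost_x u.
Proof. by move=> tu; split; [case: tu|exists u => // x y y'; rewrite !subrr]. Qed.

Lemma almost_x_fst (phi : C3 -> R) : Csmooth phi ->
  (forall x y y', phi (x, y) = phi (x, y')) -> almost_x phi.
Proof.
by move=> sp H; split=> //; exists (fun=> 0) => [|x y y'];
  [exact: test_fun0|rewrite !subr0].
Qed.

Lemma almost_x_lin (c : R) phi psi : almost_x phi -> almost_x psi ->
  almost_x (fun q => c * phi q + psi q).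
Proof.
move=> [sp [p0 tp0 Hp]] [ss [s0 ts0 Hs]]; split.
  by apply: Csmooth_add => //; exact: Csmooth_scale.
exists (fun q => c * p0 q + s0 q) => [|x y y']; first exact: test_fun_lin.
rewrite -(subrK (p0 (x, y)) (phi (x, y))) (Hp x y y').
by rewrite -(subrK (s0 (x, y)) (psi (x, y))) (Hs x y y'); ring.
Qed.

Lemma lip_cvg (V W : normedModType R) (F : V -> W) (x : V) :
  (forall y, `|F x - F y| <= `|x - y|) -> {for x, continuous F}.
Proof.
move=> H; apply/cvgrPdist_le => e e0; near=> y.
rewrite (le_trans (H y))//; near: y; apply/nbhs_normP.
Unshelve. end_near. Qed.

Lemma fst_section_continuous : continuous (fun x : 'rV[R]_3 => (x, 0) : C3).
Proof.
move=> x; apply: (@lip_cvg _ _ _ x) => y.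
by apply: norm_pair_le => //=; rewrite subrr normr0.
Qed.

Lemma almost_x_hull (K : set 'rV[R]_3) phi (q0 : C3) s : almost_x phi ->
  minimal_hull K q0.1 ->
  (forall q v, null_vector v -> 0 <= lap v (J v) phi q) ->
  (forall q, tube K q -> phi q <= s) -> phi q0 <= s.
Proof.
move=> [sp [p0 tp0 Hp]] Kq0 lp; have [s0 _] := tp0.
(* The difference phi - p0 is constant in y, so its value at y = 0 serves as g. *)
apply: (@hull_le _ phi p0 (fun x => phi (x, 0) - p0 (x, 0))) => //.
- have cB : continuous (fun q => phi q - p0 q).
    by apply: Csmooth_continuous; apply: Csmooth_sub.
  by move=> x; apply: (continuous_comp (@fst_section_continuous x) (cB _)).
- by move=> [x y] /=; rewrite addrC (Hp x 0 y) subrK.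
Qed.

Context (K : set 'rV[R]_3) (q0 : C3) (M : R).
Hypothesis Kq0 : minimal_hull K q0.1.
Hypothesis KM : forall x, K x -> dot x x <= M.
Hypothesis q0M : dot q0.1 q0.1 <= M.

Let sq : C3 -> R := sqx 0.

Let sqE q : sq q = dot q.1 q.1. Proof. by rewrite /sq /sqx subr0. Qed.

Let ax_sq : almost_x sq.
Proof.
by apply: almost_x_fst => [|x y y']; [exact: Csmooth_sqx|rewrite !sqE].
Qed.

(** Vanishes over K and at q0 while its Laplacian is positive on null vectors where |x|^2 > M:
    multiples of it dominate forms living there at no cost in s - phi(q0). *)
Let cut (q : C3) : R := cvx (sq q - M).

Let scut0 : Csmooth (fun q => sq q - M).
Proof. by apply: Csmooth_sub; [exact: Csmooth_sqx|exact: Csmooth_cst]. Qed.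

Let ax_cut : almost_x cut.
Proof.
apply: almost_x_fst => [|x y y']; last by rewrite /cut !sqE.
by apply: Csmooth_comp => //; exact: Csmooth_cvx.
Qed.

(** Functions of a point q and a vector v, standing for alpha(q)(v, J v), the values that decide
    null positivity. *)
Let A := (C3 * C3)%type -> R^o.

(** The growth |v|^2 is the one that multiples of the Laplacian of |x|^2 can dominate. *)
Let bnd (a : A) := exists C, forall q v, null_vector v -> `|a (q, v)| <= C * esq v.

(** The costs s - phi(q0) of the functions phi <= s on the tube whose Laplacian dominates a on null
    vectors. The infimum [p] of the costs is sublinear, and the maximum principle is the statement
    that the costs of 0 are nonnegative. *)
Let S (a : A) : set R := [set t | exists phi s, [/\ almost_x phi,
  (forall q, tube K q -> phi q <= s),
  (forall q v, null_vector v -> a (q, v) <= lap v (J v) phi q) & t = s - phi q0]].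

Let S_ge0 t : S 0 t -> 0 <= t.
Proof.
move=> [phi [s [ap Hs lp ->]]]; rewrite subr_ge0.
exact: (almost_x_hull ap Kq0 lp Hs).
Qed.

Let S_lin (c : R) a b t t' : 0 <= c -> S a t -> S b t' -> S (c *: a + b) (c * t + t').
Proof.
move=> c0 [phi [s [ap Hs lp ->]]] [psi [s' [aps Hs' lps ->]]].
exists (fun q => c * phi q + psi q), (c * s + s'); split.
- exact: almost_x_lin.
- by move=> q Kq; rewrite lerD ?ler_wpM2l ?Hs ?Hs'.
- move=> q v nv; have [sp _] := ap; have [ss _] := aps.
  rewrite lapD//; last exact: Csmooth_scale.
  by rewrite lapZ// lerD ?lps// ler_wpM2l// lp.
- by ring.
Qed.

(** The witness C |x|^2 / 2 has Laplacian C |v|^2, and |x|^2 <= M over K. This cost becomes the mass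
    bound for T. *)
Let S_sq (C : R) a : (forall q v, null_vector v -> a (q, v) <= C * esq v) -> 0 <= C ->
  S a (C / 2 * (M - sq q0)).
Proof.
move=> Ha C0; exists (fun q => C / 2 * sq q + 0), (C / 2 * M); split.
- apply: almost_x_lin => //; apply: almost_x_test; exact: test_fun0.
- by move=> q [Kq _]; rewrite addr0 ler_wpM2l ?divr_ge0// sqE KM.
- move=> q v nv; rewrite lapD; last 2 first.
  + by apply: Csmooth_scale; exact: Csmooth_sqx.
  + exact: Csmooth_cst.
  rewrite lap_cst addr0 lapZ; last exact: Csmooth_sqx.
  rewrite lap_sqx (le_trans (Ha _ _ nv))//; lra.
- by ring.
Qed.

Let bndN a : bnd a -> exists2 C, 0 <= C & forall q v, null_vector v ->
  a (q, v) <= C * esq v /\ (- a) (q, v) <= C * esq v.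
Proof.
move=> [C HC]; exists `|C| => // q v nv.
have H : `|a (q, v)| <= `|C| * esq v.
  by rewrite (le_trans (HC _ _ nv))// ler_wpM2r ?esq_ge0// ler_norm.
by split; apply: le_trans H; [exact: ler_norm|rewrite -normrN; exact: ler_norm].
Qed.

(** A cost of a plus a cost of - a is a cost of 0, hence nonnegative; so any cost of - a bounds
    those of a from below. *)
Let S_has_inf a : bnd a -> has_inf (S a).
Proof.
move=> /bndN[C C0 HC]; split.
  by eexists; apply: (S_sq _ C0) => q v nv; case: (HC q v nv).
have SN : S (- a) (C / 2 * (M - sq q0)).
  by apply: (S_sq _ C0) => q v nv; case: (HC q v nv).
exists (- (C / 2 * (M - sq q0))) => t St.
have := S_lin ler01 St SN; rewrite scale1r subrr mul1r => /S_ge0.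
by rewrite -lerBlDr sub0r.
Qed.

Let p (a : A) : R := inf (S a).

Let p_le a t : bnd a -> S a t -> p a <= t.
Proof. by move=> /S_has_inf[_ lb] St; exact: ge_inf. Qed.

Let p0 : p 0 = 0.
Proof.
have S00 : S 0 0.
  have := @S_sq 0 0; rewrite !mul0r; apply=> // q v _.
  by rewrite mul0r.
have b0 : bnd 0 by exists 0 => q v _; rewrite normr0 mul0r.
apply/eqP; rewrite eq_le p_le//=; apply: lb_le_inf; first by exists 0.
by move=> t /S_ge0.
Qed.

Let bnd_lin (c : R) a b : bnd a -> bnd b -> bnd (c *: a + b).
Proof.
move=> [C HC] [D HD]; exists (`|c| * C + D) => q v nv.
rewrite mulrDl -mulrA (le_trans (ler_normD _ _))// lerD ?HD//.
by rewrite normrM ler_wpM2l ?HC.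
Qed.

Let pD a b : bnd a -> bnd b -> p (a + b) <= p a + p b.
Proof.
move=> Ba Bb; have Bab : bnd (a + b).
  by rewrite -[a]scale1r; exact: bnd_lin.
rewrite -lerBlDr; apply: lb_le_inf; first by case: (S_has_inf Ba).
move=> t St; rewrite lerBlDr -lerBlDl.
apply: lb_le_inf; first by case: (S_has_inf Bb).
move=> t' St'; rewrite lerBlDl; apply: p_le => //.
by have := S_lin ler01 St St'; rewrite scale1r mul1r.
Qed.

Let S0 a : bnd a -> S 0 0.
Proof.
by move=> _; have := @S_sq 0 0; rewrite !mul0r; apply=> // q v _; rewrite mul0r.
Qed.

Let pZ_le (c : R) a : 0 < c -> bnd a -> p (c *: a) <= c * p a.
Proof.
move=> c0 Ba; rewrite mulrC -ler_pdivrMr//.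
apply: lb_le_inf; first by case: (S_has_inf Ba).
move=> t St; rewrite ler_pdivrMr// mulrC.
have b0 : bnd 0 by exists 0 => q v _; rewrite normr0 mul0r.
apply: p_le; first by have := bnd_lin c Ba b0; rewrite addr0.
by have := S_lin (ltW c0) St (S0 Ba); rewrite !addr0.
Qed.

Let pZ (c : R) a : 0 < c -> bnd a -> p (c *: a) = c * p a.
Proof.
move=> c0 Ba; apply/eqP; rewrite eq_le pZ_le//=.
have b0 : bnd 0 by exists 0 => q v _; rewrite normr0 mul0r.
have Bca : bnd (c *: a) by have := bnd_lin c Ba b0; rewrite addr0.
have c0' : 0 < c^-1 by rewrite invr_gt0.
have := pZ_le c0' Bca; rewrite scalerA mulVf ?gt_eqF// scale1r.
by rewrite mulrC ler_pdivlMr// mulrC.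
Qed.

Let diag (alpha : field2 R) : A := fun qv => alpha qv.1 qv.2 (J qv.2).

Let bnd_diag alpha : test_form2 alpha -> bnd (diag alpha).
Proof.
by move=> /test_form_bounded[C _ HC]; exists C => q v _; exact: HC.
Qed.

(* Hahn-Banach for the sublinear functional [p] produces [T] with
   T(ddc phi) <= sup_K phi - phi(q0). *)
Lemma hull_current : exists T : field2 R -> R,
  [/\ test_linear T,
    (forall alpha C, test_form2 alpha -> 0 <= C ->
      (forall q v, null_vector v -> `|alpha q v (J v)| <= C * esq v) ->
      `|T alpha| <= C / 2 * M),
    null_positive_current T,
    (forall u, test_fun u -> (forall q, tube K q -> u q <= 0) ->
      T (ddc u) <= - u q0) &
    forall alpha d, 0 < d -> test_form2 alpha ->
      (forall q v w, dot q.1 q.1 < M + d -> alpha q v w = 0) -> T alpha = 0].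
Proof.
have b0 : bnd 0 by exists 0 => q v _; rewrite normr0 mul0r.
have [f [flin fp]] := hahn_banach b0 bnd_lin pD pZ p0.
have fN a : bnd a -> f (- a) = - f a.
  move=> Ba; have f0 : f 0 = 0.
    by have := flin (-1) 0 0 b0 b0; rewrite scaler0 addr0 mulN1r addNr.
  by have := flin (-1) a 0 Ba b0; rewrite scaleN1r addr0 mulN1r f0 addr0.
have fS a t : bnd a -> S a t -> f a <= t.
  by move=> Ba St; rewrite (le_trans (fp _ Ba))// p_le.
have BN a : bnd a -> bnd (- a).
  by move=> Ba; have := bnd_lin (-1) Ba b0; rewrite scaleN1r addr0.
have f_le0 a : bnd a -> (forall q v, null_vector v -> a (q, v) <= 0) -> f a <= 0.
  move=> Ba Ha; apply: fS => //.
  have := @S_sq 0 a; rewrite !mul0r; apply=> // q v nv.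
  by rewrite mul0r Ha.
exists (fun alpha => f (diag alpha)); split.
- move=> c alpha beta ta tb; rewrite -flin; [|exact: bnd_diag|exact: bnd_diag].
  by congr f.
- move=> alpha C ta C0 HC; have Ba := bnd_diag ta.
  have sq0 : 0 <= sq q0 by exact: sqx_ge0.
  have Sp : f (diag alpha) <= C / 2 * (M - sq q0).
    apply: fS => //; apply: S_sq => // q v nv.
    exact: (le_trans (ler_norm _) (HC _ _ nv)).
  have Sn : f (- diag alpha) <= C / 2 * (M - sq q0).
    apply: fS; first exact: BN.
    apply: S_sq => // q v nv; apply: le_trans (HC _ _ nv); rewrite -normrN.
    exact: ler_norm.
  rewrite fN// in Sn.
  have le2 : C / 2 * (M - sq q0) <= C / 2 * M.
    by rewrite ler_wpM2l ?divr_ge0// lerBlDr lerDl.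
  rewrite ler_norml; apply/andP; split; last exact: le_trans le2.
  by rewrite lerNl (le_trans Sn).
- move=> alpha ta np; have Ba := bnd_diag ta.
  rewrite -oppr_le0 -fN//; apply: f_le0; first exact: BN.
  by move=> q v nv; rewrite oppr_le0; exact: np.
- move=> u tu Hu; apply: fS; first by apply: bnd_diag; exact: test_form2_ddc.
  exists u, 0; split; [exact: almost_x_test|exact: Hu| |by rewrite sub0r].
  by move=> q v _; rewrite /diag /= ddcJ//; case: tu.
- move=> alpha d d0 ta Ha; have Ba := bnd_diag ta.
  have [C C0 HC] := test_form_bounded ta.
  have hd : 0 < 'D_1 cvx d :> R by exact: dcvx_gt0.
  (* Where |x|^2 >= M + d, the Laplacian of [cut] is at least 2 cvx'(d) |v|^2, as cvx' is
     nondecreasing. So D times [cut] dominates C |v|^2 there, at cost 0. *)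
  pose D := C / 'D_1 cvx d.
  have D0 : 0 <= D by rewrite divr_ge0// ltW.
  have cut0 q : sq q <= M -> cut q = 0.
    by move=> H; apply: cvx_eq0; rewrite subr_le0.
  have dom a : bnd a -> (forall q v, a (q, v) <= C * esq v) ->
      (forall q v, sq q < M + d -> a (q, v) = 0) -> f a <= 0.
    move=> Ba' aC a0; apply: fS => //.
    exists (fun q => D * cut q + 0), 0; split.
    + by apply: almost_x_lin => //; apply: almost_x_test; exact: test_fun0.
    + by move=> q [Kq _]; rewrite cut0 ?mulr0 ?addr0// sqE KM.
    + move=> q v nv; rewrite lapD; last 2 first.
      * by apply: Csmooth_scale; case: ax_cut.
      * exact: Csmooth_cst.
      rewrite lap_cst addr0 lapZ; last by case: ax_cut.
      have := lap_cvx_ge v (J v) q scut0.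
      have -> : lap v (J v) (fun q => sq q - M) q = 2 * esq v.
        rewrite (lapD _ _ _ (Csmooth_sqx 0) (Csmooth_cst (- M))) lap_cst addr0.
        exact: lap_sqx.
      set L := lap v (J v) (fun p => cvx (sq p - M)) q.
      move=> HL.
      have e0 := esq_ge0 v; have h0 := dcvx_ge0 (sq q - M).
      have [sqq|sqq] := ltP (sq q) (M + d).
        rewrite a0//; apply: mulr_ge0 => //; apply: le_trans HL.
        by apply: mulr_ge0 => //; apply: mulr_ge0.
      have hh : 'D_1 cvx d <= 'D_1 cvx (sq q - M).
        by apply: dcvx_nondecr; rewrite lerBrDl.
      by rewrite (le_trans (aC q v))// (scale_bound C0 hd hh e0 HL).
    + by rewrite cut0 ?sqE// mulr0 addr0 subr0.
  apply/eqP; rewrite eq_le dom//=; last first.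
  + by move=> q v sqq; rewrite /diag/= Ha// -sqE.
  + by move=> q v; exact: le_trans (ler_norm _) (HC q v).
  rewrite -oppr_le0 -fN//; apply: dom; first exact: BN.
  + move=> q v; apply: le_trans (HC q v); rewrite -normrN; exact: ler_norm.
  + by move=> q v sqq; rewrite /diag/= fctE /= Ha ?oppr0// -sqE.
Qed.

End Duality.

(** * The tube over the minimal hull lies in the current hull *)

Section HullSub.
Context {R : realType}.
Notation C3 := (C3 R).

Lemma compact_dot_bounded (K : set 'rV[R]_3) (x0 : 'rV[R]_3) : compact K ->
  exists M, dot x0 x0 <= M /\ forall x, K x -> dot x x <= M.
Proof.
move=> /compact_bounded[N [_ HN]].
pose B := `|N| + 1 + `|x0|.
exists (3%:R * B ^+ 2); split=> [|x Kx].
  apply: le_trans (dot_le_norm _) _; rewrite ler_wpM2l// lerXn2r ?nnegrE ?addr_ge0//.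
  by rewrite lerDr addr_ge0.
apply: le_trans (dot_le_norm _) _; rewrite ler_wpM2l// lerXn2r ?nnegrE ?addr_ge0//.
apply: (@le_trans _ _ (`|N| + 1)); last by rewrite lerDl.
by apply: HN => //; rewrite (le_lt_trans (ler_norm N))// ltrDl.
Qed.

(** The inequality T(ddc u) <= - u(q0), valid for u <= 0 on the tube, does double duty: for u >= 0
    supported off the tube it is the sign condition on dd^c T, and for a bump at q0 it gives T(ddc
    u) <= -1, which puts q0 in the support. *)
Lemma minimal_hull_sub (K : set 'rV[R]_3) : compact K ->
  tube (minimal_hull K) `<=` current_null_hull (tube K).
Proof.
move=> kK q0 [Hq0 _].
(* A bump at a point of the tube is positive on the tube, so the inequality would not apply to it;
   the point current takes over. *)
have [Kq0|nKq0] := pselect (K q0.1); first by apply: tube_sub_hull.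
have [M [Mq0 MK]] := compact_dot_bounded q0.1 kK.
have M0 : 0 <= M by exact: le_trans (dot_ge0 _) Mq0.
have [T [Tlin Tb Tpos Tddc Tout]] := hull_current Hq0 MK Mq0.
have Tsupp q : current_supp T q -> dot q.1 q.1 <= M.
  move=> Tq; rewrite leNgt; apply/negP => Mq.
  pose d := (dot q.1 q.1 - M) / 2.
  have d0 : 0 < d by rewrite divr_gt0// subr_gt0.
  have oU : open [set p : C3 | M + d < sqx 0 p].
    apply: (@open_comp _ _ (sqx 0) [set t | M + d < t]).
      by move=> p _; apply: Csmooth_continuous; exact: Csmooth_sqx.
    exact: open_gt.
  have Uq : [set p : C3 | M + d < sqx 0 p] q.
    by rewrite /= /sqx subr0 /d; lra.
  have [alpha [ta sa /eqP]] := Tq _ oU Uq; apply.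
  apply: (Tout _ d) => // p v w Hp; apply: form_supp_out => /sa /=.
  by rewrite /sqx subr0 => H; have := lt_trans H Hp; rewrite ltxx.
have cK : closed (tube K).
  have -> : tube K = fst @^-1` K by apply/seteqP; split=> q => [[]|Kq]; last split.
  apply: preimage_closed; first by move=> p _; exact: cvg_fst.
  by apply: compact_closed kK; exact: norm_hausdorff.
exists T; last first.
  move=> U oU Uq0.
  have oUK : open (U `&` ~` tube K).
    by apply: openI => //; rewrite openC.
  have UKq0 : (U `&` ~` tube K) q0 by split=> // -[].
  have [d d0 Hd] := small_sqball oUK UKq0.
  have tb := @test_fun_ballbump R q0 d d0.
  have bout q : ~ (U `&` ~` tube K) q -> ballbump q0 d q = 0.
    move=> nU; apply: ballbump_out => //; rewrite ltNge; apply/negP => H.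
    by apply: nU; apply: Hd.
  exists (ddc (ballbump q0 d)); split.
  - exact: test_form2_ddc.
  - apply: (subset_trans _ (subset_trans Hd (@subIsetl _ _ _))).
    apply: supp_sub_form; first exact: closed_sqball.
    move=> q v w nq; apply: (@ddc_out _ [set q | sqx q0 q + sqy q0 q <= 2 * d ^+ 2]) => //.
    + exact: closed_sqball.
    + by move=> p /= /negP; rewrite -ltNge; exact: ballbump_out.
    + exact: Csmooth_ballbump.
  - have : T (ddc (ballbump q0 d)) <= - ballbump q0 d q0.
      by apply: Tddc => // q Kq; rewrite bout//; case.
    rewrite ballbump_in//; last by rewrite sqx_center sqy_center addr0 sqr_ge0.
    by move=> H; rewrite lt_eqF// (le_lt_trans H)// ltrN10.
split=> //.
- split=> // [A kA|alpha [fa sa ka] H].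
  (* T has order zero: a bound B on the coefficients gives |alpha(v, J v)| <= B |v|^2, which costs
     at most B M / 2. *)
  + exists 0%N, (M / 2) => alpha B ta sA HB.
    have [fa _ _] := ta.
    have BB q v w : enorm v = 1 -> enorm w = 1 -> `|alpha q v w| <= B.
      by move=> v1 w1; apply: (HB [::]) => //; exact: enorm_norm_le1.
    have B0 : 0 <= B.
      apply: le_trans (normr_ge0 (alpha 0 0 0)) _.
      by apply: (HB [::]) => //; rewrite normr0.
    rewrite [leRHS](_ : _ = B / 2 * M); last by ring.
    by apply: Tb => // q v _; exact: comass_bound.
  + apply/eqP; rewrite -normr_le0.
    have -> : (0 : R) = 0 / 2 * M by rewrite !mul0r.
    apply: Tb => // q v _; rewrite mul0r normr_le0.
    have := H q v (J v); rewrite JJ; have [lin anti] := fa.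
    have -> : - v = (-1) *: v + 0 by rewrite addr0 scaleN1r.
    rewrite (is_form2Dr _ _ _ _ _ fa) mulN1r.
    have := is_form2Dr q (J v) 0 0 (-1) fa.
    rewrite scaler0 addr0 mulN1r addNr => ->.
    by rewrite addr0 anti opprK => E; apply/eqP; lra.
- apply: (@le_lt_trans _ _ (1 / 2 * M)%:E); last exact: ltry.
  apply: ge_ereal_sup => _ [alpha [ta ca] <-]; rewrite lee_fin.
  have [fa _ _] := ta.
  by apply: Tb => // q v _; exact: comass_bound.
- exists (M + 1); split; first exact: num_real.
  move=> N HN _ [q /Tsupp Hq <-]; apply: le_trans (ltW HN).
  apply: norm_le_sqrt_dot; first by rewrite addr_ge0.
  by rewrite (le_trans Hq)// expr2; nra.
- move=> u tu u0 uK; rewrite (le_trans (Tddc u tu _)) ?oppr_le0//.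
  move=> q Kq; rewrite fun_supp_out// => /uK; exact.
Qed.

End HullSub.

(** * Currents vanish off their support *)

Section SupportLemma.
Context {R : realType}.
Notation C3 := (C3 R).
Context (T : field2 R -> R) (Tlin : test_linear T).

(** The support is defined by local vanishing, so the form has to be split into local pieces:
    finitely many balls cover its support, and multiplication by b and 1 - b peels off one ball at a
    time. *)
Lemma current_supp_out (alpha : field2 R) : test_form2 alpha ->
  (forall q, form_supp alpha q -> ~ current_supp T q) -> T alpha = 0.
Proof.
move=> ta disj.
have /choice[d Hd] : forall q, exists d : R, 0 < d /\ (form_supp alpha q ->
    forall beta, test_form2 beta ->
    (forall p v w, 2 * d ^+ 2 < sqx q p + sqy q p -> beta p v w = 0) -> T beta = 0).
  move=> q; have [qs|nq] := pselect (form_supp alpha q); last by exists 1.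
  have /existsNP[U /not_implyP[oU /not_implyP[Uq nU]]] := disj _ qs.
  have [d d0 HU] := small_sqball oU Uq; exists d; split=> // _ beta tb Hb.
  apply: contrapT => /eqP Tb; apply: nU; exists beta; split=> //.
  apply: subset_trans HU; apply: supp_sub_form; first exact: closed_sqball.
  by move=> p v w /= /negP; rewrite -ltNge; exact: Hb.
pose b q := ballbump q (d q).
(* Invariant of the peeling: beta vanishes wherever no bump of the list equals 1. The factor 1 - b
   vanishes where b = 1, so (1 - b) beta satisfies it for the shorter list. *)
have H (s : seq C3) (beta : field2 R) : (forall c, c \in s -> form_supp alpha c) ->
    test_form2 beta ->
    (forall q v w, (forall c, c \in s -> b c q != 1) -> beta q v w = 0) ->
    T beta = 0.
  elim: s beta => [|c s IH] beta sin tb Hb.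
    have -> : beta = fun q v w => 0 * beta q v w.
      by apply/funext => q; apply/funext => v; apply/funext => w; rewrite mul0r Hb.
    by rewrite current_scale// mul0r.
  have [d0 Tc] := Hd c.
  have sb : Csmooth (b c) by exact: Csmooth_ballbump.
  have t1 : test_form2 (fun q v w => b c q * beta q v w) by exact: test_form2_mul.
  have sb' : Csmooth (fun q => 1 - b c q) by apply: Csmooth_sub => //; exact: Csmooth_cst.
  have t2 : test_form2 (fun q v w => (1 - b c q) * beta q v w) by exact: test_form2_mul.
  have -> : beta = fun q v w => b c q * beta q v w + (1 - b c q) * beta q v w.
    apply/funext => q; apply/funext => v; apply/funext => w.
    by rewrite -mulrDl addrC subrK mul1r.
  rewrite current_add// [X in X + _]Tc ?add0r//; last 2 first.
  - by apply: sin; rewrite mem_head.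
  - by move=> p v w Hp; rewrite /b ballbump_out// mul0r.
  apply: IH => // [c' c's|q v w Hs]; first by apply: sin; rewrite in_cons c's orbT.
  have [->|b1] := eqVneq (b c q) 1; first by rewrite subrr mul0r.
  rewrite Hb ?mulr0// => c'; rewrite in_cons => /predU1P[->//|]; exact: Hs.
have [_ _ ka] := ta.
have kc : @cover_compact C3 (form_supp alpha).
  by rewrite -(compact_cover (C3 : normedModType R)).
case: (kc C3 (form_supp alpha) (fun c => [set q | sqx c q + sqy c q < d c ^+ 2])).
- move=> c _; apply: (@open_comp _ _ (fun q => sqx c q + sqy c q) [set t | t < d c ^+ 2]).
    move=> p _; apply: Csmooth_continuous.
    by apply: Csmooth_add; [exact: Csmooth_sqx|exact: Csmooth_sqy].
  exact: open_lt.
- move=> q qs; exists q => //=.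
  by rewrite sqx_center sqy_center addr0 exprn_gt0//; case: (Hd q).
- move=> D Dsub cov; apply: (H (enum_fset D)) => //.
    by move=> c cD; have /Dsub := cD; rewrite inE.
  move=> q v w Hq; apply: form_supp_out => /cov[c /= cD Hc].
  have := Hq c cD; rewrite /b ballbump_in ?eqxx//; first by case: (Hd c).
  exact: ltW.
Qed.

End SupportLemma.

(** * Sup-convolution *)

Section UpperSemicontinuous.
Context {R : realType}.
Notation mu := (@lebesgue_measure R).
Notation circ := (`[0%R, (2 * pi)%R]%classic : set R).

Lemma usc_open (T : topologicalType) (u : T -> \bar R) (a : R) :
  usc_on setT u -> open [set x | (u x < a%:E)%E].
Proof.
move=> usc; rewrite openE => x /= ux.
apply: (@filterS _ (nbhs x) _ (fun y => setT y -> (u y < a%:E)%E)).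
  by move=> y; apply.
exact: (usc x I a ux).
Qed.

Lemma usc_comp (S T : topologicalType) (u : T -> \bar R) (g : S -> T) :
  usc_on setT u -> continuous g -> usc_on setT (u \o g).
Proof.
move=> usc cg x _ a uga; apply: cvg_within.
by have := cg x _ (open_nbhs_nbhs (conj (usc_open a usc) uga)).
Qed.

Lemma usc_measurable (u : R -> \bar R) : usc_on setT u -> measurable_fun setT u.
Proof.
move=> usc; rewrite (_ : u = \- (\- u))%E; last first.
  by apply/funext => x; rewrite oppeK.
apply: measurableT_comp => //; apply: lower_semicontinuous_measurable.
apply/lower_semicontinuousP => a.
rewrite (_ : [set x | _] = [set x | (u x < (- a)%:E)%E]); first exact: usc_open.
by apply/seteqP; split=> x /=; rewrite lteNr EFinN.
Qed.

(** The function u may take the value -oo and fail to be integrable, so positive and negative parts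
    are compared separately. *)
Lemma usc_le_integral (u : R -> \bar R) (g : R -> R) (a b : R) :
  usc_on setT u -> continuous g -> (forall t, (u t <= (g t)%:E)%E) ->
  (\int[mu]_(t in `[a, b]) u t <= \int[mu]_(t in `[a, b]) (g t)%:E)%E.
Proof.
move=> usc cg ug.
have mu' : measurable_fun `[a, b] u.
  by apply: measurable_funS (usc_measurable usc).
have mg : measurable_fun `[a, b] (EFin \o g).
  by apply/measurable_EFinP; apply: measurable_funTS; exact: continuous_measurable_fun.
rewrite [leLHS]integralE [leRHS]integralE; apply: leeB.
- apply: ge0_le_integral => //.
  + exact: measurable_funepos.
  + exact: measurable_funepos.
  + by move=> t _; rewrite !funeposE ge_max !le_max lexx orbT andbT ug.
- apply: ge0_le_integral => //.
  + exact: measurable_funeneg.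
  + exact: measurable_funeneg.
  + by move=> t _; rewrite !funenegE ge_max !le_max lexx orbT andbT leeN2 ug.
Qed.

Lemma usc_compact_bounded (V : normedModType R) (B : set V) (u : V -> \bar R) :
  compact B -> usc_on setT u -> (forall x, (u x < +oo)%E) ->
  exists M : R, forall x, B x -> (u x <= M%:E)%E.
Proof.
move=> kB usc uoo; have := kB; rewrite (compact_cover V).
move=> /(_ _ setT (fun n : nat => [set x | (u x < n%:R%:E)%E])).
case.
- by move=> n _; exact: usc_open.
- move=> x _; have := uoo x; case ux : (u x) => [r| |] // _.
    exists (Num.trunc `|r|).+1 => //=; rewrite ux lte_fin.
    by rewrite (le_lt_trans (ler_norm r))// truncnS_gt.
  by exists 0%N => //=; rewrite ux ltNyr.
(* The sum of the finitely many indices serves as a common upper bound. *)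
- move=> D _ cov; exists (\sum_(n <- enum_fset D) n)%N%:R => x /cov[n /= nD].
  move=> /ltW un; apply: le_trans un _; rewrite lee_fin ler_nat.
  by rewrite (big_rem n)//= leq_addr.
Qed.

(** Compactness makes the radius uniform: if u < c on the ball of radius e about x, half of e allows
    for moving x and half for moving z. *)
Lemma usc_compact_lt (V : normedModType R) (K : set V) (u : V -> \bar R) (c : R) :
  compact K -> usc_on setT u -> (forall x, K x -> (u x < c%:E)%E) ->
  exists2 d : R, 0 < d &
    forall x z, K x -> `|z - x| <= d -> (u z < c%:E)%E.
Proof.
move=> kK usc uc.
have := (compact_near_coveringP K).1 kK R (nbhs (0 : R)^'+)
  (fun (d : R) (x : V) => forall z, `|z - x| <= d -> (u z < c%:E)%E) _.
move=> H; have {}H : \forall d \near (0 : R)^'+, K `<=`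
    (fun x : V => forall z, `|z - x| <= d -> (u z < c%:E)%E).
  apply: H => x Kx.
  have : nbhs x [set z | (u z < c%:E)%E].
    by apply: open_nbhs_nbhs; split; [exact: usc_open|exact: uc].
  move=> /nbhs_normP[e /= e0 He].
  exists ([set x' | `|x - x'| < e / 2], [set d | d < e / 2]) => /=.
    split.
      by apply/nbhs_normP; exists (e / 2) => //=; rewrite divr_gt0.
    by apply: nbhs_right_lt; rewrite divr_gt0.
  move=> [x' d] [/= xx' de] z zx'; apply: He => /=.
  rewrite -(subrKA x') (le_lt_trans (ler_normD _ _))// [e]splitr ltrD//.
  by rewrite distrC (le_lt_trans zx').
near (0 : R)^'+ => d.
have dH : K `<=` (fun x : V => forall z, `|z - x| <= d -> (u z < c%:E)%E).
  by near: d; exact: H.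
exists d => [|x z Kx]; last exact: dH.
by near: d; exact: nbhs_right_gt.
Unshelve. all: by end_near. Qed.

End UpperSemicontinuous.

Section SupConvolution.
Context {R : realType}.
Notation mu := (@lebesgue_measure R).
Notation circ := (`[0%R, (2 * pi)%R]%classic : set R).
Notation V := 'rV[R]_3.

Lemma local_lip_continuous (W : normedModType R) (g : W -> R) (x : W) (C : R) :
  0 <= C -> (forall y, `|y - x| <= 1 -> `|g y - g x| <= C * `|y - x|) ->
  {for x, continuous g}.
Proof.
move=> C0 H; apply/cvgrPdist_le => e e0.
have C1 : 0 < C + 1 by rewrite ltr_wpDl.
near=> y.
have H1 : `|x - y| <= 1.
  by near: y; apply/nbhs_normP; exists 1 => //= z /= /ltW.
have H2 : `|x - y| <= e / (C + 1).
  near: y; apply/nbhs_normP; exists (e / (C + 1)) => [|z /= /ltW //].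
  by rewrite /= divr_gt0.
rewrite distrC (le_trans (H y _)) 1?distrC//.
apply: (@le_trans _ _ ((C + 1) * `|x - y|)); first by rewrite ler_wpM2r// lerDl.
by rewrite mulrC -ler_pdivlMr.
Unshelve. all: by end_near. Qed.

Lemma norm_dot_le n (v w : 'rV[R]_n) : `|dot v w| <= n%:R * `|v| * `|w|.
Proof.
rewrite /dot (le_trans (ler_norm_sum _ _ _))//.
rewrite -[n in n%:R]card_ord -sum1_card natr_sum !mulr_suml ler_sum// => j _.
by rewrite mul1r normrM ler_pM// coord_le_norm.
Qed.

Lemma continuous_comp3 (f : V -> R) (g : R -> V) : continuous f -> continuous g ->
  continuous (fun t => f (g t)).
Proof. by move=> cf cg t; apply: (@continuous_comp _ _ _ g f); [exact: cg|exact: cf]. Qed.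

Context (u : V -> \bar R) (Hu : MPsh setT u) (rho M N : R).
(** The margin 2 leaves room for a step of length 1 from x to a competitor z and another along the
    circle. *)
Let B : set V := [set z | `|z| <= rho + 2].
Hypothesis uM : forall z, B z -> (u z <= M%:E)%E.
Hypothesis rho0 : 0 <= rho.
Hypothesis M0 : 0 < M.
Hypothesis MN : 2 * M <= N.

(** Truncation at -M makes u real-valued; on B, where u <= M, the result lies in [-M, M]. *)
Let w (z : V) : R := fine (maxe (- M)%:E (u z)).

Let w_lo z : B z -> - M <= w z.
Proof.
move=> /uM; rewrite /w; case: (u z) => [r| |] //=.
by rewrite -EFin_max /= le_max lexx.
Qed.

Let w_hi z : B z -> w z <= M.
Proof.
have MM : - M <= M by rewrite ge0_cp// ltW.
move=> /uM; rewrite /w; case: (u z) => [r| |] //=.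
by rewrite lee_fin -EFin_max /= ge_max MM.
Qed.

Let u_le_w z : B z -> (u z <= (w z)%:E)%E.
Proof.
move=> /uM; rewrite /w; case: (u z) => [r| |] //= _; last exact: leNye.
by rewrite -EFin_max /= lee_fin le_max lexx orbT.
Qed.

Let w_cases z : B z -> w z = - M \/ u z = (w z)%:E.
Proof.
move=> /uM; rewrite /w; case: (u z) => [r| |] //= _.
  by rewrite -EFin_max /=; have [|] := leP (- M) r; [right|left].
by left.
Qed.

(** Only the quadratic penalty depends on x, so continuity comes from it and not from u. Since N >=
    2 M, competitors at Euclidean distance at least 1 contribute at most -M. *)
Definition supconv (x : V) : R :=
  sup [set w z - N * dot (z - x) (z - x) | z in B].
Let f := supconv.

Let N0 : 0 <= N. Proof. by apply: le_trans MN; rewrite mulr_ge0// ltW. Qed.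

Let f_sup x : has_sup [set w z - N * dot (z - x) (z - x) | z in B].
Proof.
split; first by eexists; exists 0 => //; rewrite /B /= normr0 addr_ge0.
exists M => _ [z Bz <-]; rewrite lerBlDr (le_trans (w_hi Bz))// lerDl.
by rewrite mulr_ge0 ?dot_ge0.
Qed.

Lemma supconv_ub x z : B z -> w z - N * dot (z - x) (z - x) <= f x.
Proof. by move=> Bz; apply: ub_le_sup; [case: (f_sup x)|exists z]. Qed.

Lemma supconv_le x m : (forall z, B z -> w z - N * dot (z - x) (z - x) <= m) ->
  f x <= m.
Proof.
by move=> H; apply: ge_sup => [|_ [z Bz <-]]; [case: (f_sup x)|exact: H].
Qed.

Let dot00 (x : V) : dot (x - x) (x - x) = 0 :> R.
Proof. by rewrite subrr /dot big1// => j _; rewrite !mxE mul0r. Qed.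

Lemma supconv_ge x : B x -> w x <= f x.
Proof. by move=> Bx; have := supconv_ub x Bx; rewrite dot00 mulr0 subr0. Qed.

Lemma supconv_ge_u x : B x -> (u x <= (f x)%:E)%E.
Proof.
by move=> Bx; apply: (le_trans (u_le_w Bx)); rewrite lee_fin supconv_ge.
Qed.

(** Expanding the penalty about z - x leaves the cross term 2 (z - x) . h, and |a . h| <= 3 |a| |h|
    in the maximum norm, whence the 6. *)
Lemma supconv_lip x x' :
  f x' <= f x + 6 * N * (`|x| + (rho + 2)) * `|x' - x|.
Proof.
apply: supconv_le => z Bz; rewrite -lerBlDr; apply: le_trans (supconv_ub x Bz).
rewrite -addrA lerD2l lerNr opprD !opprK.
set h := x' - x; have -> : z - x' = (z - x) - h.
  by rewrite /h opprB addrA subrK.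
have : `|z - x| <= `|x| + (rho + 2).
  by rewrite (le_trans (ler_normB _ _))// addrC lerD2l; exact: Bz.
move: (z - x) => a Ha; rewrite dotDl !dotDr !dotNl !dotNr opprK (dotC h a).
have H : dot a h <= 3 * (`|x| + (rho + 2)) * `|h|.
  rewrite (le_trans (ler_norm _))// (le_trans (norm_dot_le _ _))//.
  by rewrite ler_wpM2r// ler_wpM2l.
have hh := dot_ge0 h.
have -> : 6 * N * (`|x| + (rho + 2)) * `|h| = N * (2 * (3 * (`|x| + (rho + 2)) * `|h|)).
  by ring.
by rewrite -mulrDr ler_wpM2l//; lra.
Qed.

Lemma supconv_continuous : continuous f.
Proof.
move=> x; pose C := 6 * N * (`|x| + 1 + (rho + 2)).
have C0 : 0 <= C by rewrite !mulr_ge0// !addr_ge0.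
apply: (@local_lip_continuous V f x C C0) => x' x1.
have x'x : `|x'| <= `|x| + 1.
  by rewrite -[x'](subrK x) (le_trans (ler_normD _ _))// addrC lerD2l.
have bnd (y : V) : `|y| <= `|x| + 1 ->
    6 * N * (`|y| + (rho + 2)) * `|x' - x| <= C * `|x' - x|.
  by move=> Hy; rewrite ler_wpM2r// ler_wpM2l ?mulr_ge0// lerD2r.
rewrite ler_norml; apply/andP; split.
  rewrite lerNl opprB lerBlDr addrC (le_trans (supconv_lip x' x))// lerD2l distrC.
  exact: bnd.
rewrite lerBlDr addrC (le_trans (supconv_lip x x'))// lerD2l.
by apply: bnd; rewrite lerDl.
Qed.

Let pi2 : 0 < 2 * pi :> R. Proof. by rewrite mulr_gt0// pi_gt0. Qed.

Lemma le_circle_mean (g : R -> R) (m : R) : continuous g -> (forall t, m <= g t) ->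
  m <= (2 * pi)^-1 * \int[mu]_(t in circ) g t.
Proof.
move=> cg H; rewrite ler_pdivlMl//.
have -> : 2 * pi * m = \int[mu]_(t in circ) m.
  rewrite Rintegral_cst//= mulrC; congr (_ * _).
  by rewrite lebesgue_measure_itv/= lte_fin pi2/= subr0.
apply: le_Rintegral => //; apply: integrable_continuous => //.
exact: cst_continuous.
Qed.

(** A competitor z for x is translated along the circle together with x. The penalty does not
    change, so the sub-mean inequality of u at z becomes one for the supremum at x. *)
Lemma supconv_submean x (v1 v2 : V) r : `|x| <= rho -> v1 != 0 -> dot v1 v2 = 0 ->
  dot v1 v1 = dot v2 v2 -> 0 < r -> r * (`|v1| + `|v2|) <= 1 ->
  2 * pi * f x <=
    \int[mu]_(t in circ) f (x + ((r * cos t) *: v1 + (r * sin t) *: v2)).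
Proof.
move=> xr v10 v12 v11 r0 rv.
pose gam t : V := (r * cos t) *: v1 + (r * sin t) *: v2.
have cgam : continuous gam.
  have -> : gam = plane_point 0 v1 v2 \o (fun t => (((0, 0) : R * R).1 + r * cos t, ((0, 0) : R * R).2 + r * sin t)).
    by apply/funext => t; rewrite /gam /plane_point /= !add0r.
  move=> t; apply: continuous_comp; first exact: circle_continuous.
  exact: plane_point_continuous.
have ngam t : `|gam t| <= 1.
  apply: (le_trans (ler_normD _ _)); apply: le_trans rv.
  rewrite !normrZ mulrDr (gtr0_norm r0).
  by apply: lerD; rewrite ler_wpM2r// ler_piMr ?cos_max ?sin_max// ltW.
have cadd (z : V) : continuous (fun t => z + gam t).
  by move=> t; exact: (cvgD (cvg_cst z) (cgam t)).
have cfg : continuous (fun t => f (x + gam t)).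
  by apply: continuous_comp3; [exact: supconv_continuous|exact: cadd].
rewrite mulrC -ler_pdivlMr// mulrC.
have Bx t : B (x + gam t).
  by rewrite /B /= (le_trans (ler_normD _ _))// lerD// (le_trans (ngam t))// ler1n.
have mlo : - M <= (2 * pi)^-1 * \int[mu]_(t in circ) f (x + gam t).
  apply: le_circle_mean => // t.
  exact: (le_trans (w_lo (Bx t)) (supconv_ge (Bx t))).
apply: supconv_le => z Bz; set D := dot _ _.
have D0 : 0 <= D by exact: dot_ge0.
(* A distant competitor yields at most M - N <= -M, which no circle mean of f undercuts. *)
have [D1|D1] := leP D 1; last first.
  apply: le_trans mlo; have := w_hi Bz => wz.
  have ND : N <= N * D by rewrite ler_peMr// ltW.
  have := MN; move: wz ND; rewrite -/D; move: (w z) (N * D) => a b; lra.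
(* A truncated competitor also yields at most -M; otherwise w z is a value of u. *)
have [->|uz] := w_cases Bz.
  by apply: le_trans mlo; rewrite lerBlDr lerDl mulr_ge0.
have zx : `|z - x| <= 1 by apply: norm_le_sqrt_dot => //; rewrite expr1n.
have Bzg t : B (z + gam t).
  rewrite /B /= (le_trans (ler_normD _ _))//.
  have -> : rho + 2 = (rho + 1) + 1 by ring.
  by rewrite lerD// -[z](subrK x) (le_trans (ler_normD _ _))// addrC lerD.
have [_ usc sub] := Hu; have [_ _ sm] := sub z v1 v2 v10 v12 v11.
have {sm} := sm (0, 0) r r0 (fun _ _ => I).
have ppE t : plane_point z v1 v2 (0 + r * cos t, 0 + r * sin t) = z + gam t.
  by rewrite /plane_point /gam /= !add0r addrA.
rewrite /= {1}/plane_point /= !scale0r !addr0.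
under eq_integral do rewrite ppE.
move=> sm.
have cg : continuous (fun t => f (x + gam t) + N * D).
  by move=> t; exact: (cvgD (cfg t) (cvg_cst _)).
have le_ug t : (u (z + gam t) <= (f (x + gam t) + N * D)%:E)%E.
  apply: (le_trans (u_le_w (Bzg t))); rewrite lee_fin -lerBlDr.
  by have := supconv_ub (x + gam t) (Bzg t); rewrite opprD addrACA subrr addr0.
have ui := @usc_le_integral R _ _ 0 (2 * pi) (usc_comp usc (cadd z)) cg le_ug.
have {}sm : (u z <= ((2 * pi)^-1 * \int[mu]_(t in circ) (f (x + gam t) + N * D))%:E)%E.
  apply: (le_trans sm); rewrite EFinM -integral_EFin_continuous//.
  by rewrite lee_wpmul2l// lee_fin invr_ge0 ltW.
move: sm; rewrite uz lee_fin RintegralD//; last 2 first.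
- exact: integrable_continuous.
- by apply: integrable_continuous; exact: cst_continuous.
rewrite Rintegral_cst//= lebesgue_measure_itv/= lte_fin pi2/= subr0.
rewrite mulrDr [X in _ + X]mulrC mulfK ?gt_eqF//.
by rewrite lerBlDr.
Qed.

(** Competitors within d of x are at most c; the others lose at least N d^2 >= 2 M and drop to -M <=
    c. *)
Lemma supconv_le_on x (c d : R) : B x -> - M <= c -> 0 < d ->
  (forall z, `|z - x| <= d -> (u z < c%:E)%E) -> 2 * M <= N * d ^+ 2 -> f x <= c.
Proof.
move=> Bx Mc d0 ud Nd; apply: supconv_le => z Bz.
have D0 : 0 <= N * dot (z - x) (z - x) by rewrite mulr_ge0 ?dot_ge0.
have [zx|zx] := leP `|z - x| d.
  have [->|uz] := w_cases Bz; first by rewrite lerBlDr ler_wpDr.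
  by rewrite lerBlDr ler_wpDr// ltW// -lte_fin -uz ud.
have : d ^+ 2 <= dot (z - x) (z - x).
  rewrite leNgt; apply/negP => H; move: zx; rewrite ltNge => /negP; apply.
  by apply: norm_le_sqrt_dot; exact: ltW.
move=> /(ler_wpM2l N0) H; have := w_hi Bz; lra.
Qed.

End SupConvolution.

Lemma compact_norm_le (R : realType) (n : nat) (A : R) :
  compact [set x : 'rV[R]_n | `|x| <= A].
Proof.
apply: bounded_closed_compact.
  exists A; split; first exact: num_real.
  by move=> B HB x /= xA; apply: le_trans (ltW HB).
apply: (@preimage_closed _ _ (fun x : 'rV[R]_n => `|x|) [set t | t <= A]).
  by move=> x _; exact: norm_continuous.
exact: closed_le.
Qed.

Lemma MPsh_continuous_approx (R : realType) (u : 'rV[R]_3 -> \bar R)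
    (K : set 'rV[R]_3) (x0 : 'rV[R]_3) (rho c c2 : R) : MPsh setT u ->
  compact K -> 0 <= rho -> (forall x, K x -> `|x| <= rho) -> `|x0| <= rho ->
  (forall x, K x -> (u x < c%:E)%E) -> (c2%:E <= u x0)%E ->
  exists f : 'rV[R]_3 -> R, [/\ continuous f, (forall x, K x -> f x <= c),
    c2 <= f x0 &
    forall x v1 v2 r, `|x| <= rho -> v1 != 0 -> dot v1 v2 = 0 ->
      dot v1 v1 = dot v2 v2 -> 0 < r -> r * (`|v1| + `|v2|) <= 1 ->
      2 * pi * f x <= \int[@lebesgue_measure R]_(t in `[0%R, (2 * pi)%R])
        f (x + ((r * cos t) *: v1 + (r * sin t) *: v2))].
Proof.
move=> Hu kK rho0 Krho x0rho uc ux0; have [uoo usc _] := Hu.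
have kB := @compact_norm_le R 3 (rho + 2).
have [M1 HM1] := usc_compact_bounded kB usc (fun x => uoo x I).
have [d d0 Hd] := usc_compact_lt kK usc uc.
(* Large enough for u <= M on the ball, M > 0 and -M <= c. *)
pose M := `|M1| + `|c| + 1.
have M0 : 0 < M by rewrite ltr_wpDl// addr_ge0.
have Mc : - M <= c.
  by rewrite /M; have := ler_norm (- c); rewrite normrN; have := normr_ge0 M1; lra.
have HM z : `|z| <= rho + 2 -> (u z <= M%:E)%E.
  move=> /HM1 H; apply: (le_trans H); rewrite lee_fin /M.
  by have := ler_norm M1; have := normr_ge0 c; lra.
(* The first summand serves the sub-mean inequality, the second the bound on K. *)
pose N := 2 * M + 2 * M / d ^+ 2.
have dd0 : 0 < d ^+ 2 by rewrite exprn_gt0.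
have MN : 2 * M <= N by rewrite /N lerDl divr_ge0 ?mulr_ge0// ltW.
have Nd : 2 * M <= N * d ^+ 2.
  have -> : N * d ^+ 2 = 2 * M * d ^+ 2 + 2 * M.
    by rewrite /N; field; rewrite gt_eqF.
  by rewrite lerDr !mulr_ge0// ltW.
have Bx x : `|x| <= rho -> `|x| <= rho + 2 by move=> H; rewrite ler_wpDr.
exists (supconv u rho M N); split.
- exact: supconv_continuous.
- move=> x Kx; apply: (@supconv_le_on _ _ _ _ _ _ _ _ _ x c d) => //.
    exact/Bx/Krho.
  by move=> z; exact: Hd.
- rewrite -lee_fin (le_trans ux0)//; apply: supconv_ge_u => //.
  exact: Bx.
- by move=> x v1 v2 r xr v10 v12 v11 r0 rv; exact: supconv_submean.
Qed.

(** * Integration on the real 3-space *)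

Section Caratheodory.
Context {R : realType} {d : measure_display} {X : measurableType d}.

Let grid (n : nat) (s : R) : R := (Num.floor (n.+1%:R * s))%:~R / n.+1%:R.

Let grid_le n s : `|s - grid n s| <= n.+1%:R^-1.
Proof.
have n0 : 0 < n.+1%:R :> R by rewrite ltr0n.
have /andP[H1 H2] := floor_itv (n.+1%:R * s).
have -> : s - grid n s = (n.+1%:R * s - (Num.floor (n.+1%:R * s))%:~R) / n.+1%:R.
  by rewrite mulrBl mulrAC divff ?gt_eqF// mul1r.
have H : `|n.+1%:R * s - (Num.floor (n.+1%:R * s))%:~R| <= 1.
  rewrite ger0_norm ?subr_ge0// ltW// ltrBlDr addrC.
  by rewrite intrD in H2.
by rewrite normrM normfV (gtr0_norm n0) ler_piMl// invr_ge0 ltW.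
Qed.

Lemma bigcup_measurable_int (A : int -> set (X * R)) :
  (forall k, measurable (A k)) -> measurable (\bigcup_k A k).
Proof.
move=> mA; pose B (o : option int) := oapp A set0 o.
rewrite (_ : \bigcup_k A k = \bigcup_m B (choice.unpickle m)); last first.
  apply/seteqP; split=> [z [k _ Az]|z [m _]].
    by exists (choice.pickle k); [|rewrite (choice.pickleK k)].
  by rewrite /B; case: choice.unpickle => // k Az; exists k.
apply: bigcupT_measurable => m; case: (choice.unpickle m) => [k|] /=.
  exact: mA.
exact: measurable0.
Qed.

(** F(x, s) is the limit of F(x, grid n s), and each of these is measurable because [grid n] is
    constant on countably many intervals. Adding one variable at a time, continuous functions become
    measurable for the product sigma-algebra. *)
Lemma caratheodory_measurable (F : X * R -> R) :
  (forall x, continuous (fun s => F (x, s))) ->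
  (forall s, measurable_fun setT (fun x => F (x, s))) -> measurable_fun setT F.
Proof.
move=> cF mF; apply/measurable_EFinP.
apply: (emeasurable_fun_cvg (fun n z => (F (z.1, grid n z.2))%:E)) => [n|[x s] _].
  apply/measurable_EFinP => _ Y mY; rewrite setTI.
  rewrite (_ : _ @^-1` _ = \bigcup_(k : int)
     (((fun x => F (x, k%:~R / n.+1%:R)) @^-1` Y) `*`
      [set s | Num.floor (n.+1%:R * s) = k])); last first.
    apply/seteqP; split=> [[x s] /= FY|[x s] [k _ [/= FY E]]].
      by exists (Num.floor (n.+1%:R * s)) => //=.
    by rewrite /grid E.
  apply: bigcup_measurable_int => k; apply: measurableX.
    by rewrite -[X in measurable X]setTI; exact: mF.
  have n0 : 0 < n.+1%:R :> R by rewrite ltr0n.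
  rewrite (_ : [set s | _] = `[k%:~R / n.+1%:R, (k + 1)%:~R / n.+1%:R[%classic)//.
  apply/seteqP; split=> s /=; rewrite in_itv/= ler_pdivrMr// ltr_pdivlMr// mulrC.
    by move=> <-; exact: floor_itv.
  by move=> H; apply: floor_def.
apply/cvg_EFin; first exact: nearW.
apply: (@cvg_comp _ _ _ (fun n => grid n s) (fun s => F (x, s)) _ (nbhs s)).
  apply/cvgrPdist_le => e e0; near=> n.
  rewrite (le_trans (grid_le n s))//; apply: ltW.
  by near: n; exact: near_infty_natSinv_lt (PosNum e0).
exact: cF.
Unshelve. all: by end_near. Qed.

End Caratheodory.

Section ProductLebesgue.
Context {R : realType}.
Local Open Scope ereal_scope.

Lemma sigma_finite_product d1 d2 (T1 : measurableType d1) (T2 : measurableType d2)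
    (m1 : {sigma_finite_measure set T1 -> \bar R})
    (m2 : {sigma_finite_measure set T2 -> \bar R}) : sigma_finite setT (m1 \x m2).
Proof.
have /sigma_finiteP[F [TF ndF Foo]] := sigma_finiteT m1.
have /sigma_finiteP[G [TG ndG Goo]] := sigma_finiteT m2.
exists (fun n => F n `*` G n).
  rewrite -setXTT TF TG predeqE => -[x y]; split.
    move=> [/= [n _ Fnx] [k _ Gky]]; exists (maxn n k) => //; split.
    - by move: x Fnx; exact/subsetPset/ndF/leq_maxl.
    - by move: y Gky; exact/subsetPset/ndG/leq_maxr.
  by move=> [n _ []/= ? ?]; split; exists n.
move=> k; have [mF Fk] := Foo k; have [mG Gk] := Goo k.
split; first exact: measurableX.
by rewrite product_measure1E// lte_mul_pinfty// ge0_fin_numE.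
Qed.

Definition leb2 : set (measurableTypeR R * measurableTypeR R) -> \bar R :=
  @lebesgue_measure R \x @lebesgue_measure R.
HB.instance Definition _ := Measure.on leb2.
HB.instance Definition _ := @Measure_isSigmaFinite.Build _ _ _ leb2
  (sigma_finite_product (@lebesgue_measure R) (@lebesgue_measure R)).

Definition leb3 : set ((measurableTypeR R * measurableTypeR R) * measurableTypeR R) -> \bar R :=
  leb2 \x @lebesgue_measure R.
HB.instance Definition _ := Measure.on leb3.
HB.instance Definition _ := @Measure_isSigmaFinite.Build _ _ _ leb3
  (sigma_finite_product leb2 (@lebesgue_measure R)).

End ProductLebesgue.

Section Space3.
Context {R : realType}.
Notation mu := (@lebesgue_measure R).
Notation V := 'rV[R]_3.
Notation Z := ((R * R) * R)%type.

(** Identifies the product of three lines, which carries [leb3], with the space of row vectors. *)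
Definition pt3 (z : Z) : V :=
  plane_point 0 (delta_mx 0 0) (delta_mx 0 1) z.1 + z.2 *: delta_mx 0 (inord 2).

Lemma pt3_continuous : continuous pt3.
Proof.
move=> z; apply: cvgD.
  apply: (@continuous_comp _ _ _ fst (plane_point 0 (delta_mx 0 0) (delta_mx 0 1))).
    exact: cvg_fst.
  exact: plane_point_continuous.
by apply: cvgZr_tmp; exact: cvg_snd.
Qed.

Lemma pt3E (z : Z) : [/\ pt3 z 0 0 = z.1.1, pt3 z 0 1 = z.1.2 &
  pt3 z 0 (inord 2) = z.2].
Proof.
have E2 : (inord 2 : 'I_3) = Ordinal (isT : (2 < 3)%N).
  by apply/val_inj; rewrite /= inordK.
by rewrite /pt3 /plane_point E2; split; rewrite !mxE /=; ring.
Qed.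

Lemma continuous_slice2 (S T : topologicalType) (F : S * T -> R) (x : S) :
  continuous F -> continuous (fun t => F (x, t)).
Proof.
move=> cF t; apply: (@continuous_comp _ _ _ (fun t => (x, t)) F); last exact: cF.
by apply: (@cvg_pair _ _ _ _ (nbhs x) (nbhs t)); [exact: cvg_cst|exact: cvg_id].
Qed.

Lemma continuous_slice1 (S T : topologicalType) (F : S * T -> R) (t : T) :
  continuous F -> continuous (fun x => F (x, t)).
Proof.
move=> cF x; apply: (@continuous_comp _ _ _ (fun x => (x, t)) F); last exact: cF.
by apply: (@cvg_pair _ _ _ _ (nbhs x) (nbhs t)); [exact: cvg_id|exact: cvg_cst].
Qed.

Lemma measurable_continuous2 (F : R * R -> R) :
  continuous F -> measurable_fun setT F.
Proof.
move=> cF; apply: caratheodory_measurable => [x|s].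
  exact: continuous_slice2.
by apply: continuous_measurable_fun; exact: continuous_slice1.
Qed.

Lemma measurable_continuous3 (F : Z -> R) : continuous F -> measurable_fun setT F.
Proof.
move=> cF; apply: caratheodory_measurable => [x|s].
  exact: continuous_slice2.
by apply: measurable_continuous2; exact: continuous_slice1.
Qed.

Lemma measurable_continuous4 (F : Z * R -> R) : continuous F -> measurable_fun setT F.
Proof.
move=> cF; apply: caratheodory_measurable => [x|s].
  exact: continuous_slice2.
by apply: measurable_continuous3; exact: continuous_slice1.
Qed.

Lemma lebesgue_shift (a : R) (A : set R) : measurable A ->
  pushforward mu ((fun x => x + a) : R -> measurableTypeR R) A = mu A.
Proof.
move=> mA; apply/esym/lebesgue_measure_unique => //=.
  by apply: measurable_funD.
move=> _ _ [[b c]] _ <-; rewrite /pushforward.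
have -> : (fun x => x + a) @^-1` `]b, c] = `]b - a, c - a]%classic.
  by apply/seteqP; split=> x /=; rewrite !in_itv/= ltrBlDr lerBrDr.
rewrite /= !lebesgue_measure_itv/= !lte_fin ltrD2r.
by case: ifP => // _; rewrite -!EFinB; congr EFin; ring.
Qed.

(** The pushforward agrees with the product measure on rectangles, and these determine it. *)
Lemma prod_shift d1 d2 (T1 : measurableType d1) (T2 : measurableType d2)
    (m1 : {sigma_finite_measure set T1 -> \bar R})
    (m2 : {sigma_finite_measure set T2 -> \bar R})
    (s1 : T1 -> T1) (s2 : T2 -> T2) :
  measurable_fun setT s1 -> measurable_fun setT s2 ->
  (forall A, measurable A -> pushforward m1 s1 A = m1 A) ->
  (forall A, measurable A -> pushforward m2 s2 A = m2 A) ->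
  measurable_fun setT (fun z : T1 * T2 => (s1 z.1, s2 z.2)) /\
  forall A, measurable A ->
    pushforward (m1 \x m2)%E (fun z : T1 * T2 => (s1 z.1, s2 z.2)) A = (m1 \x m2)%E A.
Proof.
move=> ms1 ms2 H1 H2.
have ms : measurable_fun setT (fun z : T1 * T2 => (s1 z.1, s2 z.2)).
  apply: measurable_fun_pair; apply: measurableT_comp => //.
split=> // A mA; apply/esym/product_measure_unique => //= C D mC mD.
rewrite /pushforward.
rewrite (_ : _ @^-1` _ = (s1 @^-1` C) `*` (s2 @^-1` D)); last by [].
rewrite product_measure1E; last 2 first.
- by rewrite -[X in measurable X]setTI; exact: ms1.
- by rewrite -[X in measurable X]setTI; exact: ms2.
by congr (_ * _)%E; [exact: H1|exact: H2].
Qed.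

End Space3.

(** * Integrals of compactly supported continuous functions *)

Section Integral3.
Context {R : realType}.
Notation mu := (@lebesgue_measure R).
Notation V := 'rV[R]_3.
Notation Z := ((R * R) * R)%type.
Notation m3 := (@leb3 R).
Notation circ := (`[0%R, (2 * pi)%R]%classic : set R).

Definition box (A : R) : set Z := (`[- A, A] `*` `[- A, A]) `*` `[- A, A].

Lemma measurable_box A : measurable (box A).
Proof. by apply: measurableX => //; apply: measurableX. Qed.

Lemma itv_measure (A : R) : 0 <= A -> mu `[- A, A] = (2 * A)%:E.
Proof.
move=> A0; rewrite lebesgue_measure_itv/= lte_fin.
have [_|] := ltP (- A) A; first by rewrite -EFinB; congr EFin; ring.
move=> H; have -> : A = 0 by move: H A0; lra.
by rewrite mulr0.
Qed.

Lemma box_measure (A : R) : 0 <= A -> m3 (box A) = ((2 * A) ^+ 3)%:E.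
Proof.
move=> A0; rewrite /box /leb3 product_measure1E//; last exact: measurableX.
have E : leb2 (`[- A, A] `*` `[- A, A]) = (2 * A * (2 * A))%:E.
  by rewrite /leb2 product_measure1E// EFinM -itv_measure.
transitivity ((2 * A * (2 * A))%:E * (2 * A)%:E)%E.
  by rewrite -E -itv_measure.
by rewrite -EFinM; congr EFin; ring.
Qed.

Lemma box_measure_fin (A : R) : 0 <= A -> (m3 (box A) < +oo)%E.
Proof. by move=> /box_measure ->; exact: ltry. Qed.

Lemma box_out (A : R) (z : Z) : ~ box A z -> A < `|pt3 z|.
Proof.
have [e0 e1 e2] := pt3E z.
move=> nb; rewrite ltNge; apply/negP => H; apply: nb.
have h0 := le_trans (coord_le_norm (pt3 z) 0) H; rewrite e0 ler_norml in h0.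
have h1 := le_trans (coord_le_norm (pt3 z) 1) H; rewrite e1 ler_norml in h1.
have h2 := le_trans (coord_le_norm (pt3 z) (inord 2)) H; rewrite e2 ler_norml in h2.
by split; [split|] => /=; rewrite in_itv/=.
Qed.

Lemma box_in (A : R) (z : Z) : box A z -> `|pt3 z| <= A.
Proof.
have [e0 e1 e2] := pt3E z.
move=> [[/= z0 z1] z2]; move: z0 z1 z2; rewrite !in_itv/= -!ler_norml => z0 z1 z2.
have A0 : 0 <= A by exact: le_trans (normr_ge0 _) z0.
apply: norm_le_coord => // -[[|[|[|//]]] lt3].
- by rewrite (_ : Ordinal lt3 = 0) ?e0//; exact: val_inj.
- by rewrite (_ : Ordinal lt3 = 1) ?e1//; exact: val_inj.
- by rewrite (_ : Ordinal lt3 = inord 2) ?e2//; apply: val_inj; rewrite /= inordK.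
Qed.

(** The support is measured in the maximum norm, whose balls are the sets [box A]. *)
Definition csupp (F : V -> R) (A : R) : Prop :=
  continuous F /\ forall x, A < `|x| -> F x = 0.

Definition int3 (F : V -> R) : R := \int[m3]_z F (pt3 z).

Lemma ball_bounded (f : V -> R) (A : R) : continuous f ->
  exists2 M, 0 <= M & forall x, `|x| <= A -> `|f x| <= M.
Proof.
move=> cf; have /compact_bounded[M [_ HM]] : compact (f @` [set x : V | `|x| <= A]).
  apply: continuous_compact; first exact: continuous_subspaceT.
  exact: compact_norm_le.
exists (`|M| + 1) => [|x xA]; first by rewrite addr_ge0.
apply: (HM (`|M| + 1)); last by exists x.
by rewrite (le_lt_trans (ler_norm M))// ltrDl.
Qed.

Lemma csupp_bounded F A : csupp F A -> exists2 M, 0 <= M & forall x, `|F x| <= M.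
Proof.
move=> [cF F0]; have [M M0 HM] := ball_bounded A cF; exists M => // x.
by have [/HM //|/F0 ->] := leP `|x| A; rewrite normr0.
Qed.

Lemma continuous_pt3 (F : V -> R) : continuous F -> continuous (F \o pt3).
Proof.
by move=> cF z; apply: continuous_comp; [exact: pt3_continuous|exact: cF].
Qed.

Lemma patch_box F A : csupp F A -> (F \o pt3) \_ (box A) = F \o pt3.
Proof.
move=> [_ F0]; apply/funext => z; rewrite patchE; case: ifPn => //.
by rewrite notin_setE => /box_out /F0 /= ->.
Qed.

Lemma csupp_integrable F A : csupp F A -> m3.-integrable setT (EFin \o (F \o pt3)).
Proof.
move=> sF; have [cF F0] := sF; have [M M0 HM] := csupp_bounded sF.
have mF : measurable_fun setT (F \o pt3).
  by apply: measurable_continuous3; exact: continuous_pt3.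
pose A' := `|A|.
have sF' : csupp F A'.
  by split=> // x Hx; apply: F0; exact: (le_lt_trans (ler_norm A)).
rewrite -(patch_box sF') -restrict_EFin.
apply/integrable_restrict => //; first exact: measurable_box.
rewrite setTI; apply: measurable_bounded_integrable.
- exact: measurable_box.
- exact: (box_measure_fin (normr_ge0 A)).
- exact: (measurable_funTS mF).
- exists M; split; first exact: num_real.
  by move=> N MN z _; exact: (le_trans (HM _) (ltW MN)).
Qed.

Lemma int3_add F G A : csupp F A -> csupp G A ->
  int3 (fun x => F x + G x) = int3 F + int3 G.
Proof.
move=> sF sG; rewrite /int3 RintegralD//.
  exact: (csupp_integrable sF).
exact: (csupp_integrable sG).
Qed.

Lemma int3_scale F A c : csupp F A -> int3 (fun x => c * F x) = c * int3 F.
Proof.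
move=> sF; rewrite /int3 RintegralZl//; exact: (csupp_integrable sF).
Qed.

Lemma int3_le F G A : csupp F A -> csupp G A -> (forall x, F x <= G x) ->
  int3 F <= int3 G.
Proof.
move=> sF sG FG; apply: le_Rintegral => //.
  exact: (csupp_integrable sF).
exact: (csupp_integrable sG).
Qed.

Lemma int3_bound F A c : 0 <= A -> csupp F A -> (forall x, `|F x| <= c) ->
  `|int3 F| <= c * (2 * A) ^+ 3.
Proof.
move=> A0 sF Fc; have [cF F0] := sF.
have iF := csupp_integrable sF.
rewrite /int3 (le_trans (le_normr_Rintegral _ iF))//.
have -> : \int[m3]_t `|F (pt3 t)| = \int[m3]_(t in box A) `|F (pt3 t)|.
  rewrite [RHS]Rintegral_mkcond; apply: eq_Rintegral => z _.
  rewrite patchE; case: ifPn => //.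
  by rewrite notin_setE => /box_out /F0 ->; rewrite normr0.
have mb := measurable_box A.
have -> : c * (2 * A) ^+ 3 = \int[m3]_(t in box A) c.
  by rewrite Rintegral_cst//; congr (_ * _); have /(congr1 fine) := box_measure A0.
apply: le_Rintegral => //.
- have := integrable_norm iF; apply: integrableS => //.
- apply: measurable_bounded_integrable => //; first exact: box_measure_fin.
  exact: bounded_cst.
Qed.

Lemma int3_gt0 F A a : csupp F A -> 0 < a -> (forall x, 0 <= F x) ->
  (forall x, `|x| <= a -> F x = 1) -> 0 < int3 F.
Proof.
move=> sF a0 F0 F1; have iF := csupp_integrable sF.
have mb := measurable_box a.
apply: (@lt_le_trans _ _ ((2 * a) ^+ 3)); first by rewrite exprn_gt0// mulr_gt0.
have -> : (2 * a) ^+ 3 = \int[m3]_z (\1_(box a) z : R).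
  by rewrite /Rintegral integral_indic// setIT; have /(congr1 fine) := box_measure (ltW a0).
apply: le_Rintegral => //.
  have -> : \1_(box a) = (fun=> 1 : R) \_ (box a) :> (Z -> R).
    by apply/funext => z; rewrite patchE indicE; case: ifP.
  rewrite -restrict_EFin; apply/integrable_restrict => //; rewrite setTI.
  apply: measurable_bounded_integrable => //; last exact: bounded_cst.
  exact: (box_measure_fin (ltW a0)).
move=> z _; rewrite indicE; case: (boolP (z \in box a)) => //=.
by rewrite inE => /box_in /F1 ->.
Qed.

(** Coordinate shifts preserve [leb3] factor by factor, and [pt3] turns them into translations. *)
Lemma int3_shift F A (b : Z) : csupp F A ->
  int3 (fun x => F (x + pt3 b)) = int3 F.
Proof.
move=> sF; have [cF F0] := sF.
have madd (c : R) : measurable_fun setT ((fun x => x + c) : R -> measurableTypeR R).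
  by apply: measurable_funD.
have [ms2 H2] := @prod_shift R _ _ _ _ mu mu _ _ (madd b.1.1) (madd b.1.2)
  (@lebesgue_shift R b.1.1) (@lebesgue_shift R b.1.2).
have [ms3 H3] := @prod_shift R _ _ _ _ (@leb2 R) mu _ _ ms2 (madd b.2) H2
  (@lebesgue_shift R b.2).
set s3 := (fun z : (R * R) * R => _) in ms3 H3.
have ps z : pt3 (s3 z) = pt3 z + pt3 b.
  by apply/rowP => j; rewrite /s3 /pt3 /plane_point !mxE /=; ring.
have mF : measurable_fun setT (EFin \o (F \o pt3)).
  by apply/measurable_EFinP; apply: measurable_continuous3; exact: continuous_pt3.
have cFs : csupp (fun x => F (x + pt3 b)) (`|A| + `|pt3 b|).
  split=> [x|x Hx].
    have cadd : {for x, continuous (fun y : V => y + pt3 b)}.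
      exact: (cvgD cvg_id (cvg_cst _)).
    exact: (continuous_comp cadd (cF _)).
  apply: F0; apply: (le_lt_trans (ler_norm A)).
  rewrite -(ltrD2r `|pt3 b|) (lt_le_trans Hx)//.
  by rewrite -{1}(addrK (pt3 b) x) (le_trans (ler_normB _ _)).
have iFs : m3.-integrable (s3 @^-1` setT) ((EFin \o (F \o pt3)) \o s3).
  rewrite preimage_setT; apply: eq_integrable (csupp_integrable cFs) => //.
  by move=> z _; rewrite /= ps.
have := integral_pushforward ms3 mF iFs measurableT.
rewrite preimage_setT /int3 /Rintegral => E; congr fine.
transitivity (\int[m3]_x ((EFin \o (F \o pt3)) \o s3) x)%E.
  by apply: eq_integral => z _; rewrite /= ps.
rewrite -E; apply: eq_measure_integral => C mC _; exact: H3.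
Qed.

(** Fubini for F restricted to a box times the circle: F is bounded there, hence integrable, and it
    vanishes over the rest of space. *)
Lemma int3_circle (F : V * R -> R) A : continuous F ->
  (forall x t, A < `|x| -> F (x, t) = 0) ->
  m3.-integrable setT (EFin \o (fun z => \int[mu]_(t in circ) F (pt3 z, t))) /\
  int3 (fun x => \int[mu]_(t in circ) F (x, t)) =
  \int[mu]_(t in circ) int3 (fun x => F (x, t)).
Proof.
move=> cF F0; pose A' := `|A|.
pose G (y : Z * R) : R := F (pt3 y.1, y.2).
have cG : continuous G.
  move=> y; apply: (@continuous_comp _ _ _ (fun y : Z * R => (pt3 y.1, y.2)) F); last exact: cF.
  apply: (@cvg_pair _ _ _ _ (nbhs (pt3 y.1)) (nbhs y.2)); last exact: cvg_snd.
  by apply: (@continuous_comp _ _ _ fst pt3); [exact: cvg_fst|exact: pt3_continuous].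
have mG : measurable_fun setT G by exact: measurable_continuous4.
have F0' x t : A' < `|x| -> F (x, t) = 0.
  by move=> H; apply: F0; apply: le_lt_trans H; exact: ler_norm.
have [M HM] : exists M, forall y, (box A' `*` circ) y -> `|G y| <= M.
  have kB := @compact_norm_le R 3 A'.
  have /compact_bounded[M [_ HM]] : compact (F @` ([set x : V | `|x| <= A'] `*` circ)).
    apply: continuous_compact; first exact: continuous_subspaceT.
    by apply: compact_setX => //; exact: segment_compact.
  exists (`|M| + 1) => -[z t] [Bz Ct]; apply: (HM (`|M| + 1)).
    by rewrite (le_lt_trans (ler_norm M))// ltrDl.
  by exists (pt3 z, t) => //=; split => //=; exact: box_in.
have mBC : measurable (box A' `*` circ).
  by apply: measurableX => //; exact: measurable_box.
have mm : ((m3 \x mu)%E (box A' `*` circ) < +oo)%E.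
  rewrite product_measure1E//; last exact: measurable_box.
  have bf := box_measure_fin (normr_ge0 A).
  have cf : (mu circ < +oo)%E.
    by rewrite lebesgue_measure_itv/= lte_fin mulr_gt0 ?pi_gt0// -EFinB ltry.
  by apply: lte_mul_pinfty => //; rewrite ge0_fin_numE.
have iGB : (m3 \x mu)%E.-integrable (box A' `*` circ) (EFin \o G).
  apply: measurable_bounded_integrable => //; first exact: (measurable_funTS mG).
  exists M; split; first exact: num_real.
  by move=> N MN y yB; exact: (le_trans (HM _ yB) (ltW MN)).
pose H := (EFin \o G) \_ (box A' `*` circ).
have iH : (m3 \x mu)%E.-integrable setT H.
  by apply/integrable_restrict => //; rewrite setTI.
have HE z t : H (z, t) = ((fun t => (F (pt3 z, t))%:E) \_ circ) t.
  rewrite /H !patchE /= ; have [tc|tc] := boolP (t \in circ); last first.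
    case: ifPn => //; rewrite inE => -[_ /= tc']; move: tc.
    by rewrite notin_setE.
  case: ifPn => //; rewrite notin_setE => nzt; rewrite /G /= F0'//.
  by apply: box_out => Bz; apply: nzt; split=> //=; move: tc; rewrite inE.
have cFx x : continuous (fun t => F (x, t)) by exact: continuous_slice2.
have inner z : (\int[mu]_t H (z, t) = (\int[mu]_(t in circ) F (pt3 z, t))%:E)%E.
  rewrite -integral_EFin_continuous// [RHS]integral_mkcond.
  by apply: eq_integral => t _; exact: HE.
have outer t : (\int[m3]_z H (z, t) =
    ((fun t => (int3 (fun x => F (x, t)))%:E) \_ circ) t)%E.
  have sF : csupp (fun x => F (x, t)) A.
    by split=> [|x /F0 //]; exact: continuous_slice1.
  rewrite patchE; have [tc|tc] := boolP (t \in circ); last first.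
    rewrite integral0_eq// => z _; rewrite HE patchE.
    by rewrite (negPf tc).
  rewrite /int3 /Rintegral fineK; last first.
    by apply: integrable_fin_num => //; exact: (csupp_integrable sF).
  by apply: eq_integral => z _; rewrite HE patchE tc.
have I1 := integrable_fubini_F iH.
have E12 := integral12_prod_meas1 iH.
have E21 := integral21_prod_meas1 iH.
rewrite /fubini_F in I1 E12; rewrite /fubini_G in E21.
split.
  apply: eq_integrable I1 => // z _ /=; exact: inner.
rewrite /int3 /Rintegral; congr fine.
transitivity (\int[m3]_z \int[mu]_t H (z, t))%E.
  by apply: eq_integral => z _; rewrite inner.
rewrite E12 -E21 [RHS]integral_mkcond; apply: eq_integral => t _.
by rewrite outer !patchE /=.
Qed.

End Integral3.

(** * Mollification *)

Section Mollification.
Context {R : realType}.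
Notation C3 := (C3 R).
Notation V := 'rV[R]_3.

Lemma dd_scaledir (W : normedModType R) (c : R) (v : W) (u : W -> R) q :
  Csmooth u -> dd (c *: v) u q = c * dd v u q.
Proof.
move=> su; have d0 : dd (0 : W) u q = 0.
  by rewrite -(addNr v) -scaleN1r dd_lin// mulN1r addNr.
by have := dd_lin v 0 c q su; rewrite addr0 d0 addr0.
Qed.

(** The mean value theorem twice along the segment; the intermediate parameter s in [0, 1] only
    shrinks the second derivative. *)
Lemma test_fun_taylor (u : C3 -> R) : test_fun u ->
  exists2 C, 0 <= C & forall p k, `|u (k + p) - u p - dd k u p| <= C * `|k| ^+ 2.
Proof.
move=> tu; have su : Csmooth u by case: tu.
have [C C0 HC] := test_fun_lip2 tu; exists C => // p k.
have [s /andP[s0 s1] ->] := segment_MVT p k su.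
have [s' _ ->] := segment_MVT p (s *: k) (Csmooth_dd k su).
have -> : dd (s *: k) (dd k u) = fun q => s * dd k (dd k u) q.
  by apply/funext => q; apply: dd_scaledir; exact: Csmooth_dd.
rewrite normrM ger0_norm//; apply: (le_trans _ (HC k (s' *: (s *: k) + p))).
by rewrite ler_piMl.
Qed.

Lemma test_fun_radius (u : C3 -> R) : test_fun u ->
  exists2 A, 0 <= A & forall p, A < `|p| -> u p = 0.
Proof.
move=> [su /compact_bounded[M [_ HM]]]; exists (`|M| + 1) => [|p Hp].
  by rewrite addr_ge0.
apply: fun_supp_out => /(HM (`|M| + 1)) H; move: Hp; rewrite ltNge H//.
by rewrite (le_lt_trans (ler_norm M))// ltrDl.
Qed.

Context (f : V -> R) (cf : continuous f).

(** The kernel lives on C^3 so that the bounds on test functions apply to it, but only its slice y =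
    0 is integrated; the result is a function on C^3 that depends on x alone. *)
Definition mollify (k : C3 -> R) (q : C3) : R :=
  int3 (fun z => f z * k (z - q.1, 0)).

Lemma continuous_mul (U : topologicalType) (a b : U -> R) :
  continuous a -> continuous b -> continuous (fun x => a x * b x).
Proof. by move=> ca cb x; apply: cvgM; [exact: ca|exact: cb]. Qed.

Lemma mollify_continuous_arg (k : C3 -> R) (x : V) : continuous k ->
  continuous (fun z => f z * k (z - x, 0)).
Proof.
move=> ck; have c0 : continuous (fun y : V => k (y, 0)) by exact: continuous_slice1.
have c1 : continuous (fun z : V => k (z - x, 0)).
  move=> z; have cs : {for z, continuous (fun z : V => z - x)}.
    exact: (cvgB cvg_id (cvg_cst _)).
  exact: (continuous_comp cs (c0 _)).
exact: continuous_mul cf c1.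
Qed.

Lemma norm_slice (x : V) : `|(x, 0 : V)| = `|x|.
Proof.
change (Num.max `|x| `|0 : V| = `|x|); rewrite normr0.
by apply/max_idPl; exact: normr_ge0.
Qed.

Lemma mollify_csupp (k : C3 -> R) (x : V) (A B : R) : continuous k ->
  (forall p, A < `|p| -> k p = 0) -> A + `|x| <= B ->
  csupp (fun z => f z * k (z - x, 0)) B.
Proof.
move=> ck k0 AB; split=> [|z zB]; first exact: mollify_continuous_arg.
rewrite k0 ?mulr0// norm_slice -(ltrD2r `|x|) (le_lt_trans AB)//.
by rewrite (lt_le_trans zB)// -{1}(subrK x z) ler_normD.
Qed.

Lemma csupp_add (F G : V -> R) A : csupp F A -> csupp G A ->
  csupp (fun x => F x + G x) A.
Proof.
move=> [cF F0] [cG G0]; split=> [x|x Ax]; last by rewrite F0// G0// addr0.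
exact: (cvgD (cF x) (cG x)).
Qed.

Lemma csupp_scale (F : V -> R) A c : csupp F A -> csupp (fun x => c * F x) A.
Proof.
move=> [cF F0]; split=> [|x Ax]; last by rewrite F0// mulr0.
have cc : continuous (fun _ : V => c) by exact: cst_continuous.
exact: continuous_mul cc cF.
Qed.

Lemma mollify_lin (k : C3 -> R) (q : C3) (c : R) (v w : C3) : test_fun k ->
  mollify (dd (- (c *: v + w).1, 0) k) q =
  c * mollify (dd (- v.1, 0) k) q + mollify (dd (- w.1, 0) k) q.
Proof.
move=> tk; have sk : Csmooth k by case: tk.
have H (u : C3) : {A | csupp (fun z => f z * dd (- u.1, 0) k (z - q.1, 0)) A}.
  have tdk : test_fun (dd (- u.1, 0) k) by exact: test_fun_dd.
  apply: cid; have [A A0 HA] := test_fun_radius tdk; exists (A + `|q.1|).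
  by apply: mollify_csupp HA _ => //; apply: Csmooth_continuous; case: tdk.
have [A1 H1] := H v; have [A2 H2] := H w.
have E1 : csupp (fun z => f z * dd (- v.1, 0) k (z - q.1, 0)) (`|A1| + `|A2|).
  split=> [|x Hx]; [by case: H1|apply: H1.2; apply: le_lt_trans Hx].
  by rewrite (le_trans (ler_norm _))// lerDl.
have E2 : csupp (fun z => f z * dd (- w.1, 0) k (z - q.1, 0)) (`|A1| + `|A2|).
  split=> [|x Hx]; [by case: H2|apply: H2.2; apply: le_lt_trans Hx].
  by rewrite (le_trans (ler_norm _))// lerDr.
have E3 := csupp_scale c E1.
rewrite /mollify -(int3_scale c E1) -(int3_add E3 E2); congr int3; apply/funext => z.
have -> : (- (c *: v + w).1, 0) = c *: (- v.1, 0) + (- w.1, 0) :> C3.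
  by congr pair; rewrite /= ?opprD ?scalerN// scaler0 addr0.
by rewrite dd_lin//; ring.
Qed.

(** Moving q along v moves the argument of the kernel along (- v.1, 0). The Taylor remainder of the
    kernel is uniformly of order |h|^2, and integrating it over a fixed box gives the remainder for
    [diff_quadratic]. *)
Lemma mollify_diff (k : C3 -> R) (q : C3) : test_fun k ->
  differentiable (mollify k) q /\
  forall v, 'D_v (mollify k) q = mollify (dd (- v.1, 0) k) q.
Proof.
move=> tk; have sk : Csmooth k by case: tk.
have ck : continuous k by exact: Csmooth_continuous.
pose L (v : C3) := mollify (dd (- v.1, 0) k) q.
have linL : linear L by move=> c v w; exact: mollify_lin.
pose L' : {linear C3 -> R} :=
  HB.pack L (GRing.isLinear.Build R C3 R *:%R L linL).
have [A A0 kA] := test_fun_radius tk.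
have dkA v p : A < `|p| -> dd v k p = 0.
  move=> Ap; apply: (@near_dd _ _ [set p | A < `|p|]) => //.
  apply: (@open_comp _ _ (fun p : C3 => `|p|) [set t | A < t]).
    by move=> x _; exact: norm_continuous.
  exact: open_gt.
(* The extra 1 covers the kernels translated by h with |h| <= 1. *)
pose B := A + `|q.1| + 1.
have B0 : 0 <= B by rewrite !addr_ge0.
have [M M0 HM] := ball_bounded B cf.
have [C C0 HC] := test_fun_taylor tk.
have [C1 C10 HC1] := test_fun_lip tk.
have bound g c : csupp (fun z => f z * g z) B -> (forall z, `|g z| <= c) ->
    0 <= c -> `|int3 (fun z => f z * g z)| <= M * (2 * B) ^+ 3 * c.
  move=> sg gc c0; rewrite mulrAC; apply: int3_bound => // z.
  have [zB|zB] := leP `|z| B; first by rewrite normrM ler_pM// HM.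
  by rewrite sg.2// normr0 mulr_ge0.
have sdk v : csupp (fun z => f z * dd v k (z - q.1, 0)) B.
  apply: mollify_csupp (dkA v) _; last by rewrite /B lerDl.
  by apply/Csmooth_continuous/Csmooth_dd.
have norm1 (v : C3) : `|(- v.1, 0 : V)| <= `|v|.
  by rewrite norm_slice normrN norm_fst_le.
have cL : continuous L'.
  apply: (@lip_continuous _ _ _ (M * (2 * B) ^+ 3 * C1)) => [|x y].
    by rewrite !mulr_ge0// exprn_ge0// mulr_ge0.
  rewrite -linearB -[_ * C1 * _]mulrA.
  apply: (@bound (fun z => dd (- (y - x).1, 0) k (z - q.1, 0))) => [|z|].
  - exact: sdk.
  - by rewrite (le_trans (HC1 _ _))// ler_wpM2l.
  - by rewrite mulr_ge0.
have := @diff_quadratic R C3 (mollify k) q L' (M * (2 * B) ^+ 3 * C) cL.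
case=> [h h1|dM DM]; last by split.
have hE z : f z * k (z - (h + q).1, 0) - f z * k (z - q.1, 0) - f z * dd (- h.1, 0) k (z - q.1, 0) =
    f z * (k ((- h.1, 0) + (z - q.1, 0)) - k (z - q.1, 0) - dd (- h.1, 0) k (z - q.1, 0)).
  have -> : (- h.1, 0) + (z - q.1, 0) = (z - (h + q).1, 0) :> C3.
    by congr pair; rewrite /= ?addr0// opprD addrCA.
  by ring.
have s1 : csupp (fun z => f z * k (z - (h + q).1, 0)) B.
  apply: mollify_csupp kA _ => //; rewrite /B -addrA lerD2l addrC.
  rewrite (le_trans (ler_normD h.1 q.1))// lerD2r.
  by rewrite (le_trans (norm_fst_le _)).
have s2 : csupp (fun z => f z * k (z - q.1, 0)) B.
  by apply: mollify_csupp kA _ => //; rewrite /B lerDl.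
have s2' := csupp_scale (-1) s2.
have s3' := csupp_scale (-1) (sdk (- h.1, 0)).
have s12 := csupp_add s1 s2'.
have -> : mollify k (h + q) - mollify k q - L' h =
    int3 (fun z => f z * (k ((- h.1, 0) + (z - q.1, 0)) - k (z - q.1, 0) -
      dd (- h.1, 0) k (z - q.1, 0))).
  rewrite -mulN1r -[- L' h]mulN1r.
  rewrite /= /L /mollify -(int3_scale _ s2) -(int3_scale _ (sdk _)).
  rewrite -(int3_add s1 s2') -(int3_add s12 s3').
  by congr int3; apply/funext => z; rewrite -hE !mulN1r.
rewrite -[_ * C * _]mulrA.
apply: (@bound (fun z => k ((- h.1, 0) + (z - q.1, 0)) - k (z - q.1, 0) -
  dd (- h.1, 0) k (z - q.1, 0))) => [|z|].
- have := csupp_add s12 s3'; congr csupp; apply/funext => z.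
  by rewrite -hE !mulN1r.
- by rewrite (le_trans (HC _ _))// ler_wpM2l// ler_pXn2r ?nnegrE.
- by rewrite mulr_ge0// exprn_ge0.
Qed.

Lemma Csmooth_mollify (k : C3 -> R) : test_fun k -> Csmooth (mollify k).
Proof.
move=> tk; apply: (@Csmooth_coind _ _ (fun g => exists2 k, test_fun k & g = mollify k));
  last by exists k.
move=> g [{tk}k tk ->]; split=> [q|v]; first by have [] := mollify_diff q tk.
exists (dd (- v.1, 0) k); first exact: test_fun_dd.
by apply/funext => q; have [_ ->] := mollify_diff q tk.
Qed.

End Mollification.

(** * Mollification and sub-mean inequalities *)

Section MollifyPsh.
Context {R : realType}.
Notation C3 := (C3 R).
Notation V := 'rV[R]_3.
Notation mu := (@lebesgue_measure R).
Notation circ := (`[0%R, (2 * pi)%R]%classic : set R).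

Lemma continuous_compose (S T U : topologicalType) (g : T -> U) (h : S -> T) :
  continuous g -> continuous h -> continuous (fun x => g (h x)).
Proof. by move=> cg ch x; apply: continuous_comp; [exact: ch|exact: cg]. Qed.

Lemma continuous_add (S : topologicalType) (g h : S -> V) :
  continuous g -> continuous h -> continuous (fun x => g x + h x).
Proof. by move=> cg ch x; exact: (cvgD (cg x) (ch x)). Qed.

Lemma pt3_surj (x : V) : exists b, pt3 b = x.
Proof.
exists ((x 0 0, x 0 1), x 0 (inord 2)).
have [e0 e1 e2] := pt3E ((x 0 0, x 0 1), x 0 (inord 2)).
apply/rowP => -[[|[|[|//]]] lt3].
- by rewrite (_ : Ordinal lt3 = 0) ?e0//; exact: val_inj.
- by rewrite (_ : Ordinal lt3 = 1) ?e1//; exact: val_inj.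
- by rewrite (_ : Ordinal lt3 = inord 2) ?e2//; apply: val_inj; rewrite /= inordK.
Qed.

(* If the Laplacian were negative, subtracting a small multiple of a function
   with bounded Laplacian that is constant on the circles would contradict
   [lap_ge0_submean]. *)
Lemma lap_ge0_of_submean (W : normedModType R) (a b q : W) (w s2 : W -> R)
    (m n r0 : R) :
  Csmooth w -> Csmooth s2 -> 0 < m -> 0 < n -> 0 < r0 ->
  (forall p, lap a b s2 p <= m) ->
  (forall r t, s2 (polar q a b (r, t)) = r ^+ 2 * n) ->
  (forall r, 0 < r <= r0 ->
     2 * pi * w q <= \int[mu]_(t in circ) w (polar q a b (r, t))) ->
  0 <= lap a b w q.
Proof.
move=> sw ss m0 n0 r00 sm sE sub; rewrite leNgt; apply/negP => lw.
(* Then d lap s2 <= d m = - lap w(q) / 2, so - w - d s2 keeps a nonnegative Laplacian wherever lap w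
   <= lap w(q) / 2, in particular near q. *)
pose d := - lap a b w q / (2 * m).
have d0 : 0 < d by rewrite divr_gt0 ?oppr_gt0// mulr_gt0.
pose g p := (-1) * w p + (- d) * s2 p.
have s1 : Csmooth (fun p => (-1) * w p) by exact: Csmooth_scale.
have s3 : Csmooth (fun p => (- d) * s2 p) by exact: Csmooth_scale.
have sg : Csmooth g by exact: Csmooth_add.
have lg p : lap a b g p = - lap a b w p - d * lap a b s2 p.
  by rewrite (lapD a b p s1 s3) (lapZ a b (-1) p sw) (lapZ a b (- d) p ss) mulN1r mulNr.
have cl : continuous (lap a b w).
  rewrite (_ : lap a b w = fun p => dd a (dd a w) p + dd b (dd b w) p); last first.
    by apply/funext => p; rewrite lapE.
  by apply/Csmooth_continuous/Csmooth_add; do 2 apply: Csmooth_dd.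
have [e e0 He] : exists2 e, 0 < e & forall p, `|q - p| < e -> lap a b w p <= lap a b w q / 2.
  have op : open [set p | lap a b w p < lap a b w q / 2].
    apply: (@open_comp _ _ (lap a b w) [set t | t < lap a b w q / 2]).
      by move=> x _; exact: cl.
    exact: open_lt.
  have : nbhs q [set p | lap a b w p < lap a b w q / 2].
    by apply: open_nbhs_nbhs; split => //=; rewrite ltr_nMr// invf_lt1// ltr1n.
  move=> /nbhs_ballP[e /= e0 He]; exists e => // p pq; apply/ltW/He.
  by rewrite -ball_normE.
have ab0 : 0 < `|a| + `|b| + 1 by rewrite ltr_wpDl// addr_ge0.
pose r := Num.min r0 (e / (2 * (`|a| + `|b| + 1))).
have r_gt0 : 0 < r by rewrite lt_min r00/= divr_gt0// mulr_gt0.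
have rE : r * (`|a| + `|b| + 1) < e.
  apply: (@le_lt_trans _ _ (e / 2)); last by rewrite ltr_pdivrMr// ltr_pMr// ltr1n.
  rewrite -ler_pdivlMr// -mulrA -invfM; rewrite ge_min; apply/orP; right.
  by rewrite mulrC.
have pd s t : 0 <= s <= r -> `|q - polar q a b (s, t)| < e.
  move=> /andP[s0 sr]; apply: le_lt_trans rE.
  rewrite /polar /= opprD addrCA subrr addr0 normrN normrZ ger0_norm//.
  apply: ler_pM => //; rewrite /rot (le_trans (ler_normD _ _))// !normrZ.
  rewrite -[leLHS]addr0; apply: lerD => //; apply: lerD.
    by rewrite ler_piMl// cos_max.
  by rewrite ler_piMl// sin_max.
have : 2 * pi * g q <= \int[mu]_(t in circ) g (polar q a b (r, t)).
  apply: lap_ge0_submean => // [|s t sr]; first exact: ltW.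
  rewrite lg; have h1 := He _ (pd s t sr).
  have : d * lap a b s2 (polar q a b (s, t)) <= d * m by rewrite ler_pM2l.
  have -> : d * m = - lap a b w q / 2 by rewrite /d; field; rewrite gt_eqF.
  move: h1; move: (lap a b w _) (d * lap _ _ _ _) (lap a b w q) => X Y Z; lra.
have s2q : s2 q = 0.
  by have := sE 0 0; rewrite /polar /= scale0r add0r expr0n mul0r.
have cp : continuous (fun t : R => polar q a b (r, t)).
  move=> t; apply: (@continuous_comp _ _ _ (fun t => (r, t)) (polar q a b)); last exact: polar_continuous.
  by apply: (@cvg_pair _ _ _ _ (nbhs r) (nbhs t)); [exact: cvg_cst|exact: cvg_id].
have cw : continuous (fun t : R => w (polar q a b (r, t))).
  move=> t; apply: (@continuous_comp _ _ _ (fun t => polar q a b (r, t)) w); first exact: cp.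
  exact: (Csmooth_continuous sw).
have mcirc : mu circ = (2 * pi)%:E.
  by rewrite lebesgue_measure_itv/= lte_fin mulr_gt0 ?pi_gt0// -EFinB subr0.
have -> : \int[mu]_(t in circ) g (polar q a b (r, t)) =
    (-1) * \int[mu]_(t in circ) w (polar q a b (r, t)) + (- d * (r ^+ 2 * n)) * (2 * pi).
  have iw := @integrable_continuous R _ 0 (2 * pi) cw.
  have ic : mu.-integrable circ (EFin \o (fun t : R => - d * (r ^+ 2 * n))).
    by apply: integrable_continuous; exact: cst_continuous.
  rewrite -RintegralZl// -[X in _ + X](_ : \int[mu]_(t in circ) (- d * (r ^+ 2 * n)) = _); last first.
    by rewrite Rintegral_cst//; congr (_ * _); have /(congr1 fine) := mcirc.
  rewrite -RintegralD//; last first.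
    by apply: integrable_continuous; apply: continuous_mul => //; exact: cst_continuous.
  by apply: eq_Rintegral => t _; rewrite /g sE.
rewrite /g s2q mulr0 addr0 !mulNr !mul1r mulrN.
have := sub r; rewrite r_gt0 ge_min lexx => /(_ isT).
have : 0 < d * (r ^+ 2 * n) * (2 * pi).
  apply: mulr_gt0; last by rewrite mulr_gt0 ?pi_gt0.
  by apply: mulr_gt0 => //; apply: mulr_gt0 => //; exact: exprn_gt0.
move: (_ * (2 * pi)) (2 * pi * w q) (\int[mu]_(t in circ) _) => X Y Z; lra.
Qed.

Context (f : V -> R) (cf : continuous f) (k : C3 -> R) (tk : test_fun k) (A : R).
Hypothesis (k0 : forall p, 0 <= k p) (kA : forall x : V, A < `|x| -> k (x, 0) = 0).

Let ck : continuous k.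
Proof. by apply: Csmooth_continuous; case: tk. Qed.

Lemma mollify_shift q : mollify f k q = int3 (fun x => f (x + q.1) * k (x, 0)).
Proof.
have [B B0 kB] := test_fun_radius tk.
have s := mollify_csupp cf ck kB (lexx (B + `|q.1|)).
have [b bq] := pt3_surj q.1.
rewrite /mollify -(int3_shift b s) bq; congr int3; apply/funext => x.
by rewrite addrK.
Qed.

Lemma csupp_kernel (g : V -> R) : continuous g -> csupp (fun x => g x * k (x, 0)) A.
Proof.
move=> cg; split=> [|x Ax]; last by rewrite kA// mulr0.
by apply: continuous_mul => //; exact: continuous_slice1.
Qed.

Lemma continuous_translate (g : V -> R) (b : V) : continuous g -> continuous (fun x : V => g (x + b)).
Proof.
move=> cg x; have cadd : {for x, continuous (fun y : V => y + b)}.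
  exact: (cvgD cvg_id (cvg_cst _)).
exact: (continuous_comp cadd (cg _)).
Qed.

Lemma mollify_le q c : (forall x, `|x| <= A -> f (x + q.1) <= c) ->
  mollify f k q <= c * int3 (fun x => k (x, 0)).
Proof.
move=> fc; rewrite mollify_shift.
have s1 := csupp_kernel (@continuous_translate _ q.1 cf).
have s2 : csupp (fun x => k (x, 0)) A.
  by split => //; exact: continuous_slice1.
rewrite -(int3_scale c s2); apply: int3_le s1 (csupp_scale c s2) _ => x.
have [xA|xA] := leP `|x| A; last by rewrite kA// !mulr0.
by rewrite ler_wpM2r// fc.
Qed.

Lemma mollify_ge q c : (forall x, `|x| <= A -> c <= f (x + q.1)) ->
  c * int3 (fun x => k (x, 0)) <= mollify f k q.
Proof.
move=> fc; rewrite mollify_shift.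
have s1 := csupp_kernel (@continuous_translate _ q.1 cf).
have s2 : csupp (fun x => k (x, 0)) A.
  by split => //; exact: continuous_slice1.
rewrite -(int3_scale c s2); apply: int3_le (csupp_scale c s2) s1 _ => x.
have [xA|xA] := leP `|x| A; last by rewrite kA// !mulr0.
by rewrite ler_wpM2r// fc.
Qed.

(** After a change of variables the kernel no longer moves with q, so Fubini exchanges it with the
    circle integral, and k >= 0 preserves the inequality for f. *)
Lemma mollify_submean (q a b : C3) (r : R) :
  (forall x, `|x| <= A -> 2 * pi * f (x + q.1) <=
     \int[mu]_(t in circ) f (x + (polar q a b (r, t)).1)) ->
  2 * pi * mollify f k q <= \int[mu]_(t in circ) mollify f k (polar q a b (r, t)).
Proof.
move=> sub.
pose c t := (polar q a b (r, t)).1.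
have cc : continuous c.
  move=> t; apply: (@continuous_comp _ _ _ (fun t => polar q a b (r, t)) fst); last exact: cvg_fst.
  apply: (@continuous_comp _ _ _ (fun t => (r, t)) (polar q a b)); last exact: polar_continuous.
  by apply: (@cvg_pair _ _ _ _ (nbhs r) (nbhs t)); [exact: cvg_cst|exact: cvg_id].
pose F (y : V * R) := f (y.1 + c y.2) * k (y.1, 0).
have c1 : continuous (fun y : V * R => y.1) by move=> y; exact: cvg_fst.
have c2 : continuous (fun y : V * R => c y.2).
  by apply: continuous_compose cc _ => y; exact: cvg_snd.
have cf1 : continuous (fun y : V * R => f (y.1 + c y.2)).
  exact: continuous_compose cf (continuous_add c1 c2).
have ck1 : continuous (fun y : V * R => k (y.1, 0)).
  have ck0 : continuous (fun y : V => k (y, 0)) by exact: continuous_slice1.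
  exact: continuous_compose ck0 c1.
have cF : continuous F by exact: continuous_mul cf1 ck1.
have F0 x t : A < `|x| -> F (x, t) = 0 by move=> xA; rewrite /F /= kA ?mulr0.
have [iC E] := int3_circle cF F0.
have -> : \int[mu]_(t in circ) mollify f k (polar q a b (r, t)) =
    \int[mu]_(t in circ) int3 (fun x => F (x, t)).
  by apply: eq_Rintegral => t _; rewrite mollify_shift.
rewrite -E mollify_shift.
have s1 := csupp_kernel (@continuous_translate _ q.1 cf).
rewrite -(int3_scale _ s1); apply: le_Rintegral => //.
  exact: (csupp_integrable (csupp_scale _ s1)).
move=> z _; rewrite /F /=; move: (pt3 z) => x.
have cfx : continuous (fun t => f (x + c t)).
  by apply: continuous_compose cf (continuous_add _ cc); exact: cst_continuous.
rewrite RintegralZr//; last first.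
  by apply: integrable_continuous.
rewrite mulrA; have [xA|xA] := leP `|x| A; last by rewrite kA// !mulr0.
by rewrite ler_wpM2r// sub.
Qed.

End MollifyPsh.

(** * Smooth approximation over a large ball *)

Section SmoothApproximation.
Context {R : realType}.
Notation C3 := (C3 R).
Notation V := 'rV[R]_3.

Lemma continuous_usc (f : V -> R) : continuous f -> usc_on setT (EFin \o f).
Proof.
move=> cf x _ a /=; rewrite lte_fin => fa.
have op : open [set y | f y < a].
  apply: (@open_comp _ _ f [set t | t < a]) => [y _|]; first exact: cf.
  exact: open_lt.
change (nbhs x [set y | setT y -> ((f y)%:E < a%:E)%E]).
by apply: filterS (open_nbhs_nbhs (conj op fa)) => y /= ? _; rewrite lte_fin.
Qed.

Lemma MPsh_smooth_approx (u : V -> \bar R) (K : set V) (x0 : V)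
    (rho c c' c2 c2' : R) : MPsh setT u ->
  compact K -> 0 <= rho -> (forall x, K x -> `|x| <= rho) -> `|x0| <= rho ->
  (forall x, K x -> (u x < c%:E)%E) -> (c2%:E <= u x0)%E -> c < c' -> c2' < c2 ->
  exists w : C3 -> R, [/\ Csmooth w,
    (forall x y y', w (x, y) = w (x, y')),
    (forall x y, K x -> w (x, y) <= c'),
    (forall y, c2' <= w (x0, y)) &
    (forall q v, null_vector v -> `|q.1| <= rho -> 0 <= lap v (J v) w q)].
Proof.
move=> Hu kK rho0 Krho x0rho uc ux0 cc' cc2.
have rho1 : rho <= rho + 1 by rewrite lerDl.
have rho10 : 0 <= rho + 1 by exact: le_trans rho1.
(* The radius is rho + 1 because the mollifier averages over translates by at most 1. *)
have [f [cf fK fx0 sub]] := MPsh_continuous_approx Hu kK rho10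
  (fun x Kx => le_trans (Krho x Kx) rho1) (le_trans x0rho rho1) uc ux0.
have [d1 d10 Hd1] : exists2 d : R, 0 < d & forall x z, K x -> `|z - x| <= d -> f z <= c'.
  have [|d d0 Hd] := @usc_compact_lt _ _ _ (EFin \o f) c' kK (continuous_usc cf).
    by move=> x /fK fx; rewrite /= lte_fin (le_lt_trans fx).
  by exists d => // x z Kx zx; have := Hd x z Kx zx; rewrite /= lte_fin => /ltW.
have [d2 d20 Hd2] : exists2 d : R, 0 < d & forall z, `|z - x0| <= d -> c2' <= f z.
  have kx0 : compact [set x0] by exact: compact_set1.
  have cf' : continuous (fun x => -1 * f x).
    by apply: continuous_mul cf; exact: cst_continuous.
  have [|d d0 Hd] := @usc_compact_lt _ _ [set x0] (EFin \o (fun x => -1 * f x)) (- c2')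
      kx0 (continuous_usc cf').
    by move=> x ->; rewrite /= lte_fin mulN1r ltrN2 (lt_le_trans cc2).
  by exists d => // z zx; have := Hd x0 z erefl zx; rewrite /= lte_fin mulN1r ltrN2 => /ltW.
pose d := Num.min 1 (Num.min d1 d2).
have d0 : 0 < d by rewrite !lt_min ltr01 d10 d20.
have d_le1 : d <= 1 by rewrite ge_min lexx.
have d_led1 : d <= d1 by rewrite !ge_min lexx !orbT.
have d_led2 : d <= d2 by rewrite !ge_min lexx !orbT.
(* It vanishes beyond radius d / sqrt(2) < d. *)
pose b : C3 -> R := ballbump 0 (d / 2).
have d20' : 0 < d / 2 by rewrite divr_gt0.
have b0 p : 0 <= b p by exact: cutoff_ge0.
have tb : test_fun b by exact: test_fun_ballbump.
have sqE (x : V) : sqx (0 : C3) (x, 0 : V) + sqy (0 : C3) (x, 0 : V) = dot x x.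
  by rewrite /sqx /sqy /= !subr0 (_ : dot 0 0 = 0) ?addr0// /dot big1// => j _; rewrite !mxE mul0r.
have bA (x : V) : d < `|x| -> b (x, 0) = 0.
  move=> xd; apply: ballbump_out => //; rewrite sqE ltNge; apply/negP => H.
  have : `|x| <= d.
    apply: norm_le_sqrt_dot => //; first exact: ltW.
    apply: le_trans H _; have := sqr_ge0 d; rewrite !expr2; lra.
  by rewrite leNgt xd.
have cb : continuous b by apply: Csmooth_continuous; case: tb.
have sb : csupp (fun x : V => b (x, 0)) d by split => //; exact: continuous_slice1.
have Ib : 0 < int3 (fun x : V => b (x, 0)).
  (* The bump is 1 here since 3 (d / 4)^2 <= (d / 2)^2, the 3 comparing the Euclidean with the
     maximum norm. *)
  apply: (int3_gt0 (a := d / 4) sb) => // [|x xd]; first by rewrite divr_gt0.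
  apply: ballbump_in => //; rewrite sqE.
  have : dot x x <= 3 * (d / 4) ^+ 2.
    by apply: (le_trans (dot_le_norm x)); rewrite ler_wpM2l// ler_pXn2r ?nnegrE// ltW// divr_gt0.
  by have := sqr_ge0 d; rewrite !expr2; lra.
pose I := int3 (fun x : V => b (x, 0)).
pose k p := I^-1 * b p.
have I0 : 0 <= I^-1 by rewrite invr_ge0 ltW.
have k0 p : 0 <= k p by rewrite mulr_ge0.
have kA (x : V) : d < `|x| -> k (x, 0) = 0 by move=> /bA xd; rewrite /k xd mulr0.
have tk : test_fun k.
  have := test_fun_lin I^-1 tb test_fun0; congr test_fun.
  by apply/funext => p; rewrite addr0.
have Ik : int3 (fun x : V => k (x, 0)) = 1.
  by rewrite /k (int3_scale _ sb) mulVf// gt_eqF.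
exists (mollify f k); split.
- exact: Csmooth_mollify.
- by [].
- move=> x y Kx; rewrite -[c']mulr1 -Ik; apply: (mollify_le cf tk k0 kA) => z zd.
  by apply: (Hd1 x) => //=; rewrite addrK (le_trans zd).
- move=> y; rewrite -[c2']mulr1 -Ik; apply: (mollify_ge cf tk k0 kA) => z zd.
  by apply: Hd2 => //=; rewrite addrK (le_trans zd).
- move=> q v nv qrho.
  have [esqE vv0] := null_vector_esq nv.
  have e0 : 0 < esq v by rewrite esqE mulr_gt0.
  have [v0 vv vw] := (null_vectorP v).1 nv.
  have vJ0 : 0 < `|v.1| + `|v.2|.
    apply: ltr_pwDl => //; rewrite normr_gt0; apply: contraTneq vv0 => ->.
    by rewrite /dot big1 ?ltxx// => j _; rewrite mxE mul0r.
  (* The comparison function is |x - q.1|^2: its Laplacian is 2 |v|^2, and it equals r^2 |v.1|^2 on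
     the circle of radius r, as v.1 and v.2 are orthogonal of equal length. *)
  apply: (@lap_ge0_of_submean _ _ v (J v) q (mollify f k) (sqx q) (2 * esq v)
    (dot v.1 v.1) (`|v.1| + `|v.2|)^-1).
  + exact: Csmooth_mollify.
  + exact: Csmooth_sqx.
  + by rewrite mulr_gt0.
  + by [].
  + by rewrite invr_gt0.
  + by move=> p; rewrite lap_sqx.
  + move=> r t; rewrite /sqx /polar /rot /= addrK.
    rewrite dotZl dotZr !dotDl !dotDr !dotZl !dotZr !dotNl !dotNr (dotC v.2) vw -vv.
    have := cos2Dsin2 t; set C := cos t; set S := sin t => CS.
    transitivity (r ^+ 2 * ((C ^+ 2 + S ^+ 2) * dot v.1 v.1)); first by ring.
    by rewrite CS mul1r.
  + move=> r /andP[r0 rr]; apply: (mollify_submean cf tk k0 kA) => x xd.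
    apply: (@le_trans _ _ (\int[@lebesgue_measure R]_(t in `[0%R, (2 * pi)%R])
        f (x + q.1 + ((r * cos t) *: v.1 + (r * sin t) *: (- v.2))))).
      apply: sub => //.
      * by rewrite (le_trans (ler_normD _ _))// addrC lerD// (le_trans xd).
      * by move: vv0; apply: contraTneq => ->; rewrite /dot big1 ?ltxx// => j _; rewrite mxE mul0r.
      * by rewrite dotNr vw oppr0.
      * by rewrite dotNl dotNr opprK.
      * by rewrite normrN -ler_pdivlMr// mul1r.
    rewrite le_eqVlt; apply/orP; left; apply/eqP; apply: eq_Rintegral => t _; congr f.
    by rewrite /polar /rot /= scalerDr !scalerA -addrA (addrC q.1).
Qed.

End SmoothApproximation.

(** * Barriers *)

Section Upper.
Context {R : realType}.
Notation C3 := (C3 R).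
Notation V := 'rV[R]_3.

Lemma lap_local (W : normedModType R) (O : set W) (f g : W -> R) (a b q : W) :
  open O -> O q -> Csmooth f -> Csmooth g -> (forall p, O p -> f p = g p) ->
  lap a b f q = lap a b g q.
Proof.
move=> oO Oq sf sg fg; pose h p := -1 * g p + f p.
have sg' : Csmooth (fun p => -1 * g p) by exact: Csmooth_scale.
have h0 p : O p -> h p = 0 by move=> Op; rewrite /h fg// mulN1r addNr.
have := lapD a b q sg' sf; rewrite (lapZ a b (-1) q sg).
have dh v p : O p -> dd v h p = 0 by move=> Op; exact: (near_dd v oO Op h0).
have -> : lap a b (fun p => -1 * g p + f p) q = 0.
  by rewrite lapE (near_dd a oO Oq (dh a)) (near_dd b oO Oq (dh b)) addr0.
by move=> /eqP; rewrite eq_sym mulN1r addrC subr_eq0 => /eqP.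
Qed.

(** T(beta) <= 0 forces T <= 0 on the bump times [omega]. That form dominates both alpha and -
    alpha, up to a constant, for every alpha supported near q0, so T(alpha) = 0. *)
Lemma strictly_positive_out (T : field2 R -> R) (q0 : C3) (beta : field2 R) (c d : R) :
  test_linear T -> null_positive_current T -> test_form2 beta -> T beta <= 0 ->
  0 < c -> 0 < d ->
  (forall q v, null_vector v -> c * ballbump q0 d q * esq v <= beta q v (J v)) ->
  ~ current_supp T q0.
Proof.
move=> Tlin Tp tb Tb c0 d0 H q0T.
have tbump := test_fun_ballbump q0 d0.
have tw := test_form2_omega tbump.
have Tw : T (fun q v w => ballbump q0 d q * omega q v w) <= 0.
  have h : T (fun q v w => c * (ballbump q0 d q * omega q v w)) <= T beta.
    apply: current_le => // [|q v nv].
      exact: (test_form2_mul (Csmooth_cst c) tw).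
    by rewrite omegaJ mulrA H.
  by move: (le_trans h Tb); rewrite current_scale// pmulr_rle0.
have oU : open [set q | sqx q0 q + sqy q0 q < d ^+ 2].
  apply: (@open_comp _ _ (fun q => sqx q0 q + sqy q0 q) [set t | t < d ^+ 2]).
    move=> q _; apply: Csmooth_continuous.
    by apply: Csmooth_add; [exact: Csmooth_sqx|exact: Csmooth_sqy].
  exact: open_lt.
have [|alpha [ta sa /eqP]] := q0T _ oU.
  by rewrite /= sqx_center sqy_center addr0 exprn_gt0.
apply; have [C C0 HC] := test_form_bounded ta.
have cw : test_form2 (fun q v w => C * (ballbump q0 d q * omega q v w)).
  exact: (test_form2_mul (Csmooth_cst C) tw).
have aC q v : `|alpha q v (J v)| <= C * (ballbump q0 d q * omega q v (J v)).
  have [sq|nsq] := pselect (form_supp alpha q).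
    rewrite ballbump_in// ?mul1r ?omegaJ//.
    exact: ltW (sa _ sq).
  rewrite form_supp_out// normr0 omegaJ; apply: mulr_ge0 => //.
  by apply: mulr_ge0; [exact: cutoff_ge0|exact: esq_ge0].
have tN : test_form2 (fun q v w => -1 * alpha q v w).
  exact: (test_form2_mul (Csmooth_cst (-1)) ta).
have C1 : T alpha <= 0.
  apply: (@le_trans _ _ (T (fun q v w => C * (ballbump q0 d q * omega q v w)))).
    by apply: current_le => // q v _; exact: le_trans (ler_norm _) (aC _ _).
  by rewrite current_scale// mulr_ge0_le0.
have C2 : - T alpha <= 0.
  rewrite -mulN1r -current_scale//.
  apply: (@le_trans _ _ (T (fun q v w => C * (ballbump q0 d q * omega q v w)))).
    apply: current_le => // q v _; rewrite mulN1r; apply: le_trans (aC _ _).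
    by rewrite -normrN ler_norm.
  by rewrite current_scale// mulr_ge0_le0.
by apply/eqP; rewrite eq_le C1 -oppr_le0.
Qed.

(* [psi] is a positive multiple of 2|x - x0|^2 - |y - y0|^2 added to w - c0: its
   Levi form on null vectors is positive, and psi < 0 for large |y|. *)
Lemma barrier (w : C3 -> R) (K : set V) (q0 : C3) (s m c0 D : R) :
  Csmooth w -> (forall x y y', w (x, y) = w (x, y')) -> 0 < s -> 0 < m -> 0 <= D ->
  (forall q, tube K q -> w q <= c0 - m) -> (forall q, tube K q -> sqx q0 q <= D) ->
  c0 + m <= w q0 ->
  (forall q v, null_vector v -> sqx q0 q < 2 * s -> 0 <= lap v (J v) w q) ->
  exists (phi : C3 -> R) (c d : R),
    [/\ test_fun phi /\ (forall q, 0 <= phi q), fun_supp phi `<=` ~` tube K,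
      0 < c /\ 0 < d, (forall q, ballbump q0 d q != 0 -> sqx q0 q <= s) &
      (forall q v, null_vector v -> sqx q0 q < 2 * s ->
         c * ballbump q0 d q * esq v <= ddc phi q v (J v))].
Proof.
move=> sw wx s0 m0 D0 wK DK wq0 lw.
(* Chosen so that 2 e D < m: over K the term 2 e |x - x0|^2 does not use up the gap m. *)
pose e := m / (2 * (D + 1)).
have D1 : 0 < D + 1 by rewrite ltr_wpDl.
have e0 : 0 < e by rewrite divr_gt0// mulr_gt0.
have eD : 2 * e * D < m.
  have -> : 2 * e * D = m - 2 * e by rewrite /e; field; rewrite gt_eqF.
  by rewrite gtrBl mulr_gt0.
pose top q := w q + (2 * e) * sqx q0 q + (- c0).
pose psi q := top q + (- e) * sqy q0 q.
have s1 : Csmooth (fun q => (2 * e) * sqx q0 q) by apply/Csmooth_scale/Csmooth_sqx.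
have s2 : Csmooth (fun q => (- e) * sqy q0 q) by apply/Csmooth_scale/Csmooth_sqy.
have s3 : Csmooth (fun q => w q + (2 * e) * sqx q0 q) by exact: Csmooth_add.
have stop : Csmooth top by apply: Csmooth_add s3 (Csmooth_cst _).
have spsi : Csmooth psi by exact: Csmooth_add.
have lpsi q v : lap v (J v) psi q = lap v (J v) w q + 2 * e * esq v.
  rewrite (lapD v (J v) q stop s2) (lapD v (J v) q s3 (Csmooth_cst _)).
  rewrite (lapD v (J v) q sw s1) (lapZ _ _ _ q (Csmooth_sqx q0)).
  by rewrite (lapZ _ _ _ q (Csmooth_sqy q0)) lap_cst lap_sqx lap_sqy; ring.
(* Equal to 1 where |x - x0|^2 <= 2 s, the region where the Levi form of w is controlled, and 0
   beyond 4 s. *)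
pose chi := cutoff (fun q => (2 * s)^-1 * sqx q0 q).
have schi : Csmooth chi by apply/Csmooth_cutoff/Csmooth_scale/Csmooth_sqx.
have s20 : 0 < 2 * s by rewrite mulr_gt0.
pose phi q := chi q * cvx (psi q).
have scp : Csmooth (fun q => cvx (psi q)) by apply: Csmooth_comp => //; exact: Csmooth_cvx.
have sphi : Csmooth phi by exact: Csmooth_mul.
(* As w does not depend on y, a bound on the compact slice y = y0 holds on the whole cylinder. *)
have [W0 HW] : exists W, forall q, sqx q0 q <= 4 * s -> w q <= W.
  have kK0 := compact_sqx_sqy (a := q0) (A := 4 * s) (B := 0).
  have /compact_bounded[M [_ HM]] : compact (w @` [set q | sqx q0 q <= 4 * s /\ sqy q0 q <= 0]).
    by apply: continuous_compact kK0; exact/continuous_subspaceT/Csmooth_continuous.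
  exists (`|M| + 1) => -[x y] qs; rewrite (wx x y q0.2).
  apply: (le_trans (ler_norm _)); apply: (HM (`|M| + 1)).
    by rewrite (le_lt_trans (ler_norm M))// ltrDl.
  exists (x, q0.2) => //; split=> //; rewrite /sqy /= subrr.
  by rewrite /dot big1// => j _; rewrite mxE mul0r.
(* Beyond this bound on |y - y0|^2 the term - e |y - y0|^2 makes psi negative, so phi has compact
   support in y as well. *)
pose F := [set q | sqx q0 q <= 4 * s /\ sqy q0 q <= (W0 + 2 * e * (4 * s) - c0) / e].
have phiF q : ~ F q -> phi q = 0.
  move=> nF; have [lo|hi] := leP (sqx q0 q) (4 * s).
    have {}nF : (W0 + 2 * e * (4 * s) - c0) / e < sqy q0 q.
      by rewrite ltNge; apply/negP => h; apply: nF.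
    rewrite /phi cvx_eq0 ?mulr0//.
    move: nF; rewrite ltr_pdivrMr// => nF.
    have h1 := HW _ lo.
    have h2 : 2 * e * sqx q0 q <= 2 * e * (4 * s) by rewrite ler_pM2l// mulr_gt0.
    rewrite /psi /top mulNr; move: nF h1 h2.
    move: (2 * e * sqx _ _) (2 * e * (4 * s)) (w q); rewrite mulrC; move: (e * _) => X Y Z U.
    lra.
  rewrite /phi (_ : chi q = 0) ?mul0r//; apply: cutoff_eq0.
  by rewrite mulrC ler_pdivlMr// mulrA (_ : 2 * 2 = 4) ?ltW//; ring.
have kF : compact F by exact: compact_sqx_sqy.
have tphi : test_fun phi.
  apply: (test_fun_in sphi _ kF phiF).
  by apply: compact_closed kF; exact: norm_hausdorff.
have psi0 : psi q0 = w q0 - c0.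
  by rewrite /psi /top sqx_center sqy_center; ring.
(* As psi(q0) >= m, this is a neighbourhood of q0, and cvx'(psi) >= cvx'(m / 2) on it. *)
pose U := [set q | m / 2 < psi q] `&` [set q | sqx q0 q < s].
have oU : open U.
  apply: openI.
    apply: (@open_comp _ _ psi [set t | m / 2 < t]); last exact: open_gt.
    by move=> q _; exact: Csmooth_continuous.
  apply: (@open_comp _ _ (sqx q0) [set t | t < s]); last exact: open_lt.
  by move=> q _; apply: Csmooth_continuous; exact: Csmooth_sqx.
have Uq0 : U q0.
  split; rewrite /= ?sqx_center// psi0; move: wq0 m0; lra.
have [d d0 Hd] := small_sqball oU Uq0.
have bU q : ballbump q0 d q != 0 -> U q.
  by move=> bq; apply: Hd => /=; rewrite leNgt; apply: contra bq => h; rewrite ballbump_out.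
have k0 : 0 < 'D_1 cvx (m / 2) by apply: dcvx_gt0; rewrite divr_gt0.
exists phi, ('D_1 cvx (m / 2) * (2 * e)), d; split.
- by split=> // q; rewrite mulr_ge0 ?cutoff_ge0 ?cvx_ge0.
(* A closed support needs an open neighbourhood of the tube on which phi vanishes; [top] bounds psi
   from above and is negative on the tube. *)
- have oO : open [set q | top q < 0].
    apply: (@open_comp _ _ top [set t | t < 0]); last exact: open_lt.
    by move=> q _; exact: Csmooth_continuous.
  have sub : fun_supp phi `<=` ~` [set q | top q < 0].
    apply: supp_sub_fun; first by rewrite closedC.
    move=> q /contrapT /= tq; rewrite /phi cvx_eq0 ?mulr0// /psi mulNr.
    by rewrite subr_le0 (le_trans (ltW tq))// mulr_ge0 ?sqy_ge0// ltW.
  move=> q /sub /= ntop Kq; apply: ntop; rewrite /= /top.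
  have h2 : 2 * e * sqx q0 q <= 2 * e * D.
    by apply: ler_wpM2l; [rewrite mulr_ge0// ltW|exact: DK].
  have := wK q Kq; move: h2 eD.
  move: (2 * e * sqx _ _) (2 * e * D) (w q) => X Y Z; lra.
- by split=> //; apply: mulr_gt0 => //; exact: mulr_gt0.
- by move=> q /bU[_ /ltW].
- move=> q v nv qs; rewrite ddcJ//.
  have -> : lap v (J v) phi q = lap v (J v) (fun p => cvx (psi p)) q.
    apply: (@lap_local _ [set p | sqx q0 p < 2 * s]) => // [|p /= ps].
      apply: (@open_comp _ _ (sqx q0) [set t | t < 2 * s]); last exact: open_lt.
      by move=> p _; apply: Csmooth_continuous; exact: Csmooth_sqx.
    rewrite /phi (_ : chi p = 1) ?mul1r//; apply: cutoff_eq1.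
    by rewrite mulrC ler_pdivrMr// mul1r ltW.
  apply: le_trans (lap_cvx_ge v (J v) q spsi); rewrite lpsi.
  have lw0 := lw q v nv qs.
  have e2 : 0 <= 2 * e * esq v.
    by apply: mulr_ge0; [rewrite mulr_ge0// ltW|exact: esq_ge0].
  have dc0 : 0 <= 'D_1 cvx (psi q) by exact: dcvx_ge0.
  apply: (@le_trans _ _ ('D_1 cvx (psi q) * (2 * e * esq v))); last first.
    by rewrite ler_wpM2l// lerDr.
  have -> : 'D_1 cvx (m / 2) * (2 * e) * ballbump q0 d q * esq v =
      ('D_1 cvx (m / 2) * ballbump q0 d q) * (2 * e * esq v) by ring.
  apply: ler_wpM2r; first exact: e2.
  have [b0|/bU[mq _]] := eqVneq (ballbump q0 d q) 0.
    by rewrite b0 mulr0.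
  apply: (@le_trans _ _ ('D_1 cvx (m / 2))).
    by apply: ler_piMr; [exact: ltW|exact: cutoff_le1].
  by apply: dcvx_nondecr; exact: ltW.
Qed.

Lemma hull_sub_minimal (K : set V) : compact K ->
  current_null_hull (tube K) `<=` tube (minimal_hull K).
Proof.
move=> kK q0 [T [[Tlin Tcont T11] Tp Tmass Tbnd Tddc] q0T]; split=> //= u uP.
rewrite leNgt; apply/negP => lt_u; have [uoo _ _] := uP.
have [r ur] : exists r, u q0.1 = r%:E.
  move: lt_u (uoo q0.1 I); case: (u q0.1) => [r| |] //; first by exists r.
  by rewrite ltNge leNye.
have [c cr uc] : exists2 c, c < r & forall x, K x -> (u x < c%:E)%E.
  move: lt_u; rewrite ur; case E : (ereal_sup _) => [t| |] //.
    rewrite lte_fin => tr; exists ((t + r) / 2); first by rewrite midf_lt.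
    move=> x Kx; apply: (@le_lt_trans _ _ t%:E); last by rewrite lte_fin midf_lt.
    by rewrite -E; apply: ereal_sup_ubound; exists x.
  move=> _; exists (r - 1); first by rewrite ltrBlDr ltrDl.
  move=> x Kx; apply: (@le_lt_trans _ _ -oo%E); last exact: ltNyr.
  by rewrite -E; apply: ereal_sup_ubound; exists x.
have [M M0 HM] : exists2 M, 0 <= M & forall q, current_supp T q -> `|q.1| <= M.
  case: Tbnd => M [_ HM]; exists (`|M| + 1) => [|q qT]; first by rewrite addr_ge0.
  apply: (HM (`|M| + 1)); last by exists q.
  by rewrite (le_lt_trans (ler_norm M))// ltrDl.
have [MK MK0 HMK] : exists2 MK, 0 <= MK & forall x, K x -> `|x| <= MK.
  have /compact_bounded[N [_ HN]] := kK; exists (`|N| + 1) => [|x Kx].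
    by rewrite addr_ge0.
  by apply: (HN (`|N| + 1)) => //; rewrite (le_lt_trans (ler_norm N))// ltrDl.
have Mq0 := HM _ q0T.
have sqM q B : `|q.1| <= B -> sqx q0 q <= 3 * (B + M) ^+ 2.
  move=> qB; apply: (le_trans (dot_le_norm _)); apply: ler_wpM2l => //.
  have h : `|q.1 - q0.1| <= B + M by rewrite (le_trans (ler_normB _ _))// lerD.
  by rewrite ler_pXn2r// nnegrE// (le_trans _ h).
(* The first summand bounds |x - x0|^2 on the support of T. The 1 separates the support from {|x -
   x0|^2 >= s} and gives s >= 1. *)
pose s := 3 * (M + M) ^+ 2 + 1.
have s1 : 1 <= s by rewrite lerDr mulr_ge0// sqr_ge0.
have s0 : 0 < s by exact: lt_le_trans s1.
(* Covers K, x0 and the region |x - x0|^2 < 2 s, where |x - x0| <= 2 s because s >= 1. *)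
pose rho := M + 2 * s + MK.
have rho0 : 0 <= rho by rewrite !addr_ge0// mulr_ge0// ltW.
(* Four equal steps from c to r: one is lost on K, one at x0, and the threshold c + 2 m lies at
   distance m from both new values. *)
pose m := (r - c) / 4.
have m0 : 0 < m by rewrite divr_gt0// subr_gt0.
have [|||||w [sw wx wK wq0 lw]] := @MPsh_smooth_approx _ u K q0.1 rho c (c + m) r (c + 3 * m)
    uP kK rho0 _ _ uc.
- move=> x /HMK xM; apply: le_trans xM _; rewrite /rho lerDr addr_ge0//.
  by rewrite mulr_ge0// ltW.
- by apply: le_trans Mq0 _; rewrite /rho -addrA lerDl addr_ge0// mulr_ge0// ltW.
- by rewrite ur.
- by rewrite ltrDl.
- by rewrite /m; move: cr; lra.
have D0 : 0 <= 3 * (MK + M) ^+ 2 by rewrite mulr_ge0// sqr_ge0.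
have [||||phi [k [d [[tphi phi0] phiK [k0 d0] bs lb]]]] :=
  @barrier w K q0 s m (c + 2 * m) (3 * (MK + M) ^+ 2) sw wx s0 m0 D0.
- move=> [x y] [/= Kx _]; apply: le_trans (wK x y Kx) _; lra.
- by move=> q [/HMK /sqM].
- have := wq0 q0.2; rewrite -surjective_pairing; apply: le_trans; lra.
- move=> q v nv qs; apply: lw => //.
  have h : `|q.1 - q0.1| <= 2 * s.
    apply: norm_le_sqrt_dot; first by rewrite mulr_ge0// ltW.
    apply: (le_trans (ltW qs)); rewrite expr2 ler_peMl//; last by move: s1; lra.
    by rewrite mulr_ge0// ltW.
  rewrite -(subrK q0.1 q.1) (le_trans (ler_normD _ _))// /rho addrC.
  by apply: (@le_trans _ _ (M + 2 * s)); [exact: lerD|rewrite lerDl].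
(* Positivity of ddc phi is known only for |x - x0|^2 < 2 s, whereas null positivity of T asks for
   it everywhere; theta removes the rest. *)
pose theta := cutoff (fun q => s^-1 * sqx q0 q).
have stheta : Csmooth theta by apply/Csmooth_cutoff/Csmooth_scale/Csmooth_sqx.
have theta1 q : sqx q0 q <= s -> theta q = 1.
  by move=> qs; apply: cutoff_eq1; rewrite mulrC ler_pdivrMr// mul1r.
have theta0 q : theta q != 0 -> sqx q0 q < 2 * s.
  by move=> h; have := cutoff_neq0 h; rewrite mulrC ltr_pdivrMr.
have td := test_form2_ddc tphi.
have ttd := test_form2_mul stheta td.
(* The two forms differ only where |x - x0|^2 >= s, away from the support of T. *)
have E : T (ddc phi) = T (fun q v w => theta q * ddc phi q v w).
  apply/eqP; rewrite -subr_eq0 -(current_sub Tlin td ttd); apply/eqP.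
  apply: (current_supp_out Tlin).
    have := test_form2_lin (-1) ttd td; congr test_form2.
    by apply/funext => q; apply/funext => v; apply/funext => z; rewrite mulN1r addrC.
  have cF : closed [set q | s <= sqx q0 q].
    apply: (@preimage_closed _ _ (sqx q0) [set t | s <= t]); last exact: closed_ge.
    by move=> q _; apply: Csmooth_continuous; exact: Csmooth_sqx.
  move=> q /(supp_sub_form cF) h qT; have /= {}h : s <= sqx q0 q.
    apply: h => p v z /negP; rewrite -ltNge => /ltW /theta1 ->.
    by rewrite mul1r subrr.
  have := sqM q M (HM q qT); rewrite leNgt => /negP; apply.
  by apply: lt_le_trans h; rewrite /s ltrDl.
apply: (strictly_positive_out Tlin Tp ttd _ k0 d0 _ q0T).
  by rewrite -E; apply: Tddc.
move=> q v nv; have [qs|qs] := ltP (sqx q0 q) (2 * s); last first.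
  have -> : theta q = 0.
    by apply/eqP; apply/negPn/negP => /theta0; rewrite ltNge qs.
  rewrite mul0r (_ : ballbump q0 d q = 0) ?mulr0 ?mul0r//.
  apply/eqP/negPn/negP => /bs h; have := le_trans qs h.
  by rewrite leNgt => /negP; apply; rewrite ltr_pMl// ltr1n.
have [b0|/bs h] := eqVneq (ballbump q0 d q) 0; last by rewrite theta1// mul1r lb.
rewrite b0 mulr0 mul0r; apply: mulr_ge0; first exact: cutoff_ge0.
by have := lb q v nv qs; rewrite b0 mulr0 mul0r.
Qed.

End Upper.

Theorem corollary6p8 (R : realType) (K : set 'rV[R]_3) (hK : compact K) :
  current_null_hull (tube K) = tube (minimal_hull K).
Proof.
by apply/seteqP; split; [exact: hull_sub_minimal|exact: minimal_hull_sub].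
Qed.
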